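(* Let $\mathbf{p}_j,\mathbf{p}_k\in\mathfrak{Z}$ be distinct and let $\gamma_*\in Lip_{\mathfrak{Z}}(\mathbf{p}_j,\mathbf{p}_k)$ be a minimizing geodesic. Let $0=t_1<t_2<\dots<t_J=1$ (with $J\ge 2$) be the times $t\in[0,1]$ at which $\gamma_*(t)\in\mathfrak{Z}$, so that in particular $\gamma_*(t_1)=\mathbf{p}_j$ and $\gamma_*(t_J)=\mathbf{p}_k$. Then for every $i\in\{1,\dots,J-1\}$ there exists an $H$-minimizing heteroclinic connection between the wells $\gamma_*(t_i)$ and $\gamma_*(t_{i+1})$.
   Context: Let $N\ge 2$, $m\ge 2$, and let $W:\mathbb{R}^N\to[0,\infty)$ be a continuous function such that: (i) its zero set is $\mathfrak{Z}=\{\mathbf{p}_1,\dots,\mathbf{p}_m\}$, consisting of $m$ distinct points (the wells), and $W>0$ elsewhere; (ii) $\liminf_{|p|\to\infty}W(p)>0$; (iii) $W\in C^{1,\alpha}_{loc}(\mathbb{R}^N\setminus\mathfrak{Z})$ for some $\alpha\in(0,1)$; (iv) there are positive numbers $C,\delta$ such that $W(p)\le C|p-\mathbf{p}_j|^2$ whenever $|p-\mathbf{p}_j|<\delta$, $j=1,\dots,m$. (By (iv), $W$ is differentiable at each $\mathbf{p}_j$ with zero gradient, so $\nabla W$ is defined everywhere.) Set $F:=\sqrt{W}$. For a continuous curve $\gamma:[0,1]\to\mathbb{R}^N$ put $\mathcal{T}_\gamma:=\{t\in[0,1]:\gamma(t)\in\mathfrak{Z}\}$. The class $Lip_{\mathfrak{Z}}([0,1];\mathbb{R}^N)$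 consists of all continuous $\gamma:[0,1]\to\mathbb{R}^N$ that are locally Lipschitz (Euclidean metric) on $[0,1]\setminus\mathcal{T}_\gamma$; $Lip_{\mathfrak{Z}}(p,q)$ is the subset of those with $\gamma(0)=p$, $\gamma(1)=q$. Define $E(\gamma):=\int_0^1F(\gamma(t))|\gamma'(t)|\,dt\in[0,\infty]$ (integrand taken to be $0$ for $t\in\mathcal{T}_\gamma$) and the metric $d(p,q):=\inf\{E(\gamma):\gamma\in Lip_{\mathfrak{Z}}(p,q)\}$ on $\mathbb{R}^N$. The length $L(\gamma)$ of a curve is the supremum of $\sum_{j=0}^{n-1}d(\gamma(s_j),\gamma(s_{j+1}))$ over finite partitions $0=s_0<\dots<s_n=1$. A minimizing geodesic between distinct $p,q$ is a curve $\gamma_*\in Lip_{\mathfrak{Z}}(p,q)$ with $L(\gamma_* )=\inf_{\gamma\in Lip_{\mathfrak{Z}}(p,q)}L(\gamma)=d(p,q)=E(\gamma_* )$. For $U\in H^1_{loc}(\mathbb{R},\mathbb{R}^N)$ set $H(U):=\int_{-\infty}^{+\infty}\frac12|U'|^2+W(U)\,dx\in[0,\infty]$. An $H$-minimizing heteroclinic connection between wells $\mathbf{a},\mathbf{b}\in\mathfrak{Z}$ is a classical ($C^2$) solution $U:\mathbb{R}\to\mathbb{R}^N$ of $U''-\nabla W(U)=0$ on $\mathbb{R}$ with $U(x)\to\mathbf{a}$ as $x\to-\infty$, $U(x)\to\mathbf{b}$ as $x\to+\infty$, and $H(U)\le H(V)$ for every $V\in H^1_{loc}(\mathbb{R},\mathbb{R}^N)$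 with $V(x)\to\mathbf{a}$ as $x\to-\infty$ and $V(x)\to\mathbf{b}$ as $x\to+\infty$. *)

(* Defs.v *)
From mathcomp Require Import all_boot all_order all_algebra.
From mathcomp Require Import all_classical all_reals all_analysis.
Import Order.TTheory GRing.Theory Num.Theory numFieldNormedType.Exports.

Set Implicit Arguments.
Unset Strict Implicit.
Unset Printing Implicit Defensive.

Local Open Scope classical_set_scope.
Local Open Scope ring_scope.

(* The library norm on 'rV[R]_N is the sup norm; it induces the usual topology,
   but lengths and energies are measured with the Euclidean norm. *)
Definition enorm (R : realType) (N : nat) (v : 'rV[R]_N) : R :=
  Num.sqrt (\sum_(i < N) v 0 i ^+ 2).

Definition grad (R : realType) (N : nat) (W : 'rV[R]_N -> R) (q : 'rV[R]_N) :
  'rV[R]_N := \row_(i < N) 'D_(delta_mx 0 i) W q.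

Definition near_infinity (R : realType) (N : nat) : set (set 'rV[R]_N) :=
  [set A | exists M : R, forall q, M < enorm q -> A q].

Definition C1_holder_loc (R : realType) (N : nat) (alpha : R)
    (A : set 'rV[R]_N) (W : 'rV[R]_N -> R) : Prop :=
  (forall q, A q -> differentiable W q) /\
  (forall K : set 'rV[R]_N, compact K -> K `<=` A ->
     exists C : R, forall q r, K q -> K r ->
       enorm (grad W q - grad W r) <= C * enorm (q - r) `^ alpha).

Record multiwell (R : realType) (N m : nat) (W : 'rV[R]_N -> R)
    (wells : 'I_m -> 'rV[R]_N) : Prop := Multiwell {
  multiwell_continuous : continuous W ;
  multiwell_ge0 : forall q, 0 <= W q ;
  multiwell_inj : injective wells ;
  multiwell_zero : forall q, W q = 0 <-> range wells q ;
  multiwell_liminf : (0 < limf_einf (EFin \o W) (@near_infinity R N))%E ;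
  multiwell_regular : exists alpha : R,
    [/\ 0 < alpha, alpha < 1 & C1_holder_loc alpha (~` range wells) W] ;
  multiwell_quadratic : exists C delta : R, [/\ 0 < C, 0 < delta &
    forall j q, enorm (q - wells j) < delta ->
      W q <= C * enorm (q - wells j) ^+ 2]
}.

(* Curves on [0, 1] are total functions R -> 'rV[R]_N of which only the
   restriction to [0, 1] matters. *)
Definition well_times (R : realType) (N : nat) (Z : set 'rV[R]_N)
    (gamma : R -> 'rV[R]_N) : set R :=
  [set t | 0 <= t <= 1 /\ Z (gamma t)].

Definition LipZ (R : realType) (N : nat) (Z : set 'rV[R]_N) :
    set (R -> 'rV[R]_N) :=
  [set gamma : R -> 'rV[R]_N | {within `[(0 : R), 1], continuous gamma} /\
    let D := [set t : R | 0 <= t <= 1] `\` well_times Z gamma in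
    forall t, D t -> exists e k : R, 0 < e /\
      forall s r, D s -> D r -> `|s - t| < e -> `|r - t| < e ->
        enorm (gamma s - gamma r) <= k * `|s - r|].

Definition LipZ_between (R : realType) (N : nat) (Z : set 'rV[R]_N)
    (p q : 'rV[R]_N) : set (R -> 'rV[R]_N) :=
  [set gamma : R -> 'rV[R]_N | [/\ LipZ Z gamma, gamma 0 = p & gamma 1 = q]].

(* [derive1] is total: for gamma in LipZ Z the points where gamma is not
   differentiable form a null subset of the domain of integration. *)
Definition weighted_length (R : realType) (N : nat) (W : 'rV[R]_N -> R)
    (Z : set 'rV[R]_N) (gamma : R -> 'rV[R]_N) : \bar R :=
  (\int[lebesgue_measure]_(t in `[0%R, 1%R] `\` well_times Z gamma)
     (Num.sqrt (W (gamma t)) * enorm (derive1 gamma t))%:E)%E.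

Definition dist (R : realType) (N : nat) (W : 'rV[R]_N -> R)
    (Z : set 'rV[R]_N) (p q : 'rV[R]_N) : \bar R :=
  ereal_inf [set weighted_length W Z gamma | gamma in LipZ_between Z p q].

Definition curve_length (R : realType) (N : nat) (W : 'rV[R]_N -> R)
    (Z : set 'rV[R]_N) (gamma : R -> 'rV[R]_N) : \bar R :=
  ereal_sup [set l | exists (n : nat) (s : nat -> R),
    [/\ s 0%N = 0, s n = 1, (forall j, (j < n)%N -> s j < s j.+1) &
        l = (\sum_(j < n) dist W Z (gamma (s j)) (gamma (s j.+1)))%E]].

Definition minimizing_geodesic (R : realType) (N : nat) (W : 'rV[R]_N -> R)
    (Z : set 'rV[R]_N) (p q : 'rV[R]_N) (gamma : R -> 'rV[R]_N) : Prop :=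
  p <> q /\
  [/\ LipZ_between Z p q gamma,
      curve_length W Z gamma =
        ereal_inf [set curve_length W Z eta | eta in LipZ_between Z p q],
      curve_length W Z gamma = dist W Z p q &
      dist W Z p q = weighted_length W Z gamma].

Definition L2_loc (R : realType) (N : nat) (V : R -> 'rV[R]_N) : Prop :=
  (forall i, measurable_fun setT (fun x => V x 0 i)) /\
  (forall a b : R,
     (\int[lebesgue_measure]_(x in `[a, b]) (enorm (V x) ^+ 2)%:E < +oo)%E).

Definition C1_compact_support (R : realType) (phi : R -> R) : Prop :=
  [/\ forall x, derivable phi x 1, continuous (derive1 phi) &
      exists M : R, forall x, M < `|x| -> phi x = 0].

(* Test functions are C^1 with compact support, as in Brezis, Functional
   Analysis, Sobolev Spaces and PDEs, Section 8.2. *)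
Definition weak_derivative (R : realType) (N : nat) (V G : R -> 'rV[R]_N) :
    Prop :=
  forall (phi : R -> R) (i : 'I_N), C1_compact_support phi ->
    (\int[lebesgue_measure]_x (V x 0 i * derive1 phi x) =
     - \int[lebesgue_measure]_x (G x 0 i * phi x))%R.

(* V is the continuous representative of an element of H^1_loc(R; R^N), and G
   represents its weak derivative, which is unique up to a null set. *)
Definition H1_loc (R : realType) (N : nat) (V G : R -> 'rV[R]_N) : Prop :=
  [/\ continuous V, L2_loc V, L2_loc G & weak_derivative V G].

(* The functional H at V, where G stands for the (weak or classical) derivative
   of V. *)
Definition energy (R : realType) (N : nat) (W : 'rV[R]_N -> R)
    (V G : R -> 'rV[R]_N) : \bar R :=
  (\int[lebesgue_measure]_x (2^-1 * enorm (G x) ^+ 2 + W (V x))%:E)%E.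

Definition connects (R : realType) (N : nat) (a b : 'rV[R]_N)
    (V : R -> 'rV[R]_N) : Prop :=
  (V x @[x --> -oo] --> a) /\ (V x @[x --> +oo] --> b).

Definition classical_solution (R : realType) (N : nat) (W : 'rV[R]_N -> R)
    (U : R -> 'rV[R]_N) : Prop :=
  [/\ forall x, derivable U x 1, forall x, derivable (derive1 U) x 1,
      continuous (derive1 (derive1 U)) &
      forall x, derive1 (derive1 U) x - grad W (U x) = 0].

Definition minimizing_heteroclinic (R : realType) (N : nat)
    (W : 'rV[R]_N -> R) (Z : set 'rV[R]_N) (a b : 'rV[R]_N)
    (U : R -> 'rV[R]_N) : Prop :=
  [/\ Z a, Z b, classical_solution W U, connects a b U &
      forall V G : R -> 'rV[R]_N, H1_loc V G -> connects a b V ->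
        (energy W U (derive1 U) <= energy W V G)%E].

(* Main.v *)
Require Import Defs.
From HB Require Import structures.
From mathcomp Require Import all_boot all_order all_algebra.
From mathcomp Require Import all_classical all_reals all_analysis.
From mathcomp Require Import measurable_realfun.
From mathcomp Require Import ring lra.
Import Order.TTheory GRing.Theory Num.Theory numFieldNormedType.Exports.

Set Implicit Arguments.
Unset Strict Implicit.
Unset Printing Implicit Defensive.

Local Open Scope classical_set_scope.
Local Open Scope ring_scope.

(** Put F = sqrt W.  Young's inequality 1/2 |V'|^2 + W(V) >= sqrt 2 F(V) |V'|
    bounds the energy of a competitor V from below by sqrt 2 times its weighted
    length, with equality when |V'| = sqrt (2 W(V)).  Let m0 be the weighted
    length of the arc of the geodesic between two consecutive wells.  The arc is
    itself minimal between its endpoints: a shorter curve could be spliced into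
    the geodesic, because the junctions are wells, where curves need not be
    Lipschitz ([glue_minimal]).  So every competitor has energy at least
    sqrt 2 m0 ([energy_lower_bound]), and it remains to run through the arc with
    speed sqrt (2 W).  The time this takes is infinite at both ends because
    sqrt W grows at most linearly near a well ([no_finite_time]); hence the
    reparametrized arc U is defined on the whole line, converges to the two wells,
    and satisfies int 2 W(U) <= sqrt 2 m0 ([reparam_potential]).

    The minimality of U must then be turned into U'' = grad W(U), while a priori U
    is only locally Lipschitz.  U is compared with a path that leaves U at time x,
    joins the translate U + v within time h, follows it up to time y and returns
    to U within another h ([competitor_inequality]).  Near the compact set
    U([x, y + h]), which contains no well, W is C^1 ([C1_estimates]).  With v = eps e_i, h = eta^2 and |eps| = eta^3 the terms
    linear in eps dominate and give that the difference quotients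
    (U_i(y + h) - U_i(y)) / h and (U_i(x + h) - U_i(x)) / h differ by the integral
    over [x, y] of the i-th partial derivative of W along U, up to an error which
    vanishes with h ([EL_core], [core_scaling], [EL_approx]).  A Lipschitz function is
    differentiable somewhere, and from that point differentiability spreads to
    the whole line: U' is a constant plus a primitive of grad W(U), so U is C^2
    ([regularity]).  Finally |U'|^2 <= 2 W(U), so that the energy of U is at most
    int 2 W(U) <= sqrt 2 m0.

    Two devices carry the comparison of lengths.  Upper bounds are stated with
    polygonal chains, whose cost involves no derivative ([chain], [reach_curve],
    [chain_curve]): a Sobolev competitor is replaced by inscribed polygons, and
    a polygon is a Lipschitz curve.  And since the derivative of an arbitrary
    curve need not be measurable, weighted lengths are treated as lower
    integrals, which are still monotone and additive over measurable sets. *)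

(** * Integrals over compact intervals *)

Section interval_integrals.
Context {R : realType}.
Notation mu := (@lebesgue_measure R).
Implicit Types (f g : R -> R) (x y z : R).

Definition intg f x y := mu.-integrable `[x, y] (EFin \o f).

Lemma intgS f x y x' y' : x <= x' -> y' <= y -> intg f x y -> intg f x' y'.
Proof.
move=> xx yy; apply: integrableS => //.
by apply: subset_itv; rewrite bnd_simp.
Qed.

Lemma intg_cst k x y : intg (cst k) x y.
Proof.
apply: measurable_bounded_integrable => //.
  exact: (compact_finite_measure (@segment_compact _ x y)).
exists `|k|; split; first by rewrite realE normr_ge0.
by move=> M kM t _ /=; rewrite ltW.
Qed.

Lemma intg_continuous f x y : {within `[x, y], continuous f} -> intg f x y.
Proof. by move=> fc; apply: continuous_compact_integrable => //; exact: segment_compact. Qed.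

Lemma intgT_continuous f x y : continuous f -> intg f x y.
Proof. by move=> fc; apply: intg_continuous; exact: continuous_subspaceT. Qed.

Lemma intgZ f k x y : intg f x y -> intg (fun t => k * f t) x y.
Proof. by move=> fi; have := @integrableZl _ _ _ mu _ (measurable_itv `[x, y]) k _ fi; apply: eq_integrable => // t _ /=; rewrite EFinM. Qed.

Lemma intgD f g x y : intg f x y -> intg g x y -> intg (fun t => f t + g t) x y.
Proof. by move=> fi gi; have := @integrableD _ _ _ mu _ (measurable_itv `[x, y]) _ _ fi gi; apply: eq_integrable => // t _ /=; rewrite EFinD. Qed.

Lemma intgB f g x y : intg f x y -> intg g x y -> intg (fun t => f t - g t) x y.
Proof. by move=> fi gi; have := @integrableB _ _ _ mu _ (measurable_itv `[x, y]) _ _ fi gi; apply: eq_integrable => // t _ /=; rewrite EFinB. Qed.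

Lemma intg_sum n (F : 'I_n -> R -> R) x y : (forall i, intg (F i) x y) ->
  intg (fun t => \sum_(i < n) F i t) x y.
Proof.
move=> Fi; rewrite /intg.
have -> : EFin \o (fun t => \sum_(i < n) F i t) = (fun t => \sum_(i < n) (F i t)%:E)%E.
  by apply/funext => t /=; rewrite sumEFin.
by apply: integrable_sum => // i _; exact: Fi.
Qed.

Definition Int f x y := \int[mu]_(t in `[x, y]) f t.

Lemma Int_cst k x y : x <= y -> Int (cst k) x y = k * (y - x).
Proof.
move=> xy; rewrite /Int Rintegral_cst//; congr (_ * _).
have /= := @lebesgue_measure_itv R `[x, y].
rewrite lte_fin => E; rewrite -[RHS]/(fine (y - x)%:E); congr fine.
transitivity (mu `[x, y]%classic) => //; rewrite E; case: ifPn => //.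
rewrite -leNgt => yx.
have -> : x = y by apply/eqP; rewrite eq_le xy yx.
by rewrite subrr.
Qed.

Lemma Int_cat f x y z : x <= y -> y <= z -> intg f x z ->
  Int f x z = Int f x y + Int f y z.
Proof.
move=> xy yz fi; rewrite /Int.
have := @Rintegral_itvB R f (BLeft x) (BRight z) y fi.
rewrite !bnd_simp => /(_ xy yz) h.
rewrite -[LHS](subrK (\int[mu]_(t in `[x, y]) f t)) h addrC; congr (_ + _).
apply: Rintegral_itv_obnd_cbnd; apply: integrableS fi => //.
by apply: subset_itv; rewrite bnd_simp.
Qed.

Lemma Int_le f g x y : intg f x y -> intg g x y ->
  (forall t, x <= t <= y -> f t <= g t) -> Int f x y <= Int g x y.
Proof. by move=> fi gi fg; apply: le_Rintegral => // t; rewrite /= in_itv/=; exact: fg. Qed.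

Lemma eq_Int f g x y : (forall t, x <= t <= y -> f t = g t) -> Int f x y = Int g x y.
Proof. by move=> fg; apply: eq_Rintegral => t; rewrite inE /= in_itv/=; exact: fg. Qed.

Lemma IntZ f k x y : intg f x y -> Int (fun t => k * f t) x y = k * Int f x y.
Proof. by move=> fi; exact: RintegralZl. Qed.

Lemma IntD f g x y : intg f x y -> intg g x y ->
  Int (fun t => f t + g t) x y = Int f x y + Int g x y.
Proof. by move=> fi gi; exact: RintegralD. Qed.

Lemma IntB f g x y : intg f x y -> intg g x y ->
  Int (fun t => f t - g t) x y = Int f x y - Int g x y.
Proof. by move=> fi gi; exact: RintegralB. Qed.

Lemma Int_ge0 f x y : (forall t, x <= t <= y -> 0 <= f t) -> 0 <= Int f x y.
Proof. by move=> f0; apply: Rintegral_ge0 => t; rewrite /= in_itv/=; exact: f0. Qed.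

Lemma Int_norm f x y : intg f x y -> `|Int f x y| <= Int (fun t => `|f t|) x y.
Proof. by move=> fi; apply: le_normr_Rintegral. Qed.

Lemma intg_norm f x y : intg f x y -> intg (fun t => `|f t|) x y.
Proof. by move=> fi; apply: integrable_norm. Qed.

Lemma Int_le_cst f k x y : x <= y -> intg f x y ->
  (forall t, x <= t <= y -> f t <= k) -> Int f x y <= k * (y - x).
Proof. by move=> xy fi fk; rewrite -Int_cst//; apply: Int_le => //; exact: intg_cst. Qed.

Lemma Int_ge_cst f k x y : x <= y -> intg f x y ->
  (forall t, x <= t <= y -> k <= f t) -> k * (y - x) <= Int f x y.
Proof. by move=> xy fi fk; rewrite -Int_cst//; apply: Int_le => //; exact: intg_cst. Qed.

Lemma Int_sum n (F : 'I_n -> R -> R) x y : (forall i, intg (F i) x y) ->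
  Int (fun t => \sum_(i < n) F i t) x y = \sum_(i < n) Int (F i) x y.
Proof.
elim: n F => [|n IH] F Fi.
  rewrite big_ord0 (@eq_Int _ (cst 0)); last by move=> t _; rewrite big_ord0.
  have [xy|yx] := leP x y; first by rewrite Int_cst// mul0r.
  by rewrite /Int set_itv_ge ?Rintegral_set0// bnd_simp -ltNge.
rewrite big_ord_recl -IH; last by move=> i; exact: Fi.
rewrite -IntD//; last by apply: intg_sum.
by apply: eq_Int => t _; rewrite big_ord_recl.
Qed.

Lemma Int_EFin f x y : intg f x y ->
  (Int f x y)%:E = (\int[mu]_(t in `[x, y]) (f t)%:E)%E.
Proof. by move=> fi; rewrite /Int /Rintegral fineK//; exact: integrable_fin_num. Qed.

End interval_integrals.

(** * Lipschitz functions as integrals *)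

Section AC.
Context {R : realType}.
Notation mu := (@lebesgue_measure R).

Lemma lip_continuous (f : R -> R) (L : R) :
  (forall x y, `|f x - f y| <= L * `|x - y|) -> continuous f.
Proof.
move=> fL x; apply/cvgrPdist_le => e e0.
near=> y; apply: (le_trans (fL x y)).
have L0 : 0 < `|L| + 1 by rewrite ltr_pwDr.
apply: (@le_trans _ _ ((`|L| + 1) * `|x - y|)).
  by rewrite ler_wpM2r// (le_trans (ler_norm L))// lerDl.
rewrite -ler_pdivlMl// mulrC.
near: y; apply: (@cvgr_dist_le _ _ _ (nbhs x) _ id) => //.
by rewrite divr_gt0.
Unshelve. all: by end_near. Qed.

(** Both outer measures are infima over the same covers by half-open intervals. *)
Lemma lebesgue_stieltjes_lip (F : cumulative R R) (L : R) : 0 < L ->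
  (forall x y, x <= y -> F y - F x <= L * (y - x)) ->
  forall A, (lebesgue_stieltjes_measure F A <= L%:E * mu A)%E.
Proof.
move=> L0 FL A; rewrite -lee_pdivrMl//.
rewrite /lebesgue_measure /lebesgue_stieltjes_measure /measure_extension /=.
apply: le_ereal_inf_tmp => _ [B AB <-].
rewrite lee_pdivrMl//.
apply: (@le_trans _ _ (\sum_(0 <= k <oo) wlength F (B k))%E).
  by apply: ereal_inf_lbound; exists B.
have h0 k : (0 <= wlength idfun (B k))%E by exact: wlength_ge0.
rewrite -nneseriesZl; last by move=> k _.
apply: lee_nneseries => [k _ _|k _].
  exact: wlength_ge0.
have [mB _] := AB.
have [[a b] _ /= <-] := mB k.
rewrite !wlength_itv /=; case: ifPn => // ab; last by rewrite mule0.
by rewrite -!EFinB -EFinM lee_fin FL// ltW// -lte_fin.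
Qed.

(** Adding a large multiple of the identity makes [f] increasing; clamped to [c, d] and
    normalized, it is the distribution function of a probability that is absolutely
    continuous.  Its Radon-Nikodym density accounts for the increments and, by
    Lebesgue differentiation, is the derivative almost everywhere. *)
Lemma lip_density (f : R -> R) (c d k : R) : c < d ->
  (forall x y, c <= x <= d -> c <= y <= d -> `|f x - f y| <= k * `|x - y|) ->
  exists g : R -> R, [/\ forall x y, intg g x y,
    forall x y, c <= x -> x <= y -> y <= d ->
      f y - f x = Int g x y &
    {ae mu, forall x, c < x < d -> derivable f x 1 /\ derive1 f x = g x}].
Proof.
move=> cd fk.
pose cl x := if x < c then c else if d < x then d else x.
have clI x : c <= cl x <= d.
  by rewrite /cl; case: (ltP x c) => ?; [|case: (ltP d x) => ?]; apply/andP; split; lra.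
have clE x : c <= x <= d -> cl x = x.
  by rewrite /cl => /andP[? ?]; case: (ltP x c) => ?; [|case: (ltP d x) => ?]; lra.
have cl_le x y : x <= y -> 0 <= cl y - cl x <= y - x.
  rewrite /cl => xy.
  by case: (ltP x c) => ?; [|case: (ltP d x) => ?]; (case: (ltP y c) => ?; [|case: (ltP d y) => ?]); apply/andP; split; lra.
have k0 : 0 <= k.
  have := fk c d; rewrite lexx ltW//= lexx/= => /(_ isT isT) h.
  have := le_trans (normr_ge0 _) h; rewrite pmulr_lge0// normr_gt0.
  by apply/eqP => h1; lra.
(* [K] exceeds the Lipschitz constant, so that [F0] increases strictly from [c] to [d] *)
pose K := k + 1.
pose F0 x := f (cl x) - f c + K * (cl x - c).
pose D0 := F0 d.
have F0lip x y : x <= y -> 0 <= F0 y - F0 x <= (K + K) * (y - x).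
  move=> xy; have /andP[h1 h2] := cl_le _ _ xy.
  have := fk _ _ (clI y) (clI x); rewrite (ger0_norm h1) ler_norml => /andP[h3 h4].
  rewrite /F0 /K; apply/andP; split; nra.
have D00 : 0 < D0.
  rewrite /D0 /F0 clE ?lexx ?ltW//=.
  have := fk d c; rewrite !lexx !(ltW cd) /= => /(_ isT isT).
  rewrite ler_norml gtr0_norm ?subr_gt0// => /andP[h3 h4]; rewrite /K; lra.
pose F x := D0^-1 * F0 x.
have FlipE x y : x <= y -> 0 <= F y - F x <= D0^-1 * (K + K) * (y - x).
  move=> xy; have /andP[h1 h2] := F0lip _ _ xy.
  have i0 : 0 <= D0^-1 by rewrite invr_ge0 ltW.
  by rewrite /F -mulrBr -mulrA mulr_ge0//= ler_wpM2l.
have L0 : 0 < D0^-1 * (K + K).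
  rewrite mulr_gt0// ?invr_gt0// /K; lra.
have Fc : continuous F.
  apply: (@lip_continuous _ (D0^-1 * (K + K))) => x y.
  wlog xy : x y / x <= y.
    move=> h; have [xy|yx] := leP x y; first exact: h.
    by rewrite distrC (distrC x) h// ltW.
  have /andP[h1 h2] := FlipE _ _ xy.
  by rewrite distrC ger0_norm// distrC (ger0_norm (_ : 0 <= y - x)) ?subr_ge0.
have Fnd : nondecreasing F.
  by move=> x y xy; have /andP[h1 h2] := FlipE _ _ xy; rewrite -subr_ge0.
have Frc : right_continuous F by exact: right_continuousW.
have F_Ny : F @ -oo --> (0:R).
  apply: cvg_near_cst; near=> x.
  rewrite /F /F0 (_ : cl x = c) ?subrr ?mulr0 ?add0r ?mulr0//.
  have xc : x < c by near: x; apply: nbhs_ninfty_lt; rewrite num_real.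
  by rewrite /cl xc.
have F_y : F @ +oo --> (1:R).
  apply: cvg_near_cst; near=> x.
  rewrite /F (_ : F0 x = D0) ?mulVf ?gt_eqF//.
  have xd : d < x by near: x; apply: nbhs_pinfty_gt; rewrite num_real.
  have -> : D0 = F0 d by [].
  have cdd : cl d = d by rewrite clE// lexx ltW.
  by rewrite /F0 cdd /cl ltNge (ltW (lt_trans cd xd))/= xd.
pose F2 : cumulativeBounded (0:R) (1:R) :=
  HB.pack F (isCumulative.Build R _ R F Fnd Frc)
    (isCumulativeBounded.Build R 0 1 F F_Ny F_y).
pose nu : probability (measurableTypeR R) R := lebesgue_stieltjes_measure F2.
have numu : nu `<< mu.
  apply/null_content_dominatesP => A mA A0.
  apply/eqP; rewrite eq_le measure_ge0 andbT.
  apply: (le_trans (lebesgue_stieltjes_lip L0 _ A)).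
    by move=> x y xy; have /andP[] := FlipE _ _ xy.
  by rewrite A0 mule0.
have [g0 [g0ge0 g0fin g0int g0E]] := radon_nikodym_sigma_finite numu.
pose h t := fine (g0 t).
have hE t : (h t)%:E = g0 t by rewrite /h fineK.
have hint : mu.-integrable setT (EFin \o h).
  by apply: eq_integrable g0int => // t _; rewrite /= hE.
have hintS A : measurable A -> mu.-integrable A (EFin \o h).
  by move=> mA; apply: integrableS hint.
have Fh x y : x <= y -> F y - F x = \int[mu]_(t in `]x, y]) h t.
  move=> xy; rewrite /Rintegral; under eq_integral do rewrite hE.
  rewrite -g0E//= /nu /lebesgue_stieltjes_measure /measure_extension.
  by rewrite measurable_mu_extE/=; [rewrite wlength_itv_bnd|exact: is_ocitv].
pose g t := D0 * h t - K.
have hi x y : intg h x y by apply: hintS.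
exists g; split.
- by move=> x y; apply: intgB; [exact: intgZ|exact: intg_cst].
- move=> x y cx xy yd; rewrite -/(Int g x y) IntB; last 2 first.
    exact: intgZ.
    exact: intg_cst.
  rewrite IntZ// Int_cst//.
  have -> : Int h x y = F y - F x.
    rewrite Fh// /Int -Rintegral_itv_obnd_cbnd//.
    exact: hintS.
  rewrite /F -mulrBr mulrA divff ?gt_eqF// mul1r /F0 !clE; first by ring.
    by rewrite cx (le_trans xy).
  by rewrite yd (le_trans cx).
have ly : locally_integrable [set: R] h.
  by apply: open_integrable_locally => //; exact: openT.
have := @FTC1Ny R h (fun y => hintS _ (measurable_itv _)) ly.
apply: filterS => [|x [dx dxE] /andP[cx xd]].
  exact: (ae_filter_ringOfSetsType mu).
pose Phi y := \int[mu]_(t in `]-oo, y]) h t.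
have PhiE y : c <= y -> Phi y = Phi c + (F y - F c).
  move=> cy; rewrite Fh// /Phi.
  have := @Rintegral_itvB R h -oo%O (BRight y) c.
  move=> /(_ (hintS _ (measurable_itv _))); rewrite !bnd_simp => /(_ isT cy) <-.
  by rewrite addrC subrK.
have fE : {near x, (fun y => D0 * (Phi y - Phi c + F c) - K * (y - c) + f c) =1 f}.
  near=> y.
  have cy : c < y by near: y; exact: lt_nbhsr.
  have yd : y < d by near: y; exact: lt_nbhsl.
  rewrite PhiE ?ltW// /F /F0 !clE ?lexx ?ltW// ?cy ?(lt_trans cy)//.
  rewrite !subrr mulr0 !addr0 ?mulr0 ?subr0 ?addr0.
  rewrite [_ + _ - Phi c]addrC addKr mulrA divff ?gt_eqF// mul1r; ring.
have xx : is_derive x 1 (id : R -> R) 1 by exact: is_derive_id.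
have dP : is_derive x 1 Phi (h x) by split; [exact: dx|rewrite -derive1E; exact: dxE].
have dd : is_derive x 1 (fun y => D0 * (Phi y - Phi c + F c) - K * (y - c) + f c) (g x).
  rewrite (_ : (fun y => _) = (D0 *: Phi - K *: id + cst (D0 * (F c - Phi c) + K * c + f c))); last first.
    apply/funext => y /=; rewrite !fctE /=.
    move: (Phi y) (Phi c) (F c) (f c) => P Q S T.
    have -> : D0 *: P = D0 * P by [].
    have -> : K *: y = K * y by [].
    ring.
  apply: is_derive_eq; rewrite /g /GRing.scale /=; ring.
have [df dfE] := near_eq_is_derive fE dd.
by split; [exact: df|rewrite derive1E].
Unshelve. all: by end_near. Qed.
End AC.

(** * The Euclidean norm *)

Section Euclid.
Context {R : realType} {N : nat}.
Implicit Types (u v w : 'rV[R]_N).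

Definition dot u v : R := \sum_(i < N) u 0 i * v 0 i.

Lemma enorm_ge0 v : 0 <= enorm v.
Proof. exact: sqrtr_ge0. Qed.

Lemma enorm_sqr v : enorm v ^+ 2 = dot v v.
Proof.
rewrite sqr_sqrtr; last by apply: sumr_ge0 => i _; exact: sqr_ge0.
by apply: eq_bigr => i _; rewrite expr2.
Qed.

Lemma dotC u v : dot u v = dot v u.
Proof. by apply: eq_bigr => i _; rewrite mulrC. Qed.

Lemma dotDl u v w : dot (u + v) w = dot u w + dot v w.
Proof. by rewrite -big_split; apply: eq_bigr => i _; rewrite mxE mulrDl. Qed.

Lemma dotZl k u v : dot (k *: u) v = k * dot u v.
Proof. by rewrite mulr_sumr; apply: eq_bigr => i _; rewrite mxE mulrA. Qed.

Lemma dotDr u v w : dot w (u + v) = dot w u + dot w v.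
Proof. by rewrite dotC dotDl !(dotC w). Qed.

Lemma dotZr k u v : dot u (k *: v) = k * dot u v.
Proof. by rewrite dotC dotZl dotC. Qed.

Lemma dot_ge0 v : 0 <= dot v v.
Proof. by rewrite -enorm_sqr sqr_ge0. Qed.

Lemma enorm0 : enorm (0 : 'rV[R]_N) = 0.
Proof. by rewrite /enorm big1 ?sqrtr0// => i _; rewrite mxE expr0n. Qed.

Lemma enorm_eq0 v : enorm v = 0 -> v = 0.
Proof.
move=> v0; have : \sum_(i < N) v 0 i ^+ 2 == 0.
  by move: v0 => /eqP; rewrite sqrtr_eq0 => h; rewrite eq_le h sumr_ge0// => i _; exact: sqr_ge0.
rewrite psumr_eq0 => [/allP h|i _]; last exact: sqr_ge0.
apply/rowP => i; rewrite mxE; apply/eqP.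
by have := h i; rewrite mem_index_enum sqrf_eq0 => /(_ isT).
Qed.

Lemma enormZ k v : enorm (k *: v) = `|k| * enorm v.
Proof.
apply/eqP; rewrite -(@eqrXn2 _ 2)// ?mulr_ge0 ?enorm_ge0//.
by rewrite enorm_sqr dotZl dotZr exprMn enorm_sqr real_normK ?num_real// mulrA expr2.
Qed.

Lemma enormN v : enorm (- v) = enorm v.
Proof. by rewrite -scaleN1r enormZ normrN1 mul1r. Qed.

Lemma enormC u v : enorm (u - v) = enorm (v - u).
Proof. by rewrite -enormN opprB. Qed.

Lemma cauchy_schwarz u v : dot u v <= enorm u * enorm v.
Proof.
have [v0|v0] := eqVneq (dot v v) 0.
  have /enorm_eq0 -> : enorm v = 0.
    by apply/eqP; rewrite -sqrf_eq0 enorm_sqr v0.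
  by rewrite enorm0 mulr0 -(scale0r 0) dotZr mul0r.
have vp : 0 < dot v v by rewrite lt_neqAle eq_sym v0 dot_ge0.
have := dot_ge0 (dot v v *: u + (- dot u v) *: v).
rewrite !(dotDl, dotDr, dotZl, dotZr) (dotC v u) => h.
have {}h : 0 <= dot v v * (dot v v * dot u u - dot u v ^+ 2).
  by apply: le_trans h _; rewrite le_eqVlt; apply/orP; left; apply/eqP; ring.
rewrite pmulr_rge0// subr_ge0 in h.
apply: (le_trans (ler_norm _)).
rewrite -(@ler_pXn2r _ 2)// ?nnegrE ?mulr_ge0 ?enorm_ge0//.
by rewrite exprMn !enorm_sqr real_normK ?num_real// mulrC.
Qed.

Lemma enormD u v : enorm (u + v) <= enorm u + enorm v.
Proof.
rewrite -(@ler_pXn2r _ 2)// ?nnegrE ?addr_ge0 ?enorm_ge0//.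
rewrite enorm_sqr !(dotDl, dotDr) sqrrD !enorm_sqr (dotC v u).
have := cauchy_schwarz u v; lra.
Qed.

Lemma enormB_le u v w : enorm (u - w) <= enorm (u - v) + enorm (v - w).
Proof. by rewrite -[u - w](subrKA v) enormD. Qed.

Lemma enormB_dist u v : `|enorm u - enorm v| <= enorm (u - v).
Proof.
rewrite ler_norml.
have h1 := enormD (u - v) v; have h2 := enormD (v - u) u.
rewrite !subrK in h1 h2; rewrite (enormC v) in h2.
by apply/andP; split; lra.
Qed.

Lemma coord_le_enorm v i : `|v 0 i| <= enorm v.
Proof.
rewrite -(@ler_pXn2r _ 2)// ?nnegrE ?enorm_ge0// enorm_sqr.
rewrite real_normK ?num_real// /dot (bigD1 i)//= expr2 lerDl.
by apply: sumr_ge0 => j _; rewrite -expr2 sqr_ge0.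
Qed.

Lemma enorm_le_sum v : enorm v <= \sum_(i < N) `|v 0 i|.
Proof.
rewrite -(@ler_pXn2r _ 2)// ?nnegrE ?sumr_ge0 ?enorm_ge0// enorm_sqr expr2.
rewrite mulr_suml; apply: ler_sum => i _.
apply: (le_trans (ler_norm _)); rewrite normrM ler_wpM2l//.
by rewrite (bigD1 i)//= lerDl sumr_ge0.
Qed.

Lemma norm_le_enorm v : `|v| <= enorm v.
Proof.
rewrite [leLHS]/Num.Def.normr /= mx_normrE; apply: bigmax_le => [|[i j] _ /=].
  exact: enorm_ge0.
by rewrite (ord1 i) coord_le_enorm.
Qed.

Lemma coord_le_norm v i : `|v 0 i| <= `|v|.
Proof.
rewrite [leRHS]/Num.Def.normr /= mx_normrE.
exact: (@le_bigmax _ _ _ 0 (fun ij : 'I_1 * 'I_N => `|v ij.1 ij.2|) (0, i)).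
Qed.

Lemma enorm_le_norm v : enorm v <= N%:R * `|v|.
Proof.
apply: (le_trans (enorm_le_sum v)).
apply: (@le_trans _ _ (\sum_(i < N) `|v|)); last first.
  by rewrite sumr_const card_ord mulr_natl.
by apply: ler_sum => i _; exact: coord_le_norm.
Qed.

Lemma enorm_continuous : continuous (@enorm R N).
Proof.
move=> v; have FF := nbhs_filter v; apply/cvgrPdist_le => e e0.
have d0 : 0 < e / (N%:R + 1) by rewrite divr_gt0// ltr_wpDl.
have hb : nbhs v (ball v (e / (N%:R + 1))) by exact: nbhsx_ballx.
apply: filterS hb => w; rewrite -ball_normE /= => /ltW vw.
apply: (le_trans (enormB_dist v w)); apply: (le_trans (enorm_le_norm _)).
apply: (@le_trans _ _ ((N%:R + 1) * `|v - w|)).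
  by rewrite ler_wpM2r// lerDl.
by rewrite -ler_pdivlMl ?ltr_wpDl// mulrC.
Qed.

Lemma cvg_enormP (T : Type) (F : set_system T) (FF : Filter F) (f : T -> 'rV[R]_N) v :
  (f @ F --> v) <-> (forall e, 0 < e -> \forall x \near F, enorm (f x - v) < e).
Proof.
split=> [fv e e0|fe].
  near=> x; rewrite enormC.
  apply: (le_lt_trans (enorm_le_norm _)).
  have h : `|v - f x| < e / (N%:R + 1).
    by near: x; apply: cvgr_dist_lt => //; rewrite divr_gt0// ltr_wpDl.
  rewrite ltr_pdivlMr ?ltr_wpDl// in h.
  by apply: le_lt_trans h; rewrite mulrC ler_wpM2l// lerDl.
apply/cvgrPdist_lt => e e0; near=> x.
apply: (le_lt_trans (norm_le_enorm _)); rewrite enormC; near: x; exact: fe.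
Unshelve. all: by end_near. Qed.

End Euclid.

Section EuclidR.
Context {R : realType} {N : nat}.
Implicit Types (V : R -> 'rV[R]_N).

Lemma rV_continuousP (T : topologicalType) (V : T -> 'rV[R]_N) :
  continuous V <-> forall i, continuous (fun x => V x 0 i).
Proof.
split=> [Vc i x|Vc x].
  apply/cvgrPdist_lt => e e0; near=> y.
  have h : `|V x - V y| < e by near: y; apply: cvgr_dist_lt => //; exact: Vc.
  apply: le_lt_trans h.
  by have := coord_le_norm (V x - V y) i; rewrite !mxE.
apply/cvg_enormP => e e0.
have e1 : 0 < e / (N%:R + 1) by rewrite divr_gt0// ltr_wpDl.
have h : \forall y \near x, forall i, `|V y 0 i - V x 0 i| < e / (N%:R + 1).
  apply: filter_forall => i; near=> y; rewrite distrC; near: y.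
  by apply: cvgr_dist_lt => //; exact: Vc.
apply: filterS h => y h.
apply: (le_lt_trans (enorm_le_sum _)).
apply: (@le_lt_trans _ _ (\sum_(i < N) e / (N%:R + 1))).
  by apply: ler_sum => i _; rewrite !mxE; exact: ltW.
rewrite sumr_const card_ord -[ltLHS]mulr_natl mulrCA.
by rewrite gtr_pMr// ltr_pdivrMr ?ltr_wpDl// mul1r ltrDl.
Unshelve. all: by end_near. Qed.

End EuclidR.

(** * Integrals of nonnegative functions without measurability *)

Section lower_integral.
Local Open Scope ereal_scope.
Context d (T : measurableType d) (R : realType) (mu : {measure set T -> \bar R}).
Implicit Types (D A B : set T) (w v : T -> \bar R).
Import HBNNSimple.

(** For a nonnegative function the integral is the supremum of the integrals of the
    simple functions below it, which makes it monotone with no measurability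
    assumption on the integrand. *)
Lemma lower_integral_le D w1 w2 : (forall x, D x -> 0 <= w1 x) ->
  (forall x, D x -> w1 x <= w2 x) ->
  \int[mu]_(x in D) w1 x <= \int[mu]_(x in D) w2 x.
Proof.
move=> w10 w12; rewrite !ge0_integralE//; last first.
  by move=> x Dx; exact: le_trans (w10 _ Dx) (w12 _ Dx).
apply: le_ereal_sup => _ [h hw <-]; exists h => // x.
apply: le_trans (hw x) _; rewrite !patchE.
by case: ifPn => //; rewrite inE; exact: w12.
Qed.

Lemma lower_integral_subset A D w : A `<=` D -> (forall x, D x -> 0 <= w x) ->
  \int[mu]_(x in A) w x <= \int[mu]_(x in D) w x.
Proof.
move=> AD w0; rewrite integral_mkcond [leRHS]integral_mkcond.
apply: lower_integral_le => x _.
  by apply: erestrict_ge0 => y /AD; exact: w0.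
have h0 := erestrict_ge0 w0 x; rewrite [leLHS]patchE.
case: ifPn => // xA; rewrite patchE ifT//.
by move: xA; rewrite !inE; exact: AD.
Qed.

Lemma lower_integral_sub D w (M : \bar R) : (forall x, D x -> 0 <= w x) ->
  (forall h : {nnsfun T >-> R}, (forall x, (h x)%:E <= (w \_ D) x) ->
    \int[mu]_x (h x)%:E <= M) ->
  \int[mu]_(x in D) w x <= M.
Proof.
move=> w0 H; rewrite ge0_integralE//; apply: ge_ereal_sup => _ [h hw <-].
by rewrite -integralT_nnsfun; exact: H.
Qed.

(** One inequality cuts a simple function below [w] along the measurable sets [A] and
    [B]; the other adds two simple functions, one below [w] on each set. *)
Lemma lower_integral_setU A B w : measurable A -> measurable B ->
  [disjoint A & B] -> (forall x, (A `|` B) x -> 0 <= w x) ->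
  \int[mu]_(x in A `|` B) w x = \int[mu]_(x in A) w x + \int[mu]_(x in B) w x.
Proof.
move=> mA mB AB w0.
have wA x : A x -> 0 <= w x by move=> Ax; apply: w0; left.
have wB x : B x -> 0 <= w x by move=> Bx; apply: w0; right.
apply/eqP; rewrite eq_le; apply/andP; split.
  apply: lower_integral_sub => // h hw.
  have mU := measurableU _ _ mA mB.
  have hx x : 0 <= (h x)%:E by rewrite lee_fin; exact: fun_ge0.
  have mh D : measurable_fun D (EFin \o h).
    by apply/measurable_EFinP; exact: measurable_funTS.
  rewrite -(setUv (A `|` B)) ge0_integral_setU//; last 2 first.
  - exact: measurableC.
  - exact/disj_setPCl.
  rewrite [X in _ + X]integral0_eq; last first.
    move=> x /= nU; apply/eqP; rewrite eq_le hx andbT.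
    by apply: le_trans (hw x) _; rewrite patchE ifN// notin_setE.
  rewrite adde0 ge0_integral_setU//; apply: leeD; apply: lower_integral_le => // x Dx.
    by apply: le_trans (hw x) _; rewrite patchE ifT// inE; left.
  by apply: le_trans (hw x) _; rewrite patchE ifT// inE; right.
have subA : \int[mu]_(x in A) w x <= \int[mu]_(x in A `|` B) w x.
  by apply: lower_integral_subset => // x; left.
have subB : \int[mu]_(x in B) w x <= \int[mu]_(x in A `|` B) w x.
  by apply: lower_integral_subset => // x; right.
have IA0 := integral_ge0 mu wA; have IB0 := integral_ge0 mu wB.
have [Aoo|Aoo] := eqVneq (\int[mu]_(x in A) w x) +oo.
  by move: subA; rewrite Aoo leye_eq => /eqP ->; rewrite leey.
have [Boo|Boo] := eqVneq (\int[mu]_(x in B) w x) +oo.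
  by move: subB; rewrite Boo leye_eq => /eqP ->; rewrite leey.
have Afin : \int[mu]_(x in A) w x \is a fin_num by rewrite ge0_fin_numE// lt_neqAle Aoo leey.
have Bfin : \int[mu]_(x in B) w x \is a fin_num by rewrite ge0_fin_numE// lt_neqAle Boo leey.
apply/lee_addgt0Pr => e e0.
have e2 : (0 < e / 2)%R by rewrite divr_gt0.
have [_ [h1 h1w <-] Ah1] : exists2 x, [set sintegral mu h | h in [set h : {nnsfun T >-> R} | forall x, (h x)%:E <= (w \_ A) x]] x & \int[mu]_(x in A) w x - (e / 2)%:E < x.
  have := Afin; rewrite ge0_integralE// => hf.
  exact: (ub_ereal_sup_adherent e2 hf).
have [_ [h2 h2w <-] Bh2] : exists2 x, [set sintegral mu h | h in [set h : {nnsfun T >-> R} | forall x, (h x)%:E <= (w \_ B) x]] x & \int[mu]_(x in B) w x - (e / 2)%:E < x.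
  have := Bfin; rewrite ge0_integralE// => hf.
  exact: (ub_ereal_sup_adherent e2 hf).
have hU : sintegral mu h1 + sintegral mu h2 <= \int[mu]_(x in A `|` B) w x.
  rewrite -!integralT_nnsfun -ge0_integralD//; last 4 first.
  - by move=> x _; rewrite lee_fin; exact: fun_ge0.
  - exact/measurable_EFinP.
  - by move=> x _; rewrite lee_fin; exact: fun_ge0.
  - exact/measurable_EFinP.
  rewrite [leRHS]integral_mkcond; apply: lower_integral_le => x _.
    by rewrite -EFinD lee_fin addr_ge0; [| exact: fun_ge0 | exact: fun_ge0].
  have := h1w x; have := h2w x; rewrite !patchE.
  have AB0 : A `&` B = set0 by exact/disj_set2P.
  have [xA|xA] := boolP (x \in A); have [xB|xB] := boolP (x \in B).
  - by exfalso; move: xA xB; rewrite !inE => xA xB; have : (A `&` B) x by []; rewrite AB0.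
  - rewrite ifT ?inE; last by left; rewrite inE in xA.
    by move=> h20 h1x; rewrite -[leRHS]adde0 leeD.
  - rewrite ifT ?inE; last by right; rewrite inE in xB.
    by move=> h20 h1x; rewrite -[leRHS]add0e leeD.
  - rewrite ifF; last by apply/negbTE/negP; rewrite inE => -[] /mem_set; apply/negP.
    by move=> h20 h1x; rewrite -[leRHS]adde0 leeD.
apply: (@le_trans _ _ (sintegral mu h1 + sintegral mu h2 + e%:E)); last by rewrite leeD2r.
have half (x y z t : \bar R) : x - (e / 2)%:E < z -> y - (e / 2)%:E < t ->
    x + y <= z + t + e%:E.
  move=> xz yt; rewrite [e in e%:E]splitr EFinD addeACA.
  by apply: leeD; rewrite -leeBlDr//; exact: ltW.
exact: half.
Qed.

(** A simple function below [w] is below [v] off a null set, and vice versa. *)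
Lemma lower_integral_ae D w v : measurable D -> measurable_fun D v ->
  (forall x, D x -> 0 <= w x) -> (forall x, D x -> 0 <= v x) ->
  {ae mu, forall x, D x -> w x = v x} ->
  \int[mu]_(x in D) w x = \int[mu]_(x in D) v x.
Proof.
move=> mD mv w0 v0 [N [mN N0 wv]].
have {}wv x : D x -> ~ N x -> w x = v x.
  by move=> Dx Nx; have := contra_not (wv x) Nx; move=> /contrapT; exact.
apply/eqP; rewrite eq_le; apply/andP; split.
  apply: lower_integral_sub => // h hw.
  have mh : measurable_fun setT (EFin \o h) by exact/measurable_EFinP.
  have hx x : 0 <= (h x)%:E by rewrite lee_fin; exact: fun_ge0.
  rewrite (ge0_negligible_integral _ _ _ _ N0)//.
  rewrite [leRHS]integral_mkcond.
  apply: (@le_trans _ _ (\int[mu]_(x in setT `\` N) (v \_ D) x)).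
    apply: lower_integral_le => // x [_ Nx]; apply: le_trans (hw x) _.
    rewrite !patchE; case: ifPn => //; rewrite inE => Dx.
    by rewrite wv.
  apply: lower_integral_subset => // x _; rewrite patchE; case: ifPn => //.
  by rewrite inE; exact: v0.
rewrite (ge0_negligible_integral _ _ _ _ N0)//.
apply: (@le_trans _ _ (\int[mu]_(x in D `\` N) w x)).
  by apply: lower_integral_le => x [Dx Nx]; [exact: v0|rewrite wv].
by apply: lower_integral_subset => // x [].
Qed.

End lower_integral.

(** * The speed of a Lipschitz curve *)

Section derive1_cvg.
Context {R : realType} {V : normedModType R}.
Implicit Types (f : R -> V) (x : R).

Lemma derive1_cvg f x : derivable f x 1 ->
  h^-1 *: (f (h + x) - f x) @[h --> 0^'] --> derive1 f x.
Proof.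
move=> df; rewrite derive1E /derive.
have -> : (fun h : R => h^-1 *: (f (h + x) - f x)) =
          (fun h => h^-1 *: ((f \o shift x) (h *: (1 : R)) - f x)).
  by apply/funext => h /=; rewrite [h *: _]mulr1.
exact: df.
Qed.

Lemma cvg_derive1 f x (l : V) :
  h^-1 *: (f (h + x) - f x) @[h --> 0^'] --> l ->
  derivable f x 1 /\ derive1 f x = l.
Proof.
move=> fl; have dl : derive1 f x = l by apply: cvg_lim.
split=> //; apply/cvg_ex; exists l.
have <- : (fun h : R => h^-1 *: (f (h + x) - f x)) =
          (fun h => h^-1 *: ((f \o shift x) (h *: (1 : R)) - f x)).
  by apply/funext => h /=; rewrite [h *: _]mulr1.
exact: fl.
Qed.

End derive1_cvg.

Section speed.
Context {R : realType}.
Notation mu := (@lebesgue_measure R).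

(** Measurable, and equal to the derivative wherever that exists, whereas [derive1] has
    an arbitrary value at the other points. *)
Definition seq_deriv (f : R -> R) (t : R) : R :=
  fine (limn_esup (fun n => (n.+1%:R * (f (t + n.+1%:R^-1) - f t))%:E)).

Lemma seq_derivE (f : R -> R) t : derivable f t 1 -> seq_deriv f t = derive1 f t.
Proof.
move=> df.
have h0 : (fun n => n.+1%:R^-1 : R) @ \oo --> 0^'.
  move=> A; rewrite /= /nbhs /= => -[e /= e0 eA]; near=> n; apply: eA => /=.
    rewrite sub0r normrN ger0_norm ?invr_ge0//.
    by near: n; exact: near_infty_natSinv_lt (PosNum e0).
  by rewrite invr_eq0 pnatr_eq0.
have h1 := cvg_comp _ _ h0 (derive1_cvg df).
have h2 : (fun n => (n.+1%:R * (f (t + n.+1%:R^-1) - f t))%:E) @ \oo --> (derive1 f t)%:E.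
  apply/cvg_EFin; first by near=> n.
  apply: cvg_trans h1; apply: near_eq_cvg; near=> n.
  by rewrite /= invrK (addrC _ t).
rewrite /seq_deriv is_cvg_limn_esupE; last by apply/cvg_ex; exists (derive1 f t)%:E.
by rewrite (cvg_lim _ h2).
Unshelve. all: by end_near. Qed.

Lemma measurable_seq_deriv (f : R -> R) : continuous f -> measurable_fun setT (seq_deriv f).
Proof.
move=> fc.
pose q n t : \bar R := (n.+1%:R * (f (t + n.+1%:R^-1) - f t))%:E.
suff mq n : measurable_fun setT (q n).
  have := @measurable_fun_limn_esup _ _ R setT q mq.
  exact: (measurableT_comp (fine_measurable measurableT)).
apply/measurable_EFinP; apply: measurable_funM => //; apply: measurable_funB.
  apply: continuous_measurable_fun => x.
  apply: continuous_comp; last exact: fc.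
  by apply: cvgD; [exact: cvg_id|exact: cvg_cst].
exact: continuous_measurable_fun.
Qed.

(** The density of [lip_density] depends on [c] and [d]; this representative does not,
    so that a single speed serves on all subintervals. *)
Lemma lip_seq_deriv (f : R -> R) (c d k : R) : c < d -> continuous f ->
  (forall x y, c <= x <= d -> c <= y <= d -> `|f x - f y| <= k * `|x - y|) ->
  [/\ intg (seq_deriv f) c d,
    forall x y, c <= x -> x <= y -> y <= d -> f y - f x = Int (seq_deriv f) x y &
    {ae mu, forall x, c < x < d -> derivable f x 1}].
Proof.
have FF : Filter (nbhs (almost_everywhere mu)) by exact: (ae_filter_ringOfSetsType mu).
move=> cd fc fk; have [g [gi gE gae]] := lip_density cd fk.
have msf D : measurable_fun D (EFin \o seq_deriv f).
  apply/measurable_EFinP; apply: measurable_funTS.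
  exact: measurable_seq_deriv.
have mg (x y : R) : measurable_fun `[x, y]%classic (EFin \o g).
  by have /integrableP[] := gi x y.
have aeE (x y : R) : c <= x -> y <= d -> ae_eq mu `[x, y]%classic (EFin \o seq_deriv f) (EFin \o g).
  move=> cx yd.
  have h1 : {ae mu, forall t, c < t < d -> (seq_deriv f t)%:E = (g t)%:E}.
    move: gae; apply: filterS => t H /H [dt <-].
    by rewrite seq_derivE.
  have h2 (z : R) : {ae mu, forall t, t <> z}.
    exists [set z]; split; [exact: measurable_set1|exact: lebesgue_measure_set1|].
    by move=> t /= /contrapT.
  apply: filterS3 h1 (h2 c) (h2 d) => t H tc td /=.
  rewrite in_itv/= => /andP[xt ty]; apply: H.
  rewrite !lt_neqAle (le_trans cx xt) (le_trans ty yd) !andbT.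
  by apply/andP; split; apply/eqP => // E; apply: tc.
have sfi : intg (seq_deriv f) c d.
  apply/integrableP; split; first exact: msf.
  have /integrableP[_ h] := gi c d.
  apply: le_lt_trans h; rewrite le_eqVlt; apply/orP; left; apply/eqP.
  apply: ge0_ae_eq_integral => //.
  - exact: (measurableT_comp (@abse_measurable R setT) (msf _)).
  - exact: (measurableT_comp (@abse_measurable R setT) (mg c d)).
  - apply: filterS (aeE _ _ (lexx c) (lexx d)) => t H Dt.
    by rewrite H.
split => //.
  move=> x y cx xy yd; rewrite gE// /Int /Rintegral; congr fine.
  apply: ae_eq_integral; [exact: measurable_itv|exact: mg|exact: msf|].
  by have := aeE _ _ cx yd; apply: filterS => t H Dt; exact/esym/H.
by move: gae; apply: filterS => t H /H [].
Qed.

Lemma intg_enorm N (G : 'I_N -> R -> R) x y : (forall i, intg (G i) x y) ->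
  intg (fun t => enorm (\row_i G i t)) x y.
Proof.
move=> Gi; have hS : intg (fun t => \sum_(i < N) `|G i t|) x y.
  by apply: (@intg_sum _ N (fun i t => `|G i t|)) => i; exact: intg_norm.
apply: (@le_integrable _ _ _ mu _ (measurable_itv _) _ (EFin \o (fun t => \sum_(i < N) `|G i t|))) => //.
  apply/measurable_EFinP; apply: (measurableT_comp (f := @Num.sqrt R)).
    by apply: continuous_measurable_fun; exact: sqrt_continuous.
  apply: measurable_sum => i.
  apply: (eq_measurable_fun (fun t => G i t ^+ 2)) => [t _|]; first by rewrite mxE.
  by apply: measurable_funX; have /integrableP[/measurable_EFinP] := Gi i.
move=> t _ /=; rewrite lee_fin ger0_norm ?enorm_ge0//.
apply: le_trans (enorm_le_sum _) _; rewrite ger0_norm ?sumr_ge0//.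
by apply: ler_sum => i _; rewrite mxE.
Qed.

(** Cauchy-Schwarz against the constant vector [V y - V x]. *)
Lemma enorm_Int N (V : R -> 'rV[R]_N) (G : 'I_N -> R -> R) x y : 
  (forall i, intg (G i) x y) ->
  (forall i, V y 0 i - V x 0 i = Int (G i) x y) ->
  enorm (V y - V x) <= Int (fun t => enorm (\row_i G i t)) x y.
Proof.
move=> Gi VG; have hE := intg_enorm Gi.
set D := V y - V x; have [->|D0] := eqVneq (enorm D) 0.
  by apply: Int_ge0 => t _; exact: enorm_ge0.
have Dp : 0 < enorm D by rewrite lt_neqAle eq_sym D0 enorm_ge0.
rewrite -(ler_pM2l Dp) -expr2 enorm_sqr -IntZ//.
have -> : dot D D = Int (fun t => \sum_(i < N) D 0 i * G i t) x y.
  rewrite (@Int_sum _ N (fun i t => D 0 i * G i t)); last by move=> i; exact: intgZ.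
  by apply: eq_bigr => i _; rewrite IntZ// -VG !mxE.
apply: Int_le => [||t _].
- by apply: (@intg_sum _ N (fun i t => D 0 i * G i t)) => i; exact: intgZ.
- exact: intgZ.
apply: le_trans (cauchy_schwarz D (\row_i G i t)).
by rewrite le_eqVlt; apply/orP; left; apply/eqP; apply: eq_bigr => i _; rewrite mxE.
Qed.

Definition speed N (g : R -> 'rV[R]_N) (t : R) : R :=
  enorm (\row_i seq_deriv (fun s => g s 0 i) t).

Lemma measurable_speed N (g : R -> 'rV[R]_N) : continuous g ->
  measurable_fun setT (speed g).
Proof.
move=> gc; apply: (measurableT_comp (f := @Num.sqrt R)).
  by apply: continuous_measurable_fun; exact: sqrt_continuous.
apply: measurable_sum => i.
apply: (eq_measurable_fun (fun t => seq_deriv (fun s => g s 0 i) t ^+ 2)) => [t _|]; first by rewrite mxE.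
apply: measurable_funX; apply: measurable_seq_deriv.
by move: i; apply/rV_continuousP.
Qed.

Lemma lip_speed N (g : R -> 'rV[R]_N) (c d k : R) : c < d -> continuous g ->
  (forall x y, c <= x <= d -> c <= y <= d -> enorm (g x - g y) <= k * `|x - y|) ->
  [/\ intg (speed g) c d,
    forall x y, c <= x -> x <= y -> y <= d -> enorm (g y - g x) <= Int (speed g) x y &
    {ae mu, forall x, c < x < d -> derivable g x 1 /\ enorm (derive1 g x) = speed g x}].
Proof.
move=> cd gc gk; have FF : Filter (nbhs (almost_everywhere mu)) by exact: (ae_filter_ringOfSetsType mu).
have gi i : [/\ intg (seq_deriv (fun s => g s 0 i)) c d,
    forall x y, c <= x -> x <= y -> y <= d -> g y 0 i - g x 0 i = Int (seq_deriv (fun s => g s 0 i)) x y &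
    {ae mu, forall x, c < x < d -> derivable (fun s => g s 0 i) x 1}].
  apply: (@lip_seq_deriv _ _ _ k) => //; first by move: i; apply/rV_continuousP.
  move=> x y xI yI; apply: le_trans (gk x y xI yI).
  by have := coord_le_enorm (g x - g y) i; rewrite !mxE.
split.
- by apply: intg_enorm => i; have [] := gi i.
- move=> x y cx xy yd; apply: enorm_Int => i; have [h1 h2 _] := gi i.
    exact: intgS h1.
  exact: h2.
- have : {ae mu, forall x, forall i, c < x < d -> derivable (fun s => g s 0 i) x 1}.
    by apply: filter_forall => i; have [] := gi i.
  apply: filterS => x H xI.
  have dg : derivable g x 1 by apply/derivable_mxP => i j; rewrite (ord1 i); exact: H.
  split=> //; rewrite /speed; congr enorm; apply/rowP => i; rewrite !mxE.
  rewrite seq_derivE; last exact: H.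
  by rewrite !derive1E derive_mx// mxE.
Qed.

End speed.

(** * Subdivision, uniform continuity, and a smooth step *)

Section uniformity.
Context {R : realType}.

(** This takes the place of Riemann sums: an estimate with an error proportional to the
    length is checked on short intervals, where continuous coefficients are nearly
    constant, and then concatenated. *)
Lemma chop (P : R -> R -> Prop) (a b delta : R) : a <= b -> 0 < delta ->
  (forall s t, a <= s -> s <= t -> t <= b -> t - s < delta -> P s t) ->
  (forall r s t, a <= r -> r <= s -> s <= t -> t <= b -> P r s -> P s t -> P r t) ->
  P a b.
Proof.
move=> ab d0 Ps Pt.
have [n nd] : exists n, (b - a) / n.+1%:R < delta.
  exists (Num.bound ((b - a) / delta)).
  rewrite ltr_pdivrMr// mulrC -ltr_pdivrMr//.
  apply: (lt_trans (archi_boundP _)); first by rewrite divr_ge0 ?subr_ge0// ltW.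
  by rewrite ltr_nat.
pose h := (b - a) / n.+1%:R.
have h0 : 0 <= h by rewrite divr_ge0 ?subr_ge0.
have bE : b = a + n.+1%:R * h.
  by rewrite /h mulrC divfK ?pnatr_eq0// addrC subrK.
have H k : (k <= n.+1)%N -> P a (a + k%:R * h).
  elim: k => [_|k IH kn].
    by rewrite mul0r addr0; apply: Ps; rewrite ?subrr.
  have kb : a + k.+1%:R * h <= b by rewrite [leRHS]bE lerD2l ler_wpM2r// ler_nat.
  have kk : a + k%:R * h <= a + k.+1%:R * h by rewrite lerD2l ler_wpM2r// ler_nat.
  have ak : a <= a + k%:R * h by rewrite lerDl mulr_ge0.
  apply: (Pt a (a + k%:R * h)) => //; first by apply: IH; exact: ltnW.
  apply: Ps => //; rewrite (_ : _ - _ = h)//.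
  by rewrite -natr1; ring.
by rewrite bE; exact: H.
Qed.

(** Only [p] ranges over the compact set, so that points [v] slightly outside of it are
    controlled as well. *)
Lemma heine (M : pseudoMetricType R) (V : normedModType R) (K : set M) (f : M -> V) :
  compact K -> continuous f -> forall e, 0 < e ->
  exists2 delta, 0 < delta & forall p v, K p -> ball p delta v -> `|f p - f v| < e.
Proof.
move=> Kc fc e e0.
have /compact_near_coveringP := Kc.
move=> /(_ R (0^'+) (fun d p => forall v, ball p d v -> `|f p - f v| < e)) [|d /= d0 H].
  move=> x Kx.
  have e2 : 0 < e / 2 by rewrite divr_gt0.
  have : nbhs x [set y | `|f x - f y| < e / 2].
    by move/cvgrPdist_lt: (fc x); exact.
  rewrite -nbhs_ballE => -[r /= r0 rH].
  exists (ball x (r / 2), [set d : R | d < r / 2]) => /=.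
    split; first by apply: nbhsx_ballx; rewrite divr_gt0.
    by apply: nbhs_right_lt; rewrite divr_gt0.
  move=> [y d] /= [xy dr] v yv.
  have h1 : `|f x - f y| < e / 2.
    by apply: rH; apply: le_ball xy; lra.
  have h2 : `|f x - f v| < e / 2.
    apply: rH; rewrite (splitr r); apply: ball_triangle xy _.
    by apply: le_ball yv; exact: ltW.
  rewrite (splitr e) -(subrKA (f x)); apply: le_lt_trans (ler_normD _ _) _.
  by rewrite distrC ltrD.
exists (d / 2); first by rewrite divr_gt0.
move=> p v Kp pv; apply: (H (d / 2)) => //=; last by rewrite divr_gt0.
by rewrite sub0r normrN gtr0_norm ?divr_gt0// ltr_pdivrMr// ltr_pMr// ltr1n.
Qed.

Lemma heine_itv (f : R -> R) (a b : R) : continuous f -> forall e, 0 < e ->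
  exists2 delta, 0 < delta & forall s t, a <= s <= b -> `|s - t| < delta -> `|f s - f t| < e.
Proof.
move=> fc e e0; have [d d0 H] := heine (@segment_compact _ a b) fc e0.
exists d => // s t sI st; apply: H => //.
Qed.

End uniformity.

Section ramp.
Context {R : realType}.
Notation mu := (@lebesgue_measure R).

Definition pos_part (u : R) : R := Num.max 0 u.

Lemma cvg_quadratic (f : R -> R) (x l C : R) :
  (forall h, `|f (h + x) - f x - h * l| <= C * h ^+ 2) ->
  is_derive x 1 f l.
Proof.
move=> H; suff : h^-1 *: (f (h + x) - f x) @[h --> 0^'] --> l.
  by move=> /cvg_derive1[df dE]; split => //; rewrite -derive1E.
apply/cvgrPdist_lt => e e0; near=> h.
have h0 : h != 0 by near: h; exact: nbhs_dnbhs_neq.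
have hp : 0 < `|h| by rewrite normr_gt0.
have he : `|h| < e / (`|C| + 1).
  by near: h; apply: dnbhs0_lt; rewrite divr_gt0// ltr_wpDl.
rewrite -(ltr_pM2r hp) -normrM mulrBl.
rewrite (_ : _ *: _ * h = f (h + x) - f x); last first.
  by rewrite -[_ *: _]/(_ * _) mulrAC mulVf// mul1r.
rewrite distrC (mulrC l); apply: le_lt_trans (H h) _.
rewrite ltr_pdivlMr in he; last by rewrite ltr_wpDl.
rewrite -[h ^+ 2]real_normK ?num_real// expr2 mulrA ltr_pM2r//.
apply: le_lt_trans he; rewrite mulrC ler_wpM2l//.
by rewrite (le_trans (ler_norm C))// lerDl.
Unshelve. all: by end_near. Qed.

Lemma is_derive_pos_part2 (u : R) : is_derive u 1 (fun u => pos_part u ^+ 2) (2 * pos_part u).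
Proof.
apply: (@cvg_quadratic _ _ _ 1) => h.
by rewrite /pos_part ler_norml; apply/andP; split; case: (leP 0 u) => ?; case: (leP 0 (h + u)) => ?; nra.
Qed.

Lemma pos_part_continuous : continuous pos_part.
Proof.
apply: (@lip_continuous _ _ 1) => x y; rewrite mul1r /pos_part.
have h1 := ler_norm (x - y); have := ler_norm (y - x); rewrite distrC => h2.
by rewrite ler_norml; apply/andP; split; case: (leP 0 x) => ?; case: (leP 0 y) => ?; lra.
Qed.

(** A C^1 step from 0 to 1 over [0, 2] whose derivative is the hat function [tent].
    Differences of rescaled steps are C^1 test functions close to the indicator of an
    interval. *)
Definition ramp (u : R) : R := 2^-1 * (pos_part u ^+ 2 - 2 * pos_part (u - 1) ^+ 2 + pos_part (u - 2) ^+ 2).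
Definition tent (u : R) : R := pos_part u - 2 * pos_part (u - 1) + pos_part (u - 2).

Lemma ramp_lt0 u : u <= 0 -> ramp u = 0.
Proof. by move=> u0; rewrite /ramp /pos_part; case: (leP 0 u) => ?; case: (leP 0 (u - 1)) => ?; case: (leP 0 (u - 2)) => ?; nra. Qed.
Lemma ramp_ge2 u : 2 <= u -> ramp u = 1.
Proof. by move=> u0; rewrite /ramp /pos_part; case: (leP 0 u) => ?; case: (leP 0 (u - 1)) => ?; case: (leP 0 (u - 2)) => ?; nra. Qed.
Lemma ramp_01 u : 0 <= ramp u <= 1.
Proof. by rewrite /ramp /pos_part; apply/andP; split; case: (leP 0 u) => ?; case: (leP 0 (u - 1)) => ?; case: (leP 0 (u - 2)) => ?; nra. Qed.
Lemma tent_ge0 u : 0 <= tent u.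
Proof. by rewrite /tent /pos_part; case: (leP 0 u) => ?; case: (leP 0 (u - 1)) => ?; case: (leP 0 (u - 2)) => ?; nra. Qed.
Lemma tent_out u : u <= 0 \/ 2 <= u -> tent u = 0.
Proof. by move=> []?; rewrite /tent /pos_part; case: (leP 0 u) => ?; case: (leP 0 (u - 1)) => ?; case: (leP 0 (u - 2)) => ?; nra. Qed.

Lemma is_derive_ramp (c h t : R) : is_derive t 1 (fun t => ramp (h * (t - c))) (h * tent (h * (t - c))).
Proof.
have dl k : is_derive t 1 (fun t => pos_part (h * (t - c) - k) ^+ 2) (h * (2 * pos_part (h * (t - c) - k))).
  have d1 : is_derive t 1 (fun t : R => h * (t - c) - k) h.
    apply: (@cvg_quadratic _ _ _ 0) => e; rewrite mul0r.
    by rewrite (_ : _ - _ = 0) ?normr0//; ring.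
  rewrite mulrC.
  exact: (@is_derive1_comp _ (fun u => pos_part u ^+ 2) (fun t => h * (t - c) - k) t _ _ (is_derive_pos_part2 _) d1).
rewrite (_ : (fun t => _) = 2^-1 *: ((fun t => pos_part (h * (t - c) - 0) ^+ 2) - (2 *: (fun t => pos_part (h * (t - c) - 1) ^+ 2)) + (fun t => pos_part (h * (t - c) - 2) ^+ 2))); last first.
  by apply/funext => s; rewrite !fctE /ramp subr0.
have d0 := dl 0; have d1 := dl 1; have d2 := dl 2.
have dd := is_deriveZ 2^-1 (is_deriveD (is_deriveB d0 (is_deriveZ 2 d1)) d2).
apply: (is_derive_eq dd); rewrite /tent subr0 /GRing.scale /=; field.
by []. Qed.

Lemma tent_continuous : continuous tent.
Proof.
have h k : continuous (fun u => pos_part (u - k)).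
  move=> u; apply: (@continuous_comp _ _ _ (fun u => u - k) pos_part); last exact: pos_part_continuous.
  by apply: cvgB; [exact: cvg_id|exact: cvg_cst].
move=> u; apply: cvgD; last exact: h.
apply: cvgB; first exact: pos_part_continuous.
by apply: cvgM; [exact: cvg_cst|exact: h].
Qed.

End ramp.

(** * Weak derivatives and increments *)

Section weak.
Context {R : realType}.
Notation mu := (@lebesgue_measure R).

Lemma Rintegral_supp (f : R -> R) (a b : R) :
  (forall t, t < a \/ b < t -> f t = 0) -> \int[mu]_t f t = Int f a b.
Proof.
move=> f0; rewrite /Int [RHS]Rintegral_mkcond; apply: eq_Rintegral => t _.
rewrite patchE; case: ifPn => // /negP; rewrite inE /= in_itv /= => /negP.
by rewrite negb_and -!ltNge => /orP h; apply: f0.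
Qed.

Lemma Int_at (f : R -> R) (x : R) : Int f x x = 0.
Proof. by rewrite /Int set_itv1 Rintegral_set1. Qed.

Lemma Int_small (f : R -> R) (x b : R) : x < b -> intg f x b ->
  forall e, 0 < e -> \forall d \near 0^'+, `|Int f x (x + d)| < e.
Proof.
move=> xb fi e e0.
have := parameterized_integral_continuous (ltW xb) fi.
move=> /(continuous_within_itvP _ xb)[_ + _] => /cvgrPdist_lt /(_ e e0).
rewrite /parameterized_integral -!/(Int f x _) Int_at => h.
have {}h : \forall t \near x^'+, `|Int f x t| < e.
  by apply: filterS h => t; rewrite sub0r normrN.
move: h => [r /= r0 h]; exists r => // d /= dr d0.
apply: h; last by rewrite ltrDl.
by move: dr; rewrite sub0r normrN /= opprD addrA subrr sub0r normrN.
Qed.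

Lemma tent_mass (h x : R) : 0 < h ->
  Int (fun t => h * tent (h * (t - x))) x (x + 2 / h) = 1.
Proof.
move=> h0; have xh : x < x + 2 / h by rewrite ltrDl divr_gt0.
rewrite /Int /Rintegral.
rewrite (@continuous_FTC2 _ _ (fun t => ramp (h * (t - x))))//=.
- have -> : h * (x + 2 / h - x) = 2 by field; rewrite gt_eqF.
  by rewrite subrr mulr0 (@ramp_ge2 _ 2)// (@ramp_lt0 _ 0)// subr0.
- apply: continuous_subspaceT => t; apply: cvgM; first exact: cvg_cst.
  apply: (@continuous_comp _ _ _ (fun t => h * (t - x)) tent); last exact: tent_continuous.
  by apply: cvgM; [exact: cvg_cst|apply: cvgB; [exact: cvg_id|exact: cvg_cst]].
- have dc t : {for t, continuous (fun t => ramp (h * (t - x)))}.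
    by apply: differentiable_continuous; apply/derivable1_diffP; have [] := is_derive_ramp x h t.
  split.
  + by move=> t _; have [] := is_derive_ramp x h t.
  + by apply: cvg_at_right_filter; exact: dc.
  + by apply: cvg_at_left_filter; exact: dc.
- by move=> t _; rewrite derive1E; have [_ ->] := is_derive_ramp x h t.
Qed.

Lemma scaled_tent_continuous (h x : R) : continuous (fun t => h * tent (h * (t - x))).
Proof.
move=> t; apply: cvgM; first exact: cvg_cst.
apply: (@continuous_comp _ _ _ (fun t => h * (t - x)) tent); last exact: tent_continuous.
by apply: cvgM; [exact: cvg_cst|apply: cvgB; [exact: cvg_id|exact: cvg_cst]].
Qed.

Lemma continuousM_fun (f g : R -> R) : continuous f -> continuous g -> continuous (fun t => f t * g t).
Proof. by move=> fc gc t; apply: cvgM; [exact: fc|exact: gc]. Qed.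

(** The rescaled tent is a nonnegative kernel of mass 1. *)
Lemma tent_average (f : R -> R) (h x e : R) : 0 < h -> continuous f ->
  (forall t, x <= t <= x + 2 / h -> `|f t - f x| <= e) ->
  `|Int (fun t => f t * (h * tent (h * (t - x)))) x (x + 2 / h) - f x| <= e.
Proof.
move=> h0 fc fe; have xh : x <= x + 2 / h by rewrite lerDl divr_ge0// ltW.
set k := fun t => h * tent (h * (t - x)).
have kc : continuous k by exact: scaled_tent_continuous.
have k0 t : 0 <= k t by rewrite mulr_ge0 ?tent_ge0// ltW.
have ki : intg k x (x + 2 / h) by exact: intgT_continuous.
have mass : Int k x (x + 2 / h) = 1 by exact: tent_mass.
have fki : intg (fun t => f t * k t) x (x + 2 / h) by apply: intgT_continuous; exact: continuousM_fun.
rewrite -[f x]mulr1 -[in X in _ - X]mass -IntZ// -IntB//; last exact: intgZ.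
apply: le_trans (Int_norm _) _; first by apply: intgB => //; exact: intgZ.
rewrite -[leRHS]mulr1 -[in leRHS]mass -IntZ//; apply: Int_le.
- by apply: intg_norm; apply: intgB => //; exact: intgZ.
- exact: intgZ.
- by move=> t tI; rewrite -mulrBl normrM (ger0_norm (k0 t)) ler_wpM2r// fe.
Qed.

Lemma four_errors (e vx vy kx ky p1 p2 p3 i1 : R) :
  kx - ky = - (p1 + (p2 + p3)) -> `|kx - vx| <= e / 4 -> `|ky - vy| <= e / 4 ->
  `|p1 - i1| <= e / 4 -> `|p3| <= e / 4 -> `|vy - vx - (i1 + p2)| <= e.
Proof.
move=> E; rewrite !ler_norml => /andP[? ?] /andP[? ?] /andP[? ?] /andP[? ?].
by apply/andP; split; lra.
Qed.

(** Testing with the difference of two steep ramps, one starting at [x] and one at [y],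
    compares averages of [v] just after [x] and [y] with the integral of [g] between
    them, up to two short end pieces. *)
Lemma weak_FTC (v g : R -> R) : continuous v -> (forall a b, intg g a b) ->
  (forall phi, C1_compact_support phi ->
     \int[mu]_t (v t * derive1 phi t) = - \int[mu]_t (g t * phi t)) ->
  forall x y, x < y -> v y - v x = Int g x y.
Proof.
move=> vc gi H x y xy; apply/eqP; rewrite -subr_eq0 -normr_le0.
apply/ler_addgt0Pr => e e0; rewrite add0r.
have e4 : 0 < e / 4 by rewrite divr_gt0.
have gni a b : intg (fun t => `|g t|) a b by exact: intg_norm.
have vn z : \forall d \near 0^'+, forall t, z <= t <= z + d -> `|v t - v z| <= e / 4.
  have := vc z => /cvgrPdist_lt /(_ _ e4); rewrite /= nearE /= -nbhs_ballE => -[r /= r0 hr].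
  exists r => // d /=; rewrite sub0r normrN => dr d0 t /andP[zt tz].
  rewrite distrC ltW//; apply: hr; rewrite -ball_normE /= distrC ger0_norm ?subr_ge0//.
  by rewrite ltrBlDl (le_lt_trans tz)// ltrD2l (le_lt_trans (ler_norm _) dr).
have [d [[[[d0 dxy] vx] vy] [gx gy]]] : exists d, (((0 < d /\ d < y - x)
   /\ (forall t, x <= t <= x + d -> `|v t - v x| <= e / 4))
   /\ (forall t, y <= t <= y + d -> `|v t - v y| <= e / 4))
   /\ (`|Int (fun t => `|g t|) x (x + d)| < e / 4 /\ `|Int (fun t => `|g t|) y (y + d)| < e / 4).
  apply: (@filter_ex _ (0^'+)).
  near=> d; repeat split.
  - by near: d; exact: nbhs_right_gt.
  - by near: d; apply: nbhs_right_lt; rewrite subr_gt0.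
  - by near: d; exact: vn.
  - by near: d; exact: vn.
  - by near: d; apply: (@Int_small _ x (x + 1)) => //; rewrite ltrDl.
  - by near: d; apply: (@Int_small _ y (y + 1)) => //; rewrite ltrDl.
(* with this slope both ramps have width [d] *)
pose h := 2 / d.
have h0 : 0 < h by rewrite divr_gt0.
have hd : 2 / h = d by rewrite /h invf_div mulrC divfK.
pose phi t := ramp (h * (t - x)) - ramp (h * (t - y)).
pose kx t := h * tent (h * (t - x)); pose ky t := h * tent (h * (t - y)).
have dphi (t : R) : is_derive t 1 phi (kx t - ky t).
  exact: is_deriveB (is_derive_ramp x h t) (is_derive_ramp y h t).
have phiE : derive1 phi = (fun t => kx t - ky t).
  by apply/funext => t; rewrite derive1E; have [_ ->] := dphi t.
have kxc : continuous kx by exact: scaled_tent_continuous.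
have kyc : continuous ky by exact: scaled_tent_continuous.
have phi0 t : t < x \/ y + d < t -> phi t = 0.
  move=> [tx|tyd]; rewrite /phi.
    have hle z : t <= z -> ramp (h * (t - z)) = 0.
      by move=> tz; rewrite ramp_lt0// pmulr_rle0// subr_le0.
    by rewrite !hle ?subrr ?ltW// (lt_trans tx).
  have hh z : z <= y -> 2 <= h * (t - z).
    move=> zy; rewrite -hd in tyd; rewrite mulrC -ler_pdivrMr// lerBrDr ltW// (le_lt_trans _ tyd)//.
    by rewrite addrC lerD2r.
  by rewrite !ramp_ge2 ?subrr ?hh// ltW.
have phiC : C1_compact_support phi.
  split.
  - by move=> t; have [] := dphi t.
  - by rewrite phiE => t; apply: cvgB; [exact: kxc|exact: kyc].
  - exists (`|x| + `|y| + d) => t ht; apply: phi0.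
    have [t0|t0] := leP 0 t.
      right; rewrite (ger0_norm t0) in ht; apply: le_lt_trans ht.
      have := ler_norm y; have := normr_ge0 x; lra.
    left; rewrite (ltr0_norm t0) in ht.
    have := ler_norm (- x); rewrite normrN; have := normr_ge0 y; lra.
have kx0 t : t <= x \/ x + d <= t -> kx t = 0.
  rewrite /kx => -[tx|tx]; rewrite tent_out ?mulr0//.
    by left; rewrite pmulr_rle0// subr_le0.
  by right; rewrite mulrC -ler_pdivrMr// hd; lra.
have ky0 t : t <= y \/ y + d <= t -> ky t = 0.
  rewrite /ky => -[tx|tx]; rewrite tent_out ?mulr0//.
    by left; rewrite pmulr_rle0// subr_le0.
  by right; rewrite mulrC -ler_pdivrMr// hd; lra.
have := H phi phiC; rewrite phiE.
rewrite (@Rintegral_supp _ x (y + d)); last first.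
  by move=> t [?|?]; rewrite kx0 ?ky0 ?subrr ?mulr0//; [left|left|right|right]; lra.
rewrite (@Rintegral_supp _ x (y + d)); last first.
  by move=> t ht; rewrite phi0// mulr0.
have Vx : `|Int (fun t => v t * kx t) x (x + d) - v x| <= e / 4.
  by rewrite -hd; apply: tent_average => // t; rewrite hd; exact: vx.
have Vy : `|Int (fun t => v t * ky t) y (y + d) - v y| <= e / 4.
  by rewrite -hd; apply: tent_average => // t; rewrite hd; exact: vy.
have ix a b : intg (fun t => v t * kx t) a b by apply: intgT_continuous; exact: continuousM_fun.
have iy a b : intg (fun t => v t * ky t) a b by apply: intgT_continuous; exact: continuousM_fun.
have Int0 (f : R -> R) a b : a <= b -> (forall t, a <= t <= b -> f t = 0) -> Int f a b = 0.
  by move=> ab f0; rewrite (@eq_Int _ f (cst 0)) ?Int_cst ?mul0r.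
rewrite (@eq_Int _ (fun t => v t * (kx t - ky t)) (fun t => v t * kx t - v t * ky t)); last first.
  by move=> t _; rewrite mulrBr.
rewrite IntB//.
rewrite (@Int_cat _ (fun t => v t * kx t) x (x + d)) ?lerDl ?(ltW d0)//; last by lra.
rewrite (Int0 (fun t => v t * kx t) (x + d) (y + d)); last 2 first.
  by lra.
  by move=> t /andP[h1 h2]; rewrite kx0 ?mulr0//; right.
rewrite (@Int_cat _ (fun t => v t * ky t) x y) ?lerDl ?(ltW xy) ?(ltW d0)//.
rewrite (Int0 (fun t => v t * ky t) x y) ?(ltW xy)//; last first.
  by move=> t /andP[h1 h2]; rewrite ky0 ?mulr0//; left.
rewrite addr0 add0r => E.
have phi01 t : 0 <= phi t <= 1.
  rewrite /phi; have [ty|yt] := leP t y.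
    by rewrite (@ramp_lt0 _ (h * (t - y))) ?subr0 ?ramp_01// pmulr_rle0// subr_le0.
  rewrite (@ramp_ge2 _ (h * (t - x))); last by rewrite mulrC -ler_pdivrMr// hd; lra.
  by have /andP[] := ramp_01 (h * (t - y)); lra.
have phi1 t : x + d <= t <= y -> phi t = 1.
  move=> /andP[xt ty]; rewrite /phi (@ramp_lt0 _ (h * (t - y))) ?subr0; last first.
    by rewrite pmulr_rle0// subr_le0.
  by rewrite ramp_ge2// mulrC -ler_pdivrMr// hd; lra.
have gphi_le t : `|g t * phi t| <= `|g t|.
  by have /andP[p0 p1] := phi01 t; rewrite normrM (ger0_norm p0) ler_piMr.
have gphii a b : intg (fun t => g t * phi t) a b.
  apply: (@le_integrable _ _ _ mu _ (measurable_itv _) _ (EFin \o g)); last exact: gi.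
    apply/measurable_EFinP; apply: measurable_funM.
      by have /integrableP[/measurable_EFinP] := gi a b.
    apply: measurable_funTS; apply: continuous_measurable_fun => t.
    by apply: differentiable_continuous; apply/derivable1_diffP; have [] := dphi t.
  by move=> t _; rewrite /= lee_fin.
have xdy : x + d <= y by lra.
have xxd : x <= x + d by lra.
have yyd : y <= y + d by lra.
have Q1 : `|Int (fun t => g t * phi t) x (x + d) - Int g x (x + d)| <= e / 4.
  rewrite -IntB//; apply: le_trans (Int_norm _) _; first exact: intgB.
  apply: le_trans (le_trans (ler_norm _) (ltW gx)).
  apply: Int_le => //; first by apply: intg_norm; exact: intgB.
  move=> t _; have /andP[p0 p1] := phi01 t.
  rewrite -[X in `|_ - X|]mulr1 -mulrBr normrM ler_piMr// ler_norml; lra.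
have Q2 : `|Int (fun t => g t * phi t) y (y + d)| <= e / 4.
  apply: le_trans (Int_norm _) _ => //.
  apply: le_trans (le_trans (ler_norm _) (ltW gy)).
  by apply: Int_le => //; exact: intg_norm.
move: E; rewrite (@Int_cat _ (fun t => g t * phi t) x (x + d) (y + d)) ?xxd//; last by lra.
rewrite (@Int_cat _ (fun t => g t * phi t) (x + d) y (y + d)) ?xdy//.
rewrite (@eq_Int _ (fun t => g t * phi t) g (x + d) y); last first.
  by move=> t tI; rewrite phi1 ?mulr1.
rewrite (@Int_cat _ g x (x + d) y)// => E.
exact: four_errors E Vx Vy Q1 Q2.
Unshelve. all: by end_near. Qed.

End weak.

(** * Sobolev curves and polygonal chains *)

Section H1.
Context {R : realType} {N : nat}.
Notation mu := (@lebesgue_measure R).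

Lemma intgM_continuous (f g : R -> R) x y : continuous f -> intg g x y ->
  intg (fun t => f t * g t) x y.
Proof.
move=> fc gi.
have [M [_ hM]] := compact_bounded (continuous_compact (continuous_subspaceT fc) (@segment_compact _ x y)).
have fM t : x <= t <= y -> `|f t| <= `|M| + 1.
  move=> tI; apply: (hM (`|M| + 1)); first by rewrite (le_lt_trans (ler_norm M))// ltrDl.
  by exists t.
apply: (@le_integrable _ _ _ mu _ (measurable_itv _) _ (EFin \o (fun t => (`|M| + 1) * g t))); last exact: intgZ.
  apply/measurable_EFinP; apply: measurable_funM.
    by apply: measurable_funTS; exact: continuous_measurable_fun.
  by have /integrableP[/measurable_EFinP] := gi.
move=> t; rewrite /= in_itv /= => tI; rewrite lee_fin !normrM ler_wpM2r//.
by rewrite [leRHS]ger0_norm ?fM// addr_ge0.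
Qed.

Lemma H1_intg (V G : R -> 'rV[R]_N) x y : H1_loc V G ->
  intg (fun t => enorm (G t) ^+ 2) x y.
Proof.
move=> [_ _ [mG GL2] _]; apply/integrableP; split.
  apply/measurable_EFinP; apply: measurable_funX; apply: measurable_funTS.
  apply: (measurableT_comp (f := @Num.sqrt R)).
    by apply: continuous_measurable_fun; exact: sqrt_continuous.
  by apply: measurable_sum => i; apply: measurable_funX; exact: mG.
apply: le_lt_trans (GL2 x y); rewrite le_eqVlt; apply/orP; left; apply/eqP.
by apply: eq_integral => t _; rewrite gee0_abs ?lee_fin ?sqr_ge0.
Qed.

(** Square integrability gives local integrability, so that each coordinate of [V] is
    the integral of its weak derivative; [enorm_Int] combines the coordinates. *)
Lemma H1_upper_gradient (V G : R -> 'rV[R]_N) : H1_loc V G ->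
  (forall x y, intg (fun t => enorm (G t)) x y) /\
  (forall x y, x <= y -> enorm (V y - V x) <= Int (fun t => enorm (G t)) x y).
Proof.
move=> hVG; have [Vc _ [mG GL2] wd] := hVG.
have Gi i x y : intg (fun t => G t 0 i) x y.
  apply: (@le_integrable _ _ _ mu _ (measurable_itv _) _ (EFin \o (fun t => cst 1 t + enorm (G t) ^+ 2))).
  - by apply/measurable_EFinP; apply: measurable_funTS; exact: mG.
  - move=> t _; rewrite /= lee_fin [leRHS]ger0_norm ?addr_ge0 ?sqr_ge0//.
    apply: le_trans (coord_le_enorm (G t) i) _.
    have := enorm_ge0 (G t); nra.
  - apply: intgD; [exact: intg_cst|exact: H1_intg hVG].
have GE t : G t = \row_i G t 0 i by apply/rowP => i; rewrite mxE.
have EE : (fun t => enorm (G t)) = (fun t => enorm (\row_i G t 0 i)).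
  by apply/funext => t; rewrite {1}GE.
rewrite EE; split=> [x y|x y xy]; first exact: intg_enorm.
apply: enorm_Int => // i.
move: xy; rewrite le_eqVlt => /orP[/eqP ->|xy]; first by rewrite subrr Int_at.
apply: (@weak_FTC _ (fun t => V t 0 i) (fun t => G t 0 i)) => //.
- by move: i; apply/rV_continuousP.
- by move=> phi Hphi; exact: wd.
Qed.

End H1.

Section chains.
Context {R : realType} {N : nat}.
Notation mu := (@lebesgue_measure R).
Variable F : 'rV[R]_N -> R.
Implicit Types (p q r : 'rV[R]_N).

(** Polygonal paths with a cost: a segment is charged its length times an upper bound of
    [F] along it.  The cost bounds the weighted length and involves no derivative. *)
Inductive chain : 'rV[R]_N -> 'rV[R]_N -> R -> Prop :=
| chain_nil p : chain p p 0
| chain_cons p q r c M : chain p q c ->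
    (forall th, 0 <= th <= 1 -> F (q + th *: (r - q)) <= M) ->
    chain p r (c + M * enorm (r - q)).

Lemma chain_trans p q r c c' : chain p q c -> chain q r c' -> chain p r (c + c').
Proof.
move=> h1 h2; elim: h2 h1 => [q' |q' q1 r' c1 M _ IH HM] h1; first by rewrite addr0.
by rewrite addrA; apply: chain_cons HM; exact: IH.
Qed.

(** The weighted distance from [p] to [q], measured with polygons, is at most [c]; stated
    without forming the infimum. *)
Definition reach p q c := forall e, 0 < e -> exists2 c', c' <= c + e & chain p q c'.

Lemma reach_trans p q r c c' : reach p q c -> reach q r c' -> reach p r (c + c').
Proof.
move=> h1 h2 e e0; have e2 : 0 < e / 2 by rewrite divr_gt0.
have [c1 c1c h1'] := h1 _ e2; have [c2 c2c h2'] := h2 _ e2.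
by exists (c1 + c2); [lra|exact: chain_trans h1' h2'].
Qed.

Lemma reach_le p q c c' : c <= c' -> reach p q c -> reach p q c'.
Proof. by move=> cc h e e0; have [c1 c1c h1] := h _ e0; exists c1 => //; lra. Qed.

Lemma reach_seg p q M c : (forall th, 0 <= th <= 1 -> F (p + th *: (q - p)) <= M) ->
  M * enorm (q - p) <= c -> reach p q c.
Proof.
move=> HM Mc; apply: reach_le Mc _ => e e0; exists (M * enorm (q - p)); first by lra.
by rewrite -[M * _]add0r; apply: chain_cons HM; exact: chain_nil.
Qed.

Lemma norm_segment p q th : 0 <= th <= 1 -> enorm (p + th *: (q - p) - p) <= enorm (q - p).
Proof.
move=> /andP[t0 t1]; rewrite addrC addKr enormZ ger0_norm//.
by rewrite ler_piMl// enorm_ge0.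
Qed.

(** Inscribed polygons: on a short piece [F] is nearly constant along the arc and along
    its chord, and the chord is no longer than the integral of [g]. *)
Lemma reach_curve (V : R -> 'rV[R]_N) (g : R -> R) x y : x <= y ->
  continuous F -> (forall p, 0 <= F p) -> continuous V -> intg g x y ->
  (forall t, 0 <= g t) ->
  (forall s t, x <= s -> s <= t -> t <= y -> enorm (V t - V s) <= Int g s t) ->
  reach (V x) (V y) (Int (fun t => F (V t) * g t) x y).
Proof.
move=> xy Fc F0 Vc gi g0 Vg e e0.
have I0 : 0 <= Int g x y by apply: Int_ge0 => t _.
pose eta := e / (Int g x y + 1).
have I1 : 0 < Int g x y + 1 by rewrite ltr_wpDl.
have eta0 : 0 < eta by rewrite divr_gt0.
have eta2 : 0 < eta / 2 by rewrite divr_gt0.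
have Kc : compact (V @` `[x, y]).
  by apply: continuous_compact; [exact: continuous_subspaceT|exact: segment_compact].
have [d1 d10 H1] := heine Kc Fc eta2.
have d1N : 0 < d1 / (N%:R + 1) by rewrite divr_gt0// ltr_wpDl.
have [d2 d20 H2] := heine (@segment_compact _ x y) Vc d1N.
have FVc : continuous (fun t => F (V t)).
  by move=> t; apply: continuous_comp; [exact: Vc|exact: Fc].
have FVi a b : x <= a -> b <= y -> intg (fun t => F (V t) * g t) a b.
  by move=> xa bY; apply: intgM_continuous => //; exact: intgS gi.
pose P s t := exists2 c, c <= Int (fun t => F (V t) * g t) s t + eta * Int g s t & chain (V s) (V t) c.
suff [c cle cch] : P x y.
  exists c => //; apply: le_trans cle _; rewrite lerD2l /eta mulrAC ler_pdivrMr//.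
  by rewrite ler_wpM2l ?ltW// ltrDl.
apply: (@chop _ P x y d2) => // [s t xs st ty tsd|r s t xr rs st ty [c1 c1l h1] [c2 c2l h2]]; last first.
  exists (c1 + c2); last exact: chain_trans h1 h2.
  rewrite (@Int_cat _ _ r s t)//; last by apply: FVi.
  rewrite (@Int_cat _ g r s t)//; last by exact: intgS gi.
  by rewrite mulrDr addrACA lerD.
have close u : s <= u <= t -> enorm (V u - V s) < d1.
  move=> /andP[su ut]; apply: le_lt_trans (enorm_le_norm _) _.
  have : `|V s - V u| < d1 / (N%:R + 1).
    apply: H2; first by rewrite /= in_itv /= xs (le_trans st).
    rewrite -ball_normE /= distrC ger0_norm ?subr_ge0//; lra.
  rewrite ltr_pdivlMr ?ltr_wpDl// distrC => h; apply: le_lt_trans h.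
  by rewrite mulrC ler_wpM2l// lerDl.
have Ks : (V @` `[x, y]) (V s) by exists s => //; rewrite /= in_itv /= xs (le_trans st).
have near_s p : enorm (p - V s) < d1 -> `|F (V s) - F p| < eta / 2.
  move=> ps; apply: H1 => //; rewrite -ball_normE /= distrC.
  by apply: le_lt_trans (norm_le_enorm _) ps.
have hM th : 0 <= th <= 1 -> F (V s + th *: (V t - V s)) <= F (V s) + eta / 2.
  move=> thI; have := near_s (V s + th *: (V t - V s)).
  have h : enorm (V s + th *: (V t - V s) - V s) < d1.
    by apply: le_lt_trans (norm_segment _ _ thI) _; apply: close; rewrite st lexx.
  by move=> /(_ h); rewrite ltr_norml => /andP[? ?]; lra.
exists ((F (V s) + eta / 2) * enorm (V t - V s)); last first.
  by rewrite -[X in chain _ _ X]add0r; apply: chain_cons hM; exact: chain_nil.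
have gst : intg g s t by exact: intgS gi.
apply: (@le_trans _ _ ((F (V s) + eta / 2) * Int g s t)).
  by rewrite ler_wpM2l ?Vg// addr_ge0// ltW.
have FVst := FVi s t xs ty.
rewrite -!IntZ// -IntD//; last exact: intgZ.
apply: Int_le; [exact: intgZ|by apply: intgD => //; exact: intgZ|].
move=> u uI; rewrite -mulrDl ler_wpM2r//.
by have := near_s _ (close _ uI); rewrite ltr_norml => /andP[? ?]; lra.
Qed.

End chains.

(** * Chains as Lipschitz curves *)

Section competitor.
Context {R : realType} {N : nat}.
Notation mu := (@lebesgue_measure R).
Implicit Types (p q r : 'rV[R]_N) (w : R -> \bar R).

Lemma lower_integral_ccoo w (a b : R) : (forall x, 0 <= w x)%E -> a <= b ->
  (\int[mu]_(t in `[a, b]) w t = \int[mu]_(t in `]a, b[) w t)%E.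
Proof.
move=> w0; rewrite le_eqVlt => /orP[/eqP <-|ab].
  by rewrite set_itv1 set_itvoo0 integral_set0 integral_set1.
have -> : `[a, b]%classic = `]a, b[%classic `|` ([set a] `|` [set b]).
  apply/seteqP; split => t /=; rewrite !in_itv /=.
    by move=> /andP[]; rewrite !le_eqVlt => /orP[/eqP <-|->] /orP[/eqP ->|->]; auto.
  by move=> [/andP[/ltW -> /ltW ->]|[->|->]] //; rewrite lexx ltW.
rewrite lower_integral_setU//.
- rewrite lower_integral_setU//; last by apply/disj_set2P/seteqP; split => t //= [-> E]; move: ab; rewrite E ltxx.
  by rewrite !integral_set1 !adde0.
- exact: measurableU.
- apply/disj_set2P/seteqP; split => t //=; rewrite in_itv /= => -[/andP[h1 h2]].
  by move=> [E|E]; move: h1 h2; rewrite E ltxx.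
Qed.

Lemma lower_integral_oo_split w (a b c : R) : (forall x, 0 <= w x)%E -> a < b -> b < c ->
  (\int[mu]_(t in `]a, c[) w t = \int[mu]_(t in `]a, b[) w t + \int[mu]_(t in `]b, c[) w t)%E.
Proof.
move=> w0 ab bc.
have -> : `]a, c[%classic = `]a, b[%classic `|` ([set b] `|` `]b, c[%classic).
  apply/seteqP; split => t /=; rewrite !in_itv /=.
    by move=> /andP[h1 h2]; case: (ltgtP t b) => h; [left|right; right|right; left] => //; rewrite ?h1 ?h2.
  move=> [/andP[-> h]|[->|/andP[h ->]]]; [|by rewrite ab|by rewrite (lt_trans ab)].
  by rewrite (lt_trans h).
rewrite lower_integral_setU//; last 2 first.
- exact: measurableU.
- apply/disj_set2P/seteqP; split => t //=; rewrite !in_itv /= => -[/andP[h1 h2]].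
  by move=> [E|/andP[h3 _]]; [move: h2; rewrite E ltxx|have := lt_trans h2 h3; rewrite ltxx].
rewrite lower_integral_setU//; last first.
  by apply/disj_set2P/seteqP; split => t //= [->]; rewrite in_itv /= ltxx.
by rewrite integral_set1 add0e.
Qed.

Definition lipschitzR (eta : R -> 'rV[R]_N) := exists2 k, 0 <= k &
  forall s t, enorm (eta s - eta t) <= k * `|s - t|.

Lemma lipschitzR_continuous eta : lipschitzR eta -> continuous eta.
Proof.
move=> [k k0 ek]; apply/rV_continuousP => i; apply: (@lip_continuous _ _ k) => x y.
by apply: le_trans (ek x y); have := coord_le_enorm (eta x - eta y) i; rewrite !mxE.
Qed.

Lemma lipschitzR_glue (f g : R -> 'rV[R]_N) (w : R) : lipschitzR f -> lipschitzR g -> f w = g w ->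
  lipschitzR (fun t => if t <= w then f t else g t).
Proof.
move=> [k1 k10 h1] [k2 k20 h2] fg; exists (k1 + k2); first exact: addr_ge0.
move=> s t; wlog st : s t / s <= t.
  by move=> H; have [|/ltW] := leP s t; [exact: H|rewrite enormC distrC; exact: H].
have [sw|ws] := leP s w; have [tw|wt] := leP t w.
- by apply: le_trans (h1 s t) _; rewrite ler_wpM2r// lerDl.
- apply: le_trans (enormB_le _ (f w) _) _.
  have := h1 s w; have := h2 w t; rewrite -fg.
  rewrite (distrC s w) (distrC w t) (distrC s t) !ger0_norm ?subr_ge0//; last exact: ltW.
  move=> H2 H1; apply: le_trans (lerD H1 H2) _.
  have : 0 <= k1 * (t - w) by rewrite mulr_ge0// subr_ge0 ltW.
  have : 0 <= k2 * (w - s) by rewrite mulr_ge0// subr_ge0.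
  lra.
- by have := lt_le_trans ws (le_trans st tw); rewrite ltxx.
- by apply: le_trans (h2 s t) _; rewrite ler_wpM2r// lerDr.
Qed.

Lemma near_derive1 (f g : R -> 'rV[R]_N) t : (\near t, f t = g t) -> derive1 f t = derive1 g t.
Proof. by move=> fg; rewrite !derive1E (near_eq_derive _ fg). Qed.

Definition wspeed (F : 'rV[R]_N -> R) (eta : R -> 'rV[R]_N) t : \bar R :=
  (F (eta t) * enorm (derive1 eta t))%:E.

(** The last segment is run through with constant velocity in the second half of the
    parameter interval, the rest of the chain in the first half. *)
Lemma chain_curve (F : 'rV[R]_N -> R) p q c : (forall p, 0 <= F p) -> chain F p q c ->
  forall u v : R, u < v -> exists eta, [/\ lipschitzR eta, eta u = p, eta v = q &
    (\int[mu]_(t in `]u, v[) wspeed F eta t <= c%:E)%E].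
Proof.
move=> F0; elim => [{}p|{}p {}q r {}c M _ IH HM] u v uv.
  exists (cst p); split=> //.
    by exists 0 => // s t; rewrite subrr enorm0 mul0r.
  rewrite integral0_eq// => t _; rewrite /wspeed (_ : derive1 _ t = 0) ?enorm0 ?mulr0//.
  exact: derive1_cst.
pose w := (u + v) / 2.
have uw : u < w by rewrite /w; lra.
have wv : w < v by rewrite /w; lra.
have vw0 : 0 < v - w by rewrite subr_gt0.
have [e1 [l1 e1u e1w I1]] := IH u w uw.
pose e2 t := q + ((t - w) / (v - w)) *: (r - q).
have e2w : e2 w = q by rewrite /e2 subrr mul0r scale0r addr0.
have l2 : lipschitzR e2.
  exists (enorm (r - q) / (v - w)); first by rewrite divr_ge0 ?enorm_ge0// ltW.
  move=> s t; rewrite /e2 opprD addrACA subrr add0r -scalerBl enormZ.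
  rewrite -mulrBl opprB addrA subrK.
  by rewrite normrM normfV (gtr0_norm vw0); apply: eq_refl || rewrite le_eqVlt; apply/orP; left; apply/eqP; ring.
have de2 t : derive1 e2 t = (v - w)^-1 *: (r - q).
  have [//] : derivable e2 t 1 /\ derive1 e2 t = (v - w)^-1 *: (r - q).
  apply: cvg_derive1; apply: cvg_near_cst; near=> h.
  have h0 : h != 0 by near: h; exact: nbhs_dnbhs_neq.
  rewrite /e2 opprD addrACA subrr add0r -scalerBl scalerA; congr (_ *: _).
  by field; rewrite h0 gt_eqF.
exists (fun t => if t <= w then e1 t else e2 t); split.
- by apply: lipschitzR_glue => //; rewrite e2w.
- by rewrite (ltW uw).
- by rewrite leNgt wv /= /e2 divff ?gt_eqF// scale1r addrC subrK.
have ws0 f x : (0 <= wspeed F f x)%E by rewrite lee_fin mulr_ge0 ?enorm_ge0.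
rewrite (lower_integral_oo_split _ uw wv)// EFinD; apply: leeD.
  apply: le_trans I1; rewrite le_eqVlt; apply/orP; left; apply/eqP.
  apply: eq_integral => t; rewrite inE /= in_itv /= => /andP[ut tw].
  rewrite /wspeed (ltW tw); congr ((_ * enorm _)%:E); apply: near_derive1.
  by near=> s; rewrite ifT// ltW//; near: s; exact: lt_nbhsl.
apply: (@le_trans _ _ (\int[mu]_(t in `]w, v[) (M * (enorm (r - q) / (v - w)))%:E)%E).
  apply: lower_integral_le => // t; rewrite /= in_itv /= => /andP[wt tv].
  rewrite /wspeed /= (leNgt t w) wt /= lee_fin.
  have -> : derive1 (fun t => if t <= w then e1 t else e2 t) t = (v - w)^-1 *: (r - q).
    rewrite -(de2 t); apply: near_derive1.
    by near=> s; rewrite leNgt ifF//; apply/negbF; near: s; exact: lt_nbhsr.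
  rewrite enormZ gtr0_norm ?invr_gt0// [enorm _ / _]mulrC ler_wpM2r//.
    by rewrite mulr_ge0 ?enorm_ge0// invr_ge0 ltW.
  apply: HM; rewrite divr_ge0 ?(ltW vw0) ?subr_ge0 ?(ltW wt)//=.
  by rewrite ler_pdivrMr// mul1r lerD2r ltW.
rewrite integral_cst//= lebesgue_measure_itv /= lte_fin wv -EFinB -EFinM lee_fin.
by rewrite le_eqVlt; apply/orP; left; apply/eqP; field; rewrite gt_eqF.
Unshelve. all: by end_near. Qed.
End competitor.

(** * Minimality of the arcs of a geodesic *)

Lemma ge0_cancel (R : realType) (x y z : \bar R) : (0 <= x)%E -> (0 <= z)%E ->
  (x + z < +oo)%E -> (x + z <= y + z)%E -> (x <= y)%E.
Proof.
move=> x0 z0 xz; rewrite leeD2rE// ge0_fin_numE//; apply: le_lt_trans xz.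
by rewrite leeDr.
Qed.

Section minimality.
Context {R : realType} {N : nat}.
Notation mu := (@lebesgue_measure R).
Variables (W : 'rV[R]_N -> R) (Z : set 'rV[R]_N).
Hypotheses (Wc : continuous W) (W0 : forall q, 0 <= W q) (WZ : forall q, Z q -> W q = 0).
Let F q := Num.sqrt (W q).
Implicit Types (p q : 'rV[R]_N) (gamma : R -> 'rV[R]_N).

Lemma sqrtW_ge0 q : 0 <= F q.
Proof. exact: sqrtr_ge0. Qed.

Lemma sqrtW_continuous : continuous F.
Proof. by move=> q; apply: continuous_comp; [exact: Wc|exact: sqrt_continuous]. Qed.

Lemma wspeed_ge0 gamma t : (0 <= wspeed F gamma t)%E.
Proof. by rewrite lee_fin mulr_ge0 ?enorm_ge0 ?sqrtr_ge0. Qed.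

Lemma wspeed_well gamma t : Z (gamma t) -> wspeed F gamma t = 0%E.
Proof. by move=> Zt; rewrite /wspeed /F WZ// sqrtr0 mul0r. Qed.

Lemma weighted_lengthE gamma :
  weighted_length W Z gamma = (\int[mu]_(t in `[0%R, 1%R]) wspeed F gamma t)%E.
Proof.
rewrite /weighted_length integral_mkcond [RHS]integral_mkcond.
congr (integral _ _ _); apply/funext => t; rewrite !patchE.
have [tI|tI] := boolP (t \in `[0%R, 1%R]%classic); last first.
  by rewrite ifF//; apply/negbTE; move: tI; apply: contra; rewrite !inE => -[].
have [//|/negP tT] := boolP (t \in _).
have Zt : Z (gamma t).
  apply: contrapT => nZ; apply: tT; rewrite inE; split; first by rewrite inE in tI.
  by move=> [].
by rewrite -/(wspeed F gamma t) wspeed_well.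
Qed.

Lemma lipschitzR_LipZ gamma : lipschitzR gamma -> LipZ Z gamma.
Proof.
move=> lg; split; first by apply: continuous_subspaceT; exact: lipschitzR_continuous.
move=> D t _; have [k k0 h] := lg; exists 1, k; split => // s r _ _ _ _; exact: h.
Qed.

Lemma chain_segment p q : exists c, chain F p q c.
Proof.
have hc : continuous (fun th : R => F (p + th *: (q - p))).
  move=> th; apply: (@continuous_comp _ _ _ (fun th : R => p + th *: (q - p)) F); last exact: sqrtW_continuous.
  apply: cvgD; first exact: cvg_cst.
  by apply: cvgZr_tmp; exact: cvg_id.
have [M [_ hM]] := compact_bounded (continuous_compact (continuous_subspaceT hc) (@segment_compact _ 0 1)).
exists (0 + (`|M| + 1) * enorm (q - p)); apply: chain_cons; first exact: chain_nil.
move=> th thI; apply: le_trans (ler_norm _) _; apply: (hM (`|M| + 1)).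
  by rewrite (le_lt_trans (ler_norm M))// ltrDl.
by exists th => //; rewrite /= in_itv.
Qed.

(** Finiteness is what permits cancelling the common part of two lengths in [glue_minimal]. *)
Lemma dist_fin p q : (dist W Z p q < +oo)%E.
Proof.
have [c hc] := chain_segment p q.
have [eta [l e0 e1 I]] := chain_curve sqrtW_ge0 hc (@ltr01 R).
apply: (@le_lt_trans _ _ c%:E); last exact: ltry.
apply: (@le_trans _ _ (weighted_length W Z eta)).
  by apply: ereal_inf_lbound; exists eta => //; split => //; exact: lipschitzR_LipZ.
by rewrite weighted_lengthE lower_integral_ccoo// => t; exact: wspeed_ge0.
Qed.

Section glue.
Variables (P Q : 'rV[R]_N) (gamma : R -> 'rV[R]_N) (al be : R).
Hypotheses (gL : LipZ_between Z P Q gamma).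
Hypotheses (al0 : 0 <= al) (albe : al < be) (be1 : be <= 1).
Hypotheses (Za : Z (gamma al)) (Zb : Z (gamma be)).
Variable eta : R -> 'rV[R]_N.
Hypotheses (eL : lipschitzR eta) (ea : eta al = gamma al) (eb : eta be = gamma be).

Let g t := if al <= t <= be then eta t else gamma t.

Lemma glue_LipZ : LipZ_between Z P Q g.
Proof.
have [[gc gl] g0 g1] := gL; move: al0 albe be1 => h_al h_ab h_be.
have gal t : t <= al -> g t = gamma t.
  rewrite /g => ta; case: ifPn => // /andP[at' _].
  by have -> : t = al by apply/eqP; rewrite eq_le ta at'.
have gbe t : be <= t -> g t = gamma t.
  rewrite /g => bt; case: ifPn => // /andP[_ tb].
  by have -> : t = be by apply/eqP; rewrite eq_le bt tb.
have gin t : al <= t <= be -> g t = eta t by rewrite /g => ->.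
split; [split| by rewrite gal | by rewrite gbe].
- have -> : `[0, 1]%classic = (`[0, al]%classic `|` (`[al, be]%classic `|` `[be, 1]%classic)) :> set R.
    apply/seteqP; split => t /=; rewrite !in_itv /=; last first.
      by move=> [/andP[h1 h2]|[/andP[h1 h2]|/andP[h1 h2]]]; apply/andP; split; lra.
    move=> /andP[h1 h2]; case: (leP t al) => h3; [by left; rewrite h1|right].
    by case: (leP t be) => h4; [left; rewrite ltW|right; rewrite ltW].
  apply: withinU_continuous; [exact: itv_closed|by apply: closedU; exact: itv_closed| |].
    apply: (@subspace_eq_continuous _ _ _ gamma).
      by move=> t; rewrite inE /= in_itv /= => /andP[_ ta]; rewrite /from_subspace gal.
    apply: continuous_subspaceW gc => t /=; rewrite !in_itv /= => /andP[-> h].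
    by rewrite (le_trans h)// (le_trans _ be1)// ltW.
  apply: withinU_continuous; [exact: itv_closed|exact: itv_closed| |].
    apply: (@subspace_eq_continuous _ _ _ eta).
      by move=> t; rewrite inE /= in_itv /= => tI; rewrite /from_subspace gin.
    by apply: continuous_subspaceT; exact: lipschitzR_continuous.
  apply: (@subspace_eq_continuous _ _ _ gamma).
    by move=> t; rewrite inE /= in_itv /= => /andP[bt _]; rewrite /from_subspace gbe.
  apply: continuous_subspaceW gc => t /=; rewrite !in_itv /= => /andP[h ->].
  by rewrite (le_trans _ h)// (le_trans al0)// ltW.
- move=> /= t [t01 nT].
  have nZ s : 0 <= s <= 1 -> ~ well_times Z g s -> ~ Z (g s) by move=> s01 h Zs; apply: h.
  have [ta|at'] := ltP t al.
    have Dt : ([set t : R | 0 <= t <= 1] `\` well_times Z gamma) t.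
      by split => // -[_ Zt]; apply: (nZ _ t01 nT); rewrite gal// ltW.
    have [e [k [e0 H]]] := gl t Dt.
    exists (Num.min e (al - t)), k; split; first by rewrite lt_min e0 subr_gt0.
    have near_ s : `|s - t| < Num.min e (al - t) -> s < al /\ `|s - t| < e.
      by rewrite lt_min => /andP[-> h]; split => //; have := ler_norm (s - t); lra.
    move=> s r [s01 nTs] [r01 nTr] /near_[sa se] /near_[ra re].
    rewrite !gal ?(ltW sa) ?(ltW ra)//; apply: H => //; split => // -[_ Zs].
      by apply: (nZ _ s01 nTs); rewrite gal// ltW.
    by apply: (nZ _ r01 nTr); rewrite gal// ltW.
  have [tb|bt] := ltP be t.
    have Dt : ([set t : R | 0 <= t <= 1] `\` well_times Z gamma) t.
      by split => // -[_ Zt]; apply: (nZ _ t01 nT); rewrite gbe// ltW.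
    have [e [k [e0 H]]] := gl t Dt.
    exists (Num.min e (t - be)), k; split; first by rewrite lt_min e0 subr_gt0.
    have near_ s : `|s - t| < Num.min e (t - be) -> be < s /\ `|s - t| < e.
      by rewrite lt_min => /andP[-> h]; split => //; have := ler_norm (t - s); rewrite distrC; lra.
    move=> s r [s01 nTs] [r01 nTr] /near_[sa se] /near_[ra re].
    rewrite !gbe ?(ltW sa) ?(ltW ra)//; apply: H => //; split => // -[_ Zs].
      by apply: (nZ _ s01 nTs); rewrite gbe// ltW.
    by apply: (nZ _ r01 nTr); rewrite gbe// ltW.
  have ta : al < t.
    rewrite lt_neqAle at' andbT; apply/eqP => E.
    by apply: (nZ _ t01 nT); rewrite gal -E.
  have tb : t < be.
    rewrite lt_neqAle bt andbT; apply/eqP => E.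
    by apply: (nZ _ t01 nT); rewrite gbe E.
  have [k k0 H] := eL.
  exists (Num.min (t - al) (be - t)), k; split; first by rewrite lt_min !subr_gt0 ta.
  have near_ s : `|s - t| < Num.min (t - al) (be - t) -> al <= s <= be.
    rewrite lt_min => /andP[h1 h2]; have h3 := ler_norm (s - t); have := ler_norm (t - s).
    by rewrite distrC => h4; apply/andP; split; lra.
  by move=> s r _ _ /near_ sI /near_ rI; rewrite !gin.
Qed.

Hypothesis gmin : dist W Z P Q = weighted_length W Z gamma.

(** The curve with [eta] spliced in is admissible because its junctions are wells, where
    no Lipschitz condition is imposed; outside of the arc the two weighted lengths
    coincide. *)
Lemma glue_minimal :
  (\int[mu]_(t in `]al, be[) wspeed F gamma t <= \int[mu]_(t in `]al, be[) wspeed F eta t)%E.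
Proof.
move: al0 albe be1 => h_al h_ab h_be.
pose rest := `[0, al]%classic `|` `[be, 1]%classic : set R.
have mrest : measurable rest by apply: measurableU.
have split_rest f : (forall t, 0 <= f t)%E ->
    (\int[mu]_(t in `[0%R, 1%R]) f t = \int[mu]_(t in `]al, be[) f t + \int[mu]_(t in rest) f t)%E.
  move=> f0; rewrite -lower_integral_setU//; last first.
    apply/disj_set2P/seteqP; split => t //=; rewrite /rest /= !in_itv /= => -[/andP[h1 h2]].
    by move=> [/andP[_ h]|/andP[h _]]; lra.
  congr (integral _ _ _); apply/seteqP; split => t; rewrite /rest /= !in_itv /=; last first.
    by move=> [/andP[h1 h2]|[/andP[h1 h2]|/andP[h1 h2]]]; apply/andP; split; lra.
  move=> /andP[h1 h2]; case: (leP t al) => h3; [by right; left; rewrite h1|].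
  by case: (ltP t be) => h4; [left|right; right].
have rest_eq : (\int[mu]_(t in rest) wspeed F g t = \int[mu]_(t in rest) wspeed F gamma t)%E.
  apply: eq_integral => t; rewrite inE /rest /= !in_itv /= => tr.
  have [ta|at'] := ltP t al.
    rewrite /wspeed (_ : g t = gamma t); last by rewrite /g leNgt ta.
    congr ((_ * enorm _)%:E); apply: near_derive1.
    by near=> s; rewrite /g leNgt ifF//; apply/negbTE; rewrite negb_and negbK; apply/orP; left; near: s; exact: lt_nbhsl.
  have [tb|bt] := ltP be t.
    rewrite /wspeed (_ : g t = gamma t); last by rewrite /g (leNgt t) tb andbF.
    congr ((_ * enorm _)%:E); apply: near_derive1.
    by near=> s; rewrite /g (leNgt s) ifF//; apply/negbTE; rewrite negb_and negbK; apply/orP; right; near: s; exact: lt_nbhsr.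
  have tE : t = al \/ t = be.
    by case: tr => /andP[h1 h2]; [left|right]; apply/eqP; rewrite eq_le ?h1 ?h2 ?at' ?bt.
  rewrite !wspeed_well//; first by case: tE => ->.
  by case: tE => ->; rewrite /g ?lexx ?(ltW albe) /= ?ea ?eb.
have inner_eq : (\int[mu]_(t in `]al, be[) wspeed F g t = \int[mu]_(t in `]al, be[) wspeed F eta t)%E.
  apply: eq_integral => t; rewrite inE /= in_itv /= => /andP[h1 h2].
  rewrite /wspeed /g (ltW h1) (ltW h2) /=; congr ((_ * enorm _)%:E); apply: near_derive1.
  near=> s; have h3 : al < s by near: s; exact: lt_nbhsr.
  have h4 : s < be by near: s; exact: lt_nbhsl.
  by rewrite (ltW h3) (ltW h4).
have gE : weighted_length W Z g =
    (\int[mu]_(t in `]al, be[) wspeed F eta t + \int[mu]_(t in rest) wspeed F gamma t)%E.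
  have h := etrans (weighted_lengthE g) (split_rest _ (wspeed_ge0 g)).
  exact: (etrans h (f_equal2 (fun a b : \bar R => a + b)%E inner_eq rest_eq)).
have gammaE : weighted_length W Z gamma =
    (\int[mu]_(t in `]al, be[) wspeed F gamma t + \int[mu]_(t in rest) wspeed F gamma t)%E.
  exact: (etrans (weighted_lengthE gamma) (split_rest _ (wspeed_ge0 gamma))).
have le_gamma_g : (weighted_length W Z gamma <= weighted_length W Z g)%E.
  rewrite -gmin; apply: ereal_inf_lbound.
  exact: (imageP (weighted_length W Z) glue_LipZ).
have Efin : (weighted_length W Z gamma < +oo)%E by rewrite -gmin dist_fin.
rewrite gE gammaE in le_gamma_g; rewrite gammaE in Efin.
have r0 : (0 <= \int[mu]_(t in rest) wspeed F gamma t)%E by apply: integral_ge0 => t _; exact: wspeed_ge0.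
have i0 : (0 <= \int[mu]_(t in `]al, be[) wspeed F gamma t)%E by apply: integral_ge0 => t _; exact: wspeed_ge0.
exact: ge0_cancel i0 r0 Efin le_gamma_g.
Unshelve. all: by end_near. Qed.

End glue.
End minimality.

(** * Travelling along an arc with speed sqrt (2 W) *)

Lemma continuous_enorm (R : realType) (N : nat) (V : R -> 'rV[R]_N) (x e : R) :
  continuous V -> 0 < e ->
  exists2 d, 0 < d & forall t, `|x - t| < d -> enorm (V t - V x) < e.
Proof.
move=> Vc e0; have /cvg_enormP h : V t @[t --> x] --> V x by exact: Vc.
have := h e e0; rewrite /= nearE /= -nbhs_ballE => -[d /= d0 hd].
by exists d => // t xt; apply: hd; rewrite -ball_normE.
Qed.

Lemma additive_le (R : realType) (p p1 p2 q q1 q2 k x y z : R) :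
  p = p1 + p2 -> q = q1 + q2 -> p1 <= q1 + k * (y - x) -> p2 <= q2 + k * (z - y) ->
  p <= q + k * (z - x).
Proof. by move=> -> ->; lra. Qed.

Section time_change.
Context {R : realType} {N : nat}.
Notation mu := (@lebesgue_measure R).
Variables (W : 'rV[R]_N -> R) (Z : set 'rV[R]_N).
Hypotheses (Wc : continuous W) (W0 : forall q, 0 <= W q) (WZ : forall q, W q = 0 <-> Z q).
Let F q := Num.sqrt (W q).
Let r q := Num.sqrt (2 * W q).

Variables (gam : R -> 'rV[R]_N) (sp : R -> R) (al be m0 : R).
Hypotheses (albe : al < be) (gamc : continuous gam).
Hypotheses (Za : Z (gam al)) (Zb : Z (gam be)).
Hypothesis (nZ : forall t, al < t < be -> ~ Z (gam t)).
Hypotheses (sp0 : forall t, 0 <= sp t)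
  (spi : forall s t, al < s -> t < be -> intg sp s t)
  (gsp : forall s t, al < s -> s <= t -> t < be -> enorm (gam t - gam s) <= Int sp s t)
  (m0P : forall s t, al < s -> s <= t -> t < be ->
     Int (fun u => F (gam u) * sp u) s t <= m0).

Lemma sqrt2W_continuous : continuous r.
Proof.
move=> q; apply: (@continuous_comp _ _ _ (fun q => 2 * W q) Num.sqrt); last exact: sqrt_continuous.
by have FF := nbhs_filter q; apply: cvgM; [exact: cvg_cst|exact: Wc].
Qed.

Lemma sqrt2W_ge0 q : 0 <= r q.
Proof. exact: sqrtr_ge0. Qed.

Lemma sqrt2W_gam_gt0 t : al < t < be -> 0 < r (gam t).
Proof.
move=> tI; rewrite sqrtr_gt0 mulr_gt0// lt_neqAle W0 andbT eq_sym.
by apply/eqP => /WZ; exact: nZ.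
Qed.

Lemma sqrt2W_gam_continuous : continuous (fun t => r (gam t)).
Proof. by move=> t; apply: continuous_comp; [exact: gamc|exact: sqrt2W_continuous]. Qed.

Let theta t := (r (gam t))^-1 * sp t.

Lemma theta_r t : al < t < be -> r (gam t) * theta t = sp t.
Proof. by move=> tI; rewrite /theta mulrA divff ?mul1r// gt_eqF// sqrt2W_gam_gt0. Qed.

Lemma theta_ge0 t : 0 <= theta t.
Proof. by rewrite mulr_ge0// invr_ge0 sqrt2W_ge0. Qed.

Lemma theta_intg s t : al < s -> t < be -> intg theta s t.
Proof.
move=> als tbe; have [st|ts] := leP s t; last first.
  by rewrite /intg set_itv_ge ?bnd_simp -?ltNge//; exact: integrable_set0.
(* [r \o gam] is bounded below on [s, t], so its truncated inverse is continuous *)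
have [c /= cI cmin] := EVT_min st (continuous_subspaceT sqrt2W_gam_continuous).
have m0' : 0 < r (gam c).
  move: cI; rewrite in_itv /= => /andP[h1 h2].
  by apply: sqrt2W_gam_gt0; rewrite (lt_le_trans als h1) (le_lt_trans h2).
have hc : continuous (fun u => (Num.max (r (gam c)) (r (gam u)))^-1).
  move=> u; apply: cvgV; first by rewrite gt_eqF// lt_max m0'.
  apply: (@continuous_comp _ _ _ (fun u => r (gam u)) (Num.max (r (gam c)))).
    exact: sqrt2W_gam_continuous.
  apply: (@lip_continuous _ _ 1) => x y; rewrite mul1r.
  have h1 := ler_norm (x - y); have := ler_norm (y - x); rewrite distrC => h2.
  by rewrite ler_norml; apply/andP; split; case: (leP (r (gam c)) x) => ?; case: (leP (r (gam c)) y) => ?; lra.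
have := intgM_continuous hc (spi als tbe); apply: eq_integrable => // u.
rewrite inE /= => uI; rewrite /theta /=; congr ((_^-1 * _)%:E).
by apply/max_idPr; exact: cmin.
Qed.

Let t0 := (al + be) / 2.
Lemma t0I : al < t0 < be.
Proof. by have h := albe; rewrite /t0; apply/andP; split; lra. Qed.

(** The time at which a traveller with speed sqrt (2 W) is at parameter [t], counted from
    the midpoint; [theta] is the pace dz / dt. *)
Definition travel_time t := if t0 <= t then Int theta t0 t else - Int theta t t0.

Lemma travel_time_diff s t : al < s -> s <= t -> t < be -> travel_time t - travel_time s = Int theta s t.
Proof.
move=> als st tbe; have t0I := t0I.
move: t0I => /andP[h1 h2]; rewrite /travel_time.
have [t0s|st0] := leP t0 s.
  rewrite (le_trans t0s st) (@Int_cat _ theta t0 s t)//; last exact: theta_intg.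
  by rewrite addrC addKr.
have [t0t|tt0] := leP t0 t.
  by rewrite opprK addrC -Int_cat ?(ltW st0)//; exact: theta_intg.
rewrite opprK (@Int_cat _ theta s t t0) ?(ltW tt0)//; last exact: theta_intg.
by rewrite addrC addrK.
Qed.

Lemma travel_time_le s t : al < s -> s <= t -> t < be -> travel_time s <= travel_time t.
Proof. by move=> als st tbe; rewrite -subr_ge0 travel_time_diff//; apply: Int_ge0 => u _; exact: theta_ge0. Qed.

Lemma travel_time_IVT s t z : al < s -> s <= t -> t < be -> travel_time s <= z <= travel_time t ->
  exists2 u, s <= u <= t & travel_time u = z.
Proof.
move=> als st tbe /andP[z1 z2].
have [] := @IVT _ (fun u => Int theta s u) s t (z - travel_time s) st.
- exact: (parameterized_integral_continuous st (theta_intg als tbe)).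
- rewrite Int_at min_l ?max_r; last 2 first.
    by apply: Int_ge0 => u _; exact: theta_ge0.
    by apply: Int_ge0 => u _; exact: theta_ge0.
  by rewrite subr_ge0 z1 -travel_time_diff// lerD2r.
move=> u; rewrite in_itv /= => /andP[su ut] E; exists u; first by rewrite su.
by move: E; rewrite -travel_time_diff// ?(le_lt_trans ut)// => /addIr.
Qed.

Lemma gam_travel_time s t M : al < s -> s <= t -> t < be ->
  (forall u, s <= u <= t -> r (gam u) <= M) ->
  enorm (gam t - gam s) <= M * (travel_time t - travel_time s).
Proof.
move=> als st tbe hM; apply: le_trans (gsp als st tbe) _.
rewrite travel_time_diff// -IntZ//; last exact: theta_intg.
apply: Int_le; [exact: spi|by apply: intgZ; exact: theta_intg|].
move=> u uI; have := uI => /andP[su ut].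
rewrite -theta_r; last by rewrite (lt_le_trans als su) (le_lt_trans ut tbe).
by rewrite ler_wpM2r ?theta_ge0// hM.
Qed.

(** Travel time to a well is infinite: near it the rate is at most [c] times the
    distance [rho], so within a time window of length 1 / (2 c) the supremum of [rho]
    is at most half of itself. *)
Lemma no_finite_time (A : set R) (z : 'rV[R]_N) (c d : R) (t1 : R) :
  0 < c -> ~ Z (gam t1) -> Z z -> A t1 ->
  (forall t, A t -> al < t < be) ->
  (forall s t u, A s -> A t -> s <= u <= t -> A u) ->
  (forall t, A t -> enorm (gam t - z) <= d /\ r (gam t) <= c * enorm (gam t - z)) ->
  (forall s t, A s -> A t -> travel_time t - travel_time s <= (2 * c)^-1) ->
  (forall e, 0 < e -> exists2 t, A t & enorm (gam t - z) < e) -> False.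
Proof.
move=> c0 nZt1 Zz At1 AI Aitv Ar AX A0.
pose rho t := enorm (gam t - z).
have hs : has_sup (rho @` A).
  by split; [exists (rho t1), t1|exists d => _ [t At <-]; have [] := Ar t At].
(* [M <= M / 2] will contradict [rho t1 > 0] *)
pose M := sup (rho @` A).
have rM t : A t -> rho t <= M by move=> At; apply: sup_upper_bound => //; exists t.
have M0 : 0 <= M by apply: le_trans (rM _ At1); exact: enorm_ge0.
have step s t : A s -> A t -> s <= t -> enorm (gam t - gam s) <= M / 2.
  move=> As At st; have /andP[als _] := AI _ As; have /andP[_ tbe] := AI _ At.
  apply: le_trans (gam_travel_time (M := c * M) als st tbe _) _.
    move=> u uI; have Au := Aitv _ _ _ As At uI.
    have [_ h] := Ar _ Au; apply: le_trans h _; rewrite (ler_wpM2l (ltW c0))//.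
    exact: rM.
  rewrite (_ : M / 2 = c * M * (2 * c)^-1); last by field; rewrite gt_eqF.
  by rewrite ler_wpM2l ?mulr_ge0 ?(ltW c0)//; exact: AX.
have half t : A t -> rho t <= M / 2.
  move=> At; apply/ler_addgt0Pr => e e0; have [t' At' ht'] := A0 e e0.
  apply: le_trans (enormB_le _ (gam t') _) _; apply: lerD; last exact: ltW.
  have [tt|tt] := leP t t'; last by apply: step => //; exact: ltW.
  by rewrite enormC; exact: step.
have : M <= M / 2 by apply: ge_sup; [exact: hs.1|move=> _ [t At <-]; exact: half].
have : 0 < rho t1.
  rewrite lt_neqAle enorm_ge0 andbT eq_sym; apply/eqP => /enorm_eq0/eqP.
  by rewrite subr_eq0 => /eqP E; apply: nZt1; rewrite E.
by have := rM _ At1; lra.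
Qed.

Hypothesis quad : exists C delta : R, [/\ 0 < C, 0 < delta &
    forall z q, Z z -> enorm (q - z) < delta -> W q <= C * enorm (q - z) ^+ 2].

Lemma sqrt2W_linear : exists c delta : R, [/\ 0 < c, 0 < delta &
    forall z q, Z z -> enorm (q - z) < delta -> r q <= c * enorm (q - z)].
Proof.
have [C [d [C0 d0 H]]] := quad.
exists (Num.sqrt (2 * C)), d; split => //; first by rewrite sqrtr_gt0 mulr_gt0.
move=> z q Zz qz; have Wq := H z q Zz qz.
rewrite -[X in _ * X]ger0_norm ?enorm_ge0// -sqrtr_sqr -sqrtrM ?mulr_ge0 ?(ltW C0)//.
by rewrite ler_wsqrtr// -mulrA ler_wpM2l.
Qed.

(** Were the travel time bounded, it would vary by less than 1 / (2 c) close to the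
    endpoint, against [no_finite_time]. *)
Lemma travel_time_unbounded_right B : exists2 t, al < t < be & B < travel_time t.
Proof.
apply: contrapT => /forall2NP HB.
have XB t : al < t < be -> travel_time t <= B.
  by move=> tI; have [//|/negP] := HB t; rewrite -leNgt.
have [c [d [c0 d0 H]]] := sqrt2W_linear.
pose S := [set travel_time t | t in [set t | al < t < be]].
have t0I := t0I.
have hS : has_sup S.
  by split; [exists (travel_time t0), t0|exists B => _ [t tI <-]; exact: XB].
have ic : 0 < (2 * c)^-1 by rewrite invr_gt0 mulr_gt0.
have [_ [ta taI <-] Xta] := sup_adherent ic hS.
have [tb tbbe hb] : exists2 tb, tb < be & forall t, tb <= t -> t <= be -> enorm (gam t - gam be) < d.
  have [e e0 he] := continuous_enorm be gamc d0.
  exists (be - e / 2); first by rewrite gtrBl divr_gt0.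
  move=> t tbt tbe; apply: he; rewrite ger0_norm ?subr_ge0//; lra.
pose t1 := Num.max ta tb.
have /andP[alta tabe] := taI.
have t1I : al < t1 < be by rewrite /t1 lt_max alta /= gt_max tabe tbbe.
have t1a : ta <= t1 by rewrite /t1 le_max lexx.
have t1b : tb <= t1 by rewrite /t1 le_max lexx orbT.
have AI t : t1 <= t < be -> al < t < be.
  by move=> /andP[h1 ->]; rewrite andbT (lt_le_trans _ h1)//; have /andP[] := t1I.
have /andP[_ t1be] := t1I.
apply: (@no_finite_time [set t | t1 <= t < be] (gam be) c d t1) => //=.
- exact: nZ.
- by rewrite lexx t1be.
- move=> s t u /andP[s1 _] /andP[_ t2] /andP[su ut].
  by rewrite (le_trans s1 su) (le_lt_trans ut t2).
- move=> t /andP[h1 h2].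
  have h : enorm (gam t - gam be) < d by apply: hb; [exact: le_trans t1b h1|exact: ltW].
  by split; [exact: ltW|exact: H].
- move=> s t sI tI; have /andP[s1 _] := sI; have /andP[als sbe] := AI _ sI.
  have : travel_time t <= sup S by apply: sup_upper_bound => //; exists t => //; exact: AI.
  have : travel_time ta <= travel_time s by apply: travel_time_le => //; exact: le_trans t1a s1.
  by lra.
- move=> e e0; have [e' e'0 he] := continuous_enorm be gamc e0.
  exists (Num.max t1 (be - e' / 2)).
    by rewrite le_max lexx /= gt_max t1be /= gtrBl divr_gt0.
  have hM : Num.max t1 (be - e' / 2) < be by rewrite gt_max t1be /= gtrBl divr_gt0.
  apply: he; rewrite ger0_norm ?subr_ge0 ?(ltW hM)//.
  have : be - e' / 2 <= Num.max t1 (be - e' / 2) by rewrite le_max lexx orbT.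
  by lra.
Qed.

Lemma travel_time_unbounded_left B : exists2 t, al < t < be & travel_time t < B.
Proof.
apply: contrapT => /forall2NP HB.
have XB t : al < t < be -> B <= travel_time t.
  by move=> tI; have [//|/negP] := HB t; rewrite -leNgt.
have [c [d [c0 d0 H]]] := sqrt2W_linear.
pose S := [set travel_time t | t in [set t | al < t < be]].
have t0I := t0I.
have hS : has_inf S.
  by split; [exists (travel_time t0), t0|exists B => _ [t tI <-]; exact: XB].
have ic : 0 < (2 * c)^-1 by rewrite invr_gt0 mulr_gt0.
have [_ [ta taI <-] Xta] := inf_adherent ic hS.
have [tb tbbe hb] : exists2 tb, al < tb & forall t, al <= t -> t <= tb -> enorm (gam t - gam al) < d.
  have [e e0 he] := continuous_enorm al gamc d0.
  exists (al + e / 2); first by rewrite ltrDl divr_gt0.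
  move=> t tbt tbe; apply: he; rewrite distrC ger0_norm ?subr_ge0//; lra.
pose t1 := Num.min ta tb.
have /andP[alta tabe] := taI.
have t1I : al < t1 < be by rewrite /t1 gt_min tabe /= lt_min alta tbbe.
have t1a : t1 <= ta by rewrite /t1 ge_min lexx.
have t1b : t1 <= tb by rewrite /t1 ge_min lexx orbT.
have AI t : al < t <= t1 -> al < t < be.
  by move=> /andP[-> h1]; rewrite (le_lt_trans h1)//; have /andP[] := t1I.
have /andP[t1be _] := t1I.
apply: (@no_finite_time [set t | al < t <= t1] (gam al) c d t1) => //=.
- exact: nZ.
- by rewrite lexx t1be.
- move=> s t u /andP[s1 _] /andP[_ t2] /andP[su ut].
  by rewrite (lt_le_trans s1 su) (le_trans ut t2).
- move=> t /andP[h1 h2].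
  have h : enorm (gam t - gam al) < d by apply: hb; [exact: ltW|exact: le_trans h2 t1b].
  by split; [exact: ltW|exact: H].
- move=> s t sI tI; have /andP[_ s1] := tI; have /andP[als sbe] := AI _ sI; have /andP[alt tbe] := AI _ tI.
  have : inf S <= travel_time s by apply: inf_lbound; [exact: hS.2|exists s => //; exact: AI].
  have : travel_time t <= travel_time ta by apply: travel_time_le => //; exact: le_trans s1 t1a.
  by lra.
- move=> e e0; have [e' e'0 he] := continuous_enorm al gamc e0.
  have hM : al < Num.min t1 (al + e' / 2) by rewrite lt_min t1be /= ltrDl divr_gt0.
  exists (Num.min t1 (al + e' / 2)); first by rewrite hM ge_min lexx.
  apply: he; rewrite distrC ger0_norm ?subr_ge0 ?(ltW hM)//.
  have : Num.min t1 (al + e' / 2) <= al + e' / 2 by rewrite ge_min lexx orbT.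
  by lra.
Qed.

Lemma travel_time_surj z : exists t, al < t < be /\ travel_time t = z.
Proof.
have [s /andP[als sbe] Xs] := travel_time_unbounded_left z.
have [t /andP[alt tbe] Xt] := travel_time_unbounded_right z.
have st : s <= t.
  by rewrite leNgt; apply/negP => ts; have := travel_time_le alt (ltW ts) sbe; lra.
have [u /andP[su ut] Xu] : exists2 u, s <= u <= t & travel_time u = z.
  by apply: travel_time_IVT => //; rewrite !ltW.
by exists u; split => //; rewrite (lt_le_trans als) ?(le_lt_trans ut).
Qed.

(** A section of [travel_time], which is not injective where the curve rests; the
    parameters with the same travel time lie at the same point of space, see
    [reparam_travel_time]. *)
Definition position_time z := sval (cid (travel_time_surj z)).

Lemma position_timeI z : al < position_time z < be.
Proof. by rewrite /position_time; case: cid => t []. Qed.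

Lemma position_timeK z : travel_time (position_time z) = z.
Proof. by rewrite /position_time; case: cid => t []. Qed.

(** The arc in its natural time, for which kinetic and potential energy balance. *)
Definition reparam z := gam (position_time z).

Lemma sqrt2W_gam_bounded s t : exists M, forall u, s <= u <= t -> r (gam u) <= M.
Proof.
have [st|ts] := leP s t; last first.
  by exists 0 => u /andP[su ut]; have := lt_le_trans ts (le_trans su ut); rewrite ltxx.
have [c _ cmax] := EVT_max st (continuous_subspaceT sqrt2W_gam_continuous).
by exists (r (gam c)) => u uI; apply: cmax; rewrite in_itv.
Qed.

Lemma reparam_travel_time t : al < t < be -> reparam (travel_time t) = gam t.
Proof.
move=> /andP[alt tbe]; have /andP[als sbe] := position_timeI (travel_time t); set s := position_time (travel_time t) in als sbe *.
have E : travel_time s = travel_time t by rewrite position_timeK.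
apply/eqP; rewrite -subr_eq0; apply/eqP; apply: enorm_eq0; apply/eqP.
rewrite eq_le enorm_ge0 andbT.
have [st|ts] := leP s t.
  have [M hM] := sqrt2W_gam_bounded s t.
  by rewrite enormC; apply: le_trans (gam_travel_time als st tbe hM) _; rewrite E subrr mulr0.
have [M hM] := sqrt2W_gam_bounded t s.
by apply: le_trans (gam_travel_time alt (ltW ts) sbe hM) _; rewrite E subrr mulr0.
Qed.

Lemma position_time_le s z : al < s < be -> travel_time s < z -> s <= position_time z.
Proof.
move=> /andP[als sbe] h; rewrite leNgt; apply/negP => ts.
have /andP[h1 _] := position_timeI z; have := travel_time_le h1 (ltW ts) sbe; rewrite position_timeK; lra.
Qed.

Lemma position_time_ge s z : al < s < be -> z < travel_time s -> position_time z <= s.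
Proof.
move=> /andP[als sbe] h; rewrite leNgt; apply/negP => ts.
have /andP[_ h1] := position_timeI z; have := travel_time_le als (ltW ts) h1; rewrite position_timeK; lra.
Qed.

Lemma reparam_lip z1 z2 M : z1 <= z2 -> (forall z, z1 <= z <= z2 -> r (reparam z) <= M) ->
  enorm (reparam z2 - reparam z1) <= M * (z2 - z1).
Proof.
move=> z12 hM; have /andP[als sbe] := position_timeI z1; have /andP[alt tbe] := position_timeI z2.
have [st|ts] := leP (position_time z1) (position_time z2); last first.
  have := travel_time_le alt (ltW ts) sbe; rewrite !position_timeK => z21.
  have -> : z1 = z2 by apply/eqP; rewrite eq_le z12.
  by rewrite !subrr enorm0 mulr0.
have := @gam_travel_time (position_time z1) (position_time z2) M als st tbe; rewrite !position_timeK; apply.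
move=> u /andP[su ut]; have uI : al < u < be by rewrite (lt_le_trans als) ?(le_lt_trans ut).
have /andP[alu ube] := uI.
rewrite -reparam_travel_time//; apply: hM; apply/andP; split.
  by rewrite -[leLHS]position_timeK; apply: travel_time_le.
by rewrite -[leRHS]position_timeK; apply: travel_time_le.
Qed.

Lemma r_reparam_bounded n : exists2 M, 0 <= M & forall z, `|z| <= n -> r (reparam z) <= M.
Proof.
have h1 := position_timeI (- n - 1); have h2 := position_timeI (n + 1).
have [M hM] := sqrt2W_gam_bounded (position_time (- n - 1)) (position_time (n + 1)).
exists `|M| => // z; rewrite ler_norml => /andP[z1 z2].
apply: le_trans (ler_norm _); apply: hM; apply/andP; split.
  by apply: position_time_le => //; rewrite position_timeK; lra.
by apply: position_time_ge => //; rewrite position_timeK; lra.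
Qed.

Lemma reparam_lip_bounded n : exists2 M, 0 <= M & forall x y, `|x| <= n -> `|y| <= n ->
  enorm (reparam x - reparam y) <= M * `|x - y|.
Proof.
have [M M0 hM] := r_reparam_bounded n; exists M => // x y xn yn.
wlog xy : x y xn yn / x <= y.
  by move=> H; have [|/ltW] := leP x y; [exact: H|rewrite enormC distrC; exact: H].
rewrite enormC distrC (ger0_norm (_ : 0 <= y - x)) ?subr_ge0//; apply: reparam_lip => //.
move=> z /andP[xz zy]; apply: hM; move: xn yn; rewrite !ler_norml => /andP[? ?] /andP[? ?].
by apply/andP; split; lra.
Qed.

Lemma reparam_continuous : continuous reparam.
Proof.
move=> x; apply/cvg_enormP => e e0.
have [M M0 hM] := reparam_lip_bounded (`|x| + 1).
have e1 : 0 < e / (M + 1) by rewrite divr_gt0// ltr_wpDl.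
have d0 : 0 < Num.min 1 (e / (M + 1)) by rewrite lt_min ltr01.
have hb : nbhs (x : R) (ball (x : R) (Num.min 1 (e / (M + 1)))) by exact: nbhsx_ballx.
apply: filterS hb => y; rewrite -ball_normE /= lt_min => /andP[xy1 xy2].
have yn : `|y| <= `|x| + 1.
  have := ler_normD x (y - x); rewrite addrC subrK (distrC y); lra.
apply: le_lt_trans (hM y x yn _) _; first by rewrite lerDl.
rewrite ltr_pdivlMr ?ltr_wpDl// in xy2; apply: le_lt_trans xy2.
by rewrite distrC mulrC ler_wpM2l// lerDl.
Qed.

Lemma reparam_nZ z : ~ Z (reparam z).
Proof. by apply: nZ; exact: position_timeI. Qed.

Lemma reparam_cvgy : reparam z @[z --> +oo] --> gam be.
Proof.
apply/cvg_enormP => e e0.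
have [d d0 hd] := continuous_enorm be gamc e0.
pose s := Num.max t0 (be - d / 2).
have /andP[_ t0be] := t0I; have sbe : s < be by rewrite gt_max t0be; lra.
have als : al < s by rewrite lt_max; have /andP[->] := t0I.
near=> z; apply: hd.
have /andP[_ zbe] := position_timeI z; rewrite ger0_norm ?subr_ge0 ?(ltW zbe)//.
have : s <= position_time z by apply: position_time_le; [rewrite als|near: z; apply: nbhs_pinfty_gt; rewrite num_real].
have : be - d / 2 <= s by rewrite le_max lexx orbT.
lra.
Unshelve. all: by end_near. Qed.

Lemma reparam_cvgNy : reparam z @[z --> -oo] --> gam al.
Proof.
apply/cvg_enormP => e e0.
have [d d0 hd] := continuous_enorm al gamc e0.
pose s := Num.min t0 (al + d / 2).
have /andP[t0be _] := t0I; have sbe : al < s by rewrite lt_min t0be; lra.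
have als : s < be by rewrite gt_min; have /andP[_ ->] := t0I.
near=> z; apply: hd.
have /andP[zbe _] := position_timeI z; rewrite distrC ger0_norm ?subr_ge0 ?(ltW zbe)//.
have : position_time z <= s by apply: position_time_ge; [rewrite sbe|near: z; apply: nbhs_ninfty_lt; rewrite num_real].
have : s <= al + d / 2 by rewrite ge_min lexx orbT.
lra.
Unshelve. all: by end_near. Qed.

Lemma m0_ge0 : 0 <= m0.
Proof.
have /andP[h1 h2] := t0I; apply: le_trans (m0P h1 (lexx _) h2).
by rewrite Int_at.
Qed.

Lemma W_reparam_continuous : continuous (fun z => 2 * W (reparam z)).
Proof.
move=> z; apply: cvgM; first exact: cvg_cst.
by apply: continuous_comp; [exact: reparam_continuous|exact: Wc].
Qed.

Lemma Wgamc : continuous (fun z => 2 * W (gam z)).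
Proof.
move=> z; apply: cvgM; first exact: cvg_cst.
by apply: continuous_comp; [exact: gamc|exact: Wc].
Qed.

Lemma theta_weight u : al < u < be ->
  2 * W (gam u) * theta u = Num.sqrt 2 * (F (gam u) * sp u).
Proof.
move=> uI; rewrite -theta_r// /F.
have -> : 2 * W (gam u) = r (gam u) ^+ 2 by rewrite sqr_sqrtr// mulr_ge0.
have -> : r (gam u) = Num.sqrt 2 * Num.sqrt (W (gam u)) by rewrite -sqrtrM.
ring.
Qed.

Lemma Fsp_intg a b : al < a -> b < be -> intg (fun u => Num.sqrt 2 * (F (gam u) * sp u)) a b.
Proof.
move=> ala bbe; apply: intgZ; apply: intgM_continuous; last exact: spi.
move=> u; apply: (@continuous_comp _ _ _ gam F); first exact: gamc.
exact: (sqrtW_continuous Wc).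
Qed.

(** The substitution 2 W dz = sqrt 2 F(gam) sp dt, on a piece where [W] is nearly constant
    and up to a small multiple of the elapsed time; [chop] joins the pieces. *)
Lemma potential_local a b eta : al < a -> a <= b -> b < be ->
  (forall u, a <= u <= b -> `|2 * W (gam a) - 2 * W (gam u)| <= eta / 2) ->
  Int (fun z => 2 * W (reparam z)) (travel_time a) (travel_time b) <=
  Int (fun u => Num.sqrt 2 * (F (gam u) * sp u)) a b + eta * (travel_time b - travel_time a).
Proof.
move=> ala ab bbe close.
have Xab : travel_time a <= travel_time b by exact: travel_time_le.
apply: (@le_trans _ _ ((2 * W (gam a) + eta / 2) * (travel_time b - travel_time a))).
  apply: Int_le_cst => //; first by apply: intgT_continuous; exact: W_reparam_continuous.
  move=> z zI; have [u uI <-] := travel_time_IVT ala ab bbe zI.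
  have /andP[au ub] := uI.
  rewrite reparam_travel_time; last by rewrite (lt_le_trans ala) ?(le_lt_trans ub).
  by have := close u uI; rewrite ler_norml => /andP[? ?]; lra.
have ti := theta_intg ala bbe; have fi := Fsp_intg ala bbe.
rewrite travel_time_diff// -[eta * Int _ _ _]IntZ// -[(_ + _) * Int _ _ _]IntZ//.
rewrite -[leRHS]IntD//; last by apply: intgZ.
apply: Int_le; first by apply: intgZ.
  by apply: intgD => //; apply: intgZ.
move=> u uI; have /andP[au ub] := uI.
rewrite -theta_weight; last by rewrite (lt_le_trans ala) ?(le_lt_trans ub).
rewrite -mulrDl ler_wpM2r ?theta_ge0//.
by have := close u uI; rewrite ler_norml => /andP[? ?]; lra.
Qed.

Lemma potential_between_travel_times s t : al < s -> s <= t -> t < be ->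
  Int (fun z => 2 * W (reparam z)) (travel_time s) (travel_time t) <= Num.sqrt 2 * m0.
Proof.
move=> als st tbe.
apply: (@le_trans _ _ (Int (fun u => Num.sqrt 2 * (F (gam u) * sp u)) s t)); last first.
  rewrite IntZ; first by rewrite ler_wpM2l ?sqrtr_ge0// m0P.
  apply: intgM_continuous; last exact: spi.
  by move=> u; apply: (@continuous_comp _ _ _ gam F); [exact: gamc|exact: (sqrtW_continuous Wc)].
apply/ler_addgt0Pr => e e0.
have Xst : travel_time s <= travel_time t by exact: travel_time_le.
have X1 : 0 < travel_time t - travel_time s + 1 by rewrite ltr_wpDl// subr_ge0.
have eta0 : 0 < e / (travel_time t - travel_time s + 1) by rewrite divr_gt0.
move: (e / (travel_time t - travel_time s + 1)) (divfK (lt0r_neq0 X1) e) eta0 => eta etaE eta0.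
have eta2 : 0 < eta / 2 by rewrite divr_gt0.
suff H : Int (fun z => 2 * W (reparam z)) (travel_time s) (travel_time t) <=
    Int (fun u => Num.sqrt 2 * (F (gam u) * sp u)) s t + eta * (travel_time t - travel_time s).
  apply: le_trans H _; rewrite lerD2l -etaE.
  by rewrite ler_wpM2l ?(ltW eta0)// lerDl.
have [d d0 hd] := heine_itv s t Wgamc eta2.
apply: (@chop _ (fun a b => Int (fun z => 2 * W (reparam z)) (travel_time a) (travel_time b) <=
    Int (fun u => Num.sqrt 2 * (F (gam u) * sp u)) a b + eta * (travel_time b - travel_time a)) s t d) => //.
  move=> a b sa ab bt bad.
  apply: potential_local => //; [exact: lt_le_trans als sa|exact: le_lt_trans bt tbe|].
  move=> u /andP[au ub]; apply: ltW; apply: hd; first by rewrite sa (le_trans ab).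
  by rewrite distrC ger0_norm ?subr_ge0//; lra.
move=> a b c sa ab bc ct H1 H2.
have ala : al < a by exact: lt_le_trans als sa.
have cbe : c < be by exact: le_lt_trans ct tbe.
have alb := lt_le_trans ala ab; have bbe := le_lt_trans bc cbe.
have E1 := @Int_cat _ (fun z => 2 * W (reparam z)) (travel_time a) (travel_time b) (travel_time c) (travel_time_le ala ab bbe) (travel_time_le alb bc cbe) (intgT_continuous _ _ W_reparam_continuous).
have E2 := @Int_cat _ (fun u => Num.sqrt 2 * (F (gam u) * sp u)) a b c ab bc (Fsp_intg ala cbe).
exact: (additive_le E1 E2 H1 H2).
Qed.

Lemma reparam_potential z1 z2 : z1 <= z2 -> Int (fun z => 2 * W (reparam z)) z1 z2 <= Num.sqrt 2 * m0.
Proof.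
move=> z12; have /andP[als sbe] := position_timeI z1; have /andP[alt tbe] := position_timeI z2.
have [st|ts] := leP (position_time z1) (position_time z2).
  by have := potential_between_travel_times als st tbe; rewrite !position_timeK.
have := travel_time_le alt (ltW ts) sbe; rewrite !position_timeK => z21.
have -> : z1 = z2 by apply/eqP; rewrite eq_le z12.
by rewrite Int_at mulr_ge0 ?sqrtr_ge0 ?m0_ge0.
Qed.

End time_change.

(** * Uniform first-order estimates for the potential *)

Section tube.
Context {R : realType} {N : nat}.
Variables (W : 'rV[R]_N -> R) (A : set 'rV[R]_N).
Hypothesis (Wc : continuous W).

Lemma derive_along (q v : 'rV[R]_N) : differentiable W q -> 'D_v W q = dot v (grad W q).
Proof.
move=> dW; rewrite deriveE// {1}[v]row_sum_delta linear_sum; apply: eq_bigr => i _.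
by rewrite linearZ /grad mxE deriveE.
Qed.

Lemma is_derive_along (p v : 'rV[R]_N) (th : R) : differentiable W (p + th *: v) ->
  is_derive th 1 (fun th : R => W (p + th *: v)) (dot v (grad W (p + th *: v))).
Proof.
move=> dW; have dv := diff_derivable (v := v) dW.
suff H : h^-1 *: (W (p + (h + th) *: v) - W (p + th *: v)) @[h --> 0^'] --> dot v (grad W (p + th *: v)).
  have [df dE] := @cvg_derive1 R R (fun th : R => W (p + th *: v)) th _ H.
  by split => //; rewrite -derive1E.
rewrite -derive_along//.
have -> : (fun h : R => h^-1 *: (W (p + (h + th) *: v) - W (p + th *: v))) =
          (fun h => h^-1 *: ((W \o shift (p + th *: v)) (h *: v) - W (p + th *: v))).
  by apply/funext => h /=; rewrite scalerDl addrCA.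
exact: dv.
Qed.

Lemma line_MVT (p v : 'rV[R]_N) :
  (forall th, 0 <= th <= 1 -> differentiable W (p + th *: v)) ->
  exists2 c, 0 <= c <= 1 & W (p + v) - W p = dot v (grad W (p + c *: v)).
Proof.
move=> H.
have dW (th : R) : th \in `[0, 1] -> is_derive th 1 (fun th : R => W (p + th *: v)) (dot v (grad W (p + th *: v))).
  by rewrite in_itv /= => thI; apply: is_derive_along; exact: H.
have dWo (th : R) : th \in `]0, 1[ -> is_derive th 1 (fun th : R => W (p + th *: v)) (dot v (grad W (p + th *: v))).
  by rewrite in_itv /= => /andP[h1 h2]; apply: dW; rewrite in_itv /= !ltW.
have lc : continuous (fun th : R => W (p + th *: v)).
  move=> th; apply: (@continuous_comp _ _ _ (fun th : R => p + th *: v) W); last exact: Wc.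
  by apply: cvgD; [exact: cvg_cst|apply: cvgZr_tmp; exact: cvg_id].
have [c cI E] := MVT_segment ler01 dWo (continuous_subspaceT lc).
exists c; first by move: cI; rewrite in_itv.
by move: E; rewrite scale1r scale0r addr0 subr0 mulr1.
Qed.

Lemma holder_small (C alpha kappa : R) : 0 < alpha -> 0 < kappa ->
  exists2 e, 0 < e & forall t, 0 <= t -> t <= e -> C * t `^ alpha <= kappa.
Proof.
move=> a0 k0; have C1 : 0 < `|C| + 1 by rewrite ltr_wpDl.
have kC : 0 < kappa / (`|C| + 1) by rewrite divr_gt0.
exists ((kappa / (`|C| + 1)) `^ alpha^-1); first exact: powR_gt0.
move=> t t0 te.
have h : t `^ alpha <= kappa / (`|C| + 1).
  have -> : kappa / (`|C| + 1) = ((kappa / (`|C| + 1)) `^ alpha^-1) `^ alpha.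
    by rewrite -powRrM mulVf ?lt0r_neq0// powRr1// ltW.
  by apply: ge0_ler_powR => //; rewrite ?nnegrE ?powR_ge0// ltW.
apply: le_trans (_ : (`|C| + 1) * t `^ alpha <= _); last by rewrite mulrC -ler_pdivlMr.
by rewrite ler_wpM2r ?powR_ge0// (le_trans (ler_norm C))// lerDl.
Qed.

Lemma enorm_delta i : enorm (delta_mx 0 i : 'rV[R]_N) = 1.
Proof.
apply/eqP; rewrite -(@eqrXn2 _ 2)// ?enorm_ge0// enorm_sqr expr1n /dot (bigD1 i)//=.
rewrite mxE !eqxx mulr1 big1 ?addr0// => j ji.
by rewrite mxE (negbTE ji) andbF mulr0.
Qed.

Lemma dot_delta i (v : 'rV[R]_N) : dot (delta_mx 0 i) v = v 0 i.
Proof.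
rewrite /dot (bigD1 i)//= mxE !eqxx mul1r big1 ?addr0// => j ji.
by rewrite mxE (negbTE ji) andbF mul0r.
Qed.

Lemma abs_dot (u v : 'rV[R]_N) : `|dot u v| <= enorm u * enorm v.
Proof.
rewrite ler_norml cauchy_schwarz andbT lerNl.
have := cauchy_schwarz (-1 *: u) v; rewrite dotZl enormZ normrN normr1 mul1r mulN1r.
exact.
Qed.

Lemma compact_tube (K : set 'rV[R]_N) (d : R) : compact K ->
  compact [set q | exists2 p, K p & enorm (q - p) <= d].
Proof.
move=> Kc; pose B := [set v : 'rV[R]_N | enorm v <= d].
have Bc : compact B.
  apply: bounded_closed_compact.
    exists d; split; first exact: num_real.
    by move=> M dM v Bv /=; apply: le_trans (norm_le_enorm v) (le_trans Bv (ltW dM)).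
  have -> : B = @enorm R N @^-1` [set t | t <= d] by [].
  apply: closed_comp; last exact: closed_le.
  by move=> v _; exact: enorm_continuous.
have -> : [set q | exists2 p, K p & enorm (q - p) <= d] = (fun xy : 'rV[R]_N * 'rV[R]_N => xy.1 + xy.2) @` (K `*` B).
  apply/seteqP; split => q /=.
    by move=> [p Kp qp]; exists (p, q - p); rewrite //= addrC subrK.
  by move=> [[p v] /= [Kp Bv] <-]; exists p => //; rewrite addrC addKr.
apply: continuous_compact; last exact: compact_setX.
apply: continuous_subspaceT => xy; exact: add_continuous.
Qed.

Variable alpha : R.
Hypotheses (al0 : 0 < alpha) (WA : C1_holder_loc alpha A W).
Hypothesis (A0 : forall q, 0 < W q -> A q).

(** A compact neighbourhood of [K] still avoids the zeros of [W], and there the gradient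
    is bounded and Hoelder continuous; the mean value theorem along segments does the
    rest. *)
Lemma C1_estimates (K : set 'rV[R]_N) : compact K -> (forall p, K p -> 0 < W p) -> 
  exists delta L : R, [/\ 0 < delta, 0 <= L,
    forall p v, K p -> enorm v <= delta -> `|W (p + v) - W p| <= L * enorm v,
    forall kappa, 0 < kappa -> exists2 e, 0 < e & forall p i s, K p -> `|s| <= e ->
      `|W (p + s *: delta_mx 0 i) - W p - s * grad W p 0 i| <= kappa * `|s| &
    forall kappa, 0 < kappa -> exists2 e, 0 < e & forall p q, K p -> K q ->
      enorm (p - q) <= e -> enorm (grad W p - grad W q) <= kappa].
Proof.
move=> Kc KW; have [WA1 WA2] := WA; have a0 := al0.
have [[p0 Kp0]|K0] := pselect (exists p, K p); last first.
  exists 1, 0; split => // [p v Kp|k k0|k k0]; first by exfalso; apply: K0; exists p.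
    by exists 1 => // p i s Kp; exfalso; apply: K0; exists p.
  by exists 1 => // p i Kp; exfalso; apply: K0; exists p.
have [pm Kpm hpm] := compact_EVT_min (ex_intro K p0 Kp0) Kc (continuous_subspaceT Wc).
have mu0 : 0 < W pm by apply: KW; move: Kpm; rewrite inE.
have [d1 d10 hd1] := heine Kc Wc mu0.
pose delta := d1 / 2; have dl0 : 0 < delta by rewrite divr_gt0.
pose T := [set q | exists2 p, K p & enorm (q - p) <= delta].
have Tc : compact T by exact: compact_tube.
have KT p v : K p -> enorm v <= delta -> T (p + v).
  by move=> Kp vd; exists p => //; rewrite addrC addKr.
have KT0 p : K p -> T p by move=> Kp; exists p => //; rewrite subrr enorm0 ltW.
have TA : T `<=` A.
  move=> q [p Kp qp]; apply: A0; have hp : W pm <= W p by apply: hpm; rewrite inE.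
  have : `|W p - W q| < W pm.
    apply: hd1 => //; rewrite -ball_normE /=; apply: le_lt_trans (norm_le_enorm _) _.
    by rewrite enormC; apply: le_lt_trans qp _; rewrite /delta; lra.
  by rewrite ltr_norml => /andP[? ?]; lra.
have [C hC] := WA2 T Tc TA.
have [qm _ hqm] := compact_EVT_max (ex_intro T p0 (KT0 _ Kp0)) Tc (continuous_subspaceT (@enorm_continuous R N)).
pose D := enorm qm + enorm p0; pose L := enorm (grad W p0) + `|C| * D `^ alpha.
have gL q : T q -> enorm (grad W q) <= L.
  move=> Tq; have h1 := enormD (grad W q - grad W p0) (grad W p0); rewrite subrK in h1.
  apply: le_trans h1 _; rewrite addrC lerD2l; apply: le_trans (hC q p0 Tq (KT0 _ Kp0)) _.
  apply: le_trans (ler_norm _) _; rewrite normrM ler_wpM2l// ger0_norm ?powR_ge0//.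
  apply: ge0_ler_powR; rewrite ?nnegrE ?addr_ge0 ?enorm_ge0// ?(ltW a0)//.
  apply: le_trans (enormD _ _) _; rewrite enormN lerD2r.
  by apply: hqm; rewrite inE.
have L0 : 0 <= L by rewrite addr_ge0 ?enorm_ge0// mulr_ge0// powR_ge0.
have scale_le (c : R) (v : 'rV[R]_N) : 0 <= c <= 1 -> enorm (c *: v) <= enorm v.
  by move=> /andP[c0 c1]; rewrite enormZ ger0_norm// ler_piMl// enorm_ge0.
have mvt p v : K p -> enorm v <= delta -> exists2 c, 0 <= c <= 1 & W (p + v) - W p = dot v (grad W (p + c *: v)).
  move=> Kp vd; apply: line_MVT => th thI; apply/WA1/TA/KT => //.
  exact: le_trans (scale_le _ _ thI) vd.
exists delta, L; split => //.
- move=> p v Kp vd; have [c cI ->] := mvt p v Kp vd.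
  apply: le_trans (abs_dot _ _) _; rewrite mulrC ler_wpM2r ?enorm_ge0// gL//.
  by apply: KT => //; exact: le_trans (scale_le _ _ cI) vd.
- move=> k k0; have [e e0 he] := holder_small C a0 k0.
  exists (Num.min e delta); first by rewrite lt_min e0.
  move=> p i s Kp; rewrite le_min => /andP[se sd].
  have ev : enorm (s *: delta_mx 0 i : 'rV[R]_N) = `|s| by rewrite enormZ enorm_delta mulr1.
  have vd : enorm (s *: delta_mx 0 i : 'rV[R]_N) <= delta by rewrite ev.
  have [c cI ->] := mvt p _ Kp vd; set q := p + _.
  rewrite dotZl dot_delta -mulrBr normrM mulrC ler_wpM2r//.
  have -> : grad W q 0 i - grad W p 0 i = (grad W q - grad W p) 0 i by rewrite !mxE.
  apply: le_trans (coord_le_enorm _ _) _.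
  have Tq : T q by apply: KT => //; exact: le_trans (scale_le _ _ cI) vd.
  apply: le_trans (hC q p Tq (KT0 _ Kp)) _; apply: he; first exact: enorm_ge0.
  by rewrite /q addrC addKr; apply: le_trans (scale_le _ _ cI) _; rewrite ev.
- move=> k k0; have [e e0 he] := holder_small C a0 k0.
  exists e => // p q Kp Kq pq; apply: le_trans (hC p q (KT0 _ Kp) (KT0 _ Kq)) _.
  by apply: he => //; exact: enorm_ge0.
Qed.

End tube.

(** * Comparison with translated paths *)

Section local_minimality.
Context {R : realType} {N : nat}.
Notation mu := (@lebesgue_measure R).
Variables (W : 'rV[R]_N -> R) (a b : 'rV[R]_N) (U : R -> 'rV[R]_N) (m0 : R).
Hypotheses (Wc : continuous W) (W0 : forall q, 0 <= W q) (Wa : W a = 0) (Wb : W b = 0).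
Let F q := Num.sqrt (W q).
Let r q := Num.sqrt (2 * W q).
Hypotheses (Uc : continuous U)
  (Ulip : forall x y M, x <= y -> (forall z, x <= z <= y -> r (U z) <= M) ->
     enorm (U y - U x) <= M * (y - x))
  (Upot : forall x y, x <= y -> Int (fun z => 2 * W (U z)) x y <= Num.sqrt 2 * m0)
  (Ua : U z @[z --> -oo] --> a) (Ub : U z @[z --> +oo] --> b)
  (m0_min : forall c, chain F a b c -> m0 <= c).

Let s2 : R := Num.sqrt 2.
Let s2_gt0 : 0 < s2. Proof. by rewrite sqrtr_gt0. Qed.
Let s2s2 : s2 * s2 = 2. Proof. by rewrite -expr2 sqr_sqrtr. Qed.

Lemma rUc : continuous (fun z => r (U z)).
Proof. by move=> z; apply: (@continuous_comp _ _ _ U r); [exact: Uc|exact: sqrt2W_continuous]. Qed.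

Lemma U_upper_gradient x y : x <= y -> enorm (U y - U x) <= Int (fun z => r (U z)) x y.
Proof.
move=> xy; apply/ler_addgt0Pr => e e0.
have X1 : 0 < y - x + 1 by rewrite ltr_wpDl// subr_ge0.
have eta0 : 0 < e / (y - x + 1) by rewrite divr_gt0.
move: (e / (y - x + 1)) (divfK (lt0r_neq0 X1) e) eta0 => eta etaE eta0.
have eta2 : 0 < eta / 2 by rewrite divr_gt0.
have ri s t : intg (fun z => r (U z)) s t by apply: intgT_continuous; exact: rUc.
suff H : enorm (U y - U x) <= Int (fun z => r (U z)) x y + eta * (y - x).
  apply: le_trans H _; rewrite lerD2l -etaE.
  by rewrite ler_wpM2l ?(ltW eta0)// lerDl.
have [d d0 hd] := heine_itv x y rUc eta2.
apply: (@chop _ (fun s t => enorm (U t - U s) <= Int (fun z => r (U z)) s t + eta * (t - s)) x y d) => //.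
  move=> s t xs st ty tsd.
  have close z : s <= z <= t -> `|r (U s) - r (U z)| < eta / 2.
    move=> /andP[sz zt]; apply: hd; first by rewrite xs (le_trans st).
    by rewrite distrC ger0_norm ?subr_ge0//; lra.
  apply: (@le_trans _ _ ((r (U s) + eta / 2) * (t - s))).
    by apply: Ulip => // z /close; rewrite ltr_norml => /andP[? ?]; lra.
  rewrite -lerBlDr -mulrBl; apply: Int_ge_cst => // z /close.
  by rewrite ltr_norml => /andP[? ?]; lra.
move=> s t u xs st tu uy H1 H2.
have E := @Int_cat _ (fun z => r (U z)) s t u st tu (ri s u).
have H := enormB_le (U u) (U t) (U s).
apply: le_trans H _; rewrite E.
move: (lerD H2 H1); move: (Int _ _ _) (Int _ _ _) => i1 i2 H12.
apply: le_trans H12 _; rewrite le_eqVlt; apply/orP; left; apply/eqP; ring.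
Qed.

(** By the arithmetic-geometric mean inequality
    sqrt (W (U + v)) * sqrt (2 W (U)) <= (W (U + v) + W (U)) / sqrt 2. *)
Lemma reach_shift v x y : x <= y ->
  reach F (U x + v) (U y + v) (s2^-1 * Int (fun z => W (U z + v) + W (U z)) x y).
Proof.
move=> xy; have Vc : continuous (fun z => U z + v).
  by move=> z; apply: cvgD; [exact: Uc|exact: cvg_cst].
have ri : intg (fun z => r (U z)) x y by apply: intgT_continuous; exact: rUc.
have WVc : continuous (fun z => W (U z + v)).
  by move=> z; apply: (@continuous_comp _ _ _ (fun z => U z + v) W); [exact: Vc|exact: Wc].
have WUc : continuous (fun z => W (U z)).
  by move=> z; apply: (@continuous_comp _ _ _ U W); [exact: Uc|exact: Wc].
have hr := @reach_curve _ _ F (fun z => U z + v) (fun z => r (U z)) x y xy (sqrtW_continuous Wc)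
  (sqrtW_ge0 W) Vc ri (fun t => sqrtr_ge0 _).
apply: reach_le (hr _); last first.
  move=> s t xs st ty; rewrite opprD addrACA subrr addr0; exact: U_upper_gradient.
have Si : intg (fun z => W (U z + v) + W (U z)) x y by apply: intgD; apply: intgT_continuous.
rewrite -IntZ//; apply: Int_le.
- apply: intgM_continuous => // z.
  by apply: (@continuous_comp _ _ _ (fun z => U z + v) F); [exact: Vc|exact: (sqrtW_continuous Wc)].
- exact: intgZ.
move=> z _; rewrite [leRHS]mulrC ler_pdivlMr//.
have -> : r (U z) = s2 * F (U z) by rewrite /r sqrtrM.
have -> : W (U z + v) = F (U z + v) ^+ 2 by rewrite sqr_sqrtr.
have -> : W (U z) = F (U z) ^+ 2 by rewrite sqr_sqrtr.
move: (F (U z + v)) (F (U z)) => p q.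
have -> : p * (s2 * q) * s2 = s2 * s2 * (p * q) by ring.
by rewrite s2s2; have := sqr_ge0 (p - q); rewrite !expr2; nra.
Qed.

Lemma reach_U x y : x <= y -> reach F (U x) (U y) (s2^-1 * Int (fun z => 2 * W (U z)) x y).
Proof.
move=> xy; have := reach_shift 0 xy; rewrite !addr0.
rewrite (@eq_Int _ _ (fun z => 2 * W (U z)))// => z _.
by rewrite addr0; ring.
Qed.

(** Up to the factor sqrt 2, the bound is the action of the segment run through in time
    [h]; Young's inequality compares it with the weighted length. *)
Lemma reach_fast_segment p q h M : 0 < h ->
  (forall th, 0 <= th <= 1 -> W (p + th *: (q - p)) <= M) ->
  reach F p q (s2^-1 * (enorm (q - p) ^+ 2 / (2 * h) + h * M)).
Proof.
move=> h0 HM; apply: (@reach_seg _ _ F p q (Num.sqrt M)).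
  by move=> th thI; rewrite ler_wsqrtr// HM.
have M0 : 0 <= M by apply: le_trans (HM 0 _); rewrite ?lexx ?ler01.
rewrite mulrC [leRHS]mulrC ler_pdivlMr//.
have ME : M = Num.sqrt M ^+ 2 by rewrite sqr_sqrtr.
rewrite {2}ME; move: (Num.sqrt M) (enorm _) => k e.
have h20 : 0 < 2 * h by rewrite mulr_gt0.
rewrite -(ler_pM2r h20) [leRHS]mulrDl; have -> : e ^+ 2 / (2 * h) * (2 * h) = e ^+ 2 by field; rewrite gt_eqF.
have -> : h * k ^+ 2 * (2 * h) = (s2 * s2) * (h * k) ^+ 2 by rewrite s2s2; ring.
have -> : e * k * s2 * (2 * h) = 2 * (e * (s2 * (h * k))) by ring.
have -> : s2 * s2 * (h * k) ^+ 2 = (s2 * (h * k)) ^+ 2 by ring.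
by move: (s2 * (h * k)) => u; have := sqr_ge0 (e - u); rewrite !expr2; nra.
Qed.

Lemma reach_near_zero p e : W p = 0 -> 0 < e ->
  exists2 d, 0 < d & forall q, enorm (q - p) < d -> reach F p q e /\ reach F q p e.
Proof.
move=> Wp e0.
have FF := nbhs_filter p.
have := (sqrtW_continuous Wc) p => /cvgrPdist_lt /(_ 1 ltr01); rewrite /= nearE /= -nbhs_ballE => -[d /= d0 hd].
have Fp : Num.sqrt (W p) = 0 by rewrite Wp sqrtr0.
have hF v : enorm (v - p) < d -> F v <= 1.
  move=> vp; have : ball p d v.
    by rewrite -ball_normE /= -normrN opprB; apply: le_lt_trans (norm_le_enorm _) vp.
  by move=> /hd; rewrite Fp sub0r normrN ger0_norm ?sqrtr_ge0// => /ltW.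
exists (Num.min d e); first by rewrite lt_min d0.
move=> q; rewrite lt_min => /andP[qd qe]; split.
  apply: (@reach_seg _ _ F p q 1); last by rewrite mul1r ltW.
  by move=> th thI; apply: hF; apply: le_lt_trans (norm_segment _ _ thI) qd.
apply: (@reach_seg _ _ F q p 1); last by rewrite mul1r enormC ltW.
move=> th /andP[t0 t1]; apply: hF; apply: le_lt_trans qd.
have -> : q + th *: (p - q) - p = (1 - th) *: (q - p).
  by rewrite scalerBl scale1r -(opprB q p) scalerN addrAC.
rewrite enormZ ger0_norm ?subr_ge0// ler_piMl ?enorm_ge0//; lra.
Qed.

(** Close to a well the weight is small, and so is the length that remains. *)
Lemma reach_tail e : 0 < e -> exists2 T0, 0 <= T0 & forall T, T0 <= T ->
  reach F a (U (- T)) e /\ reach F (U T) b e.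
Proof.
move=> e0; have [da da0 ha] := reach_near_zero Wa e0; have [db db0 hb] := reach_near_zero Wb e0.
have /cvg_enormP /(_ da da0) [A [_ HA]] := Ua.
have /cvg_enormP /(_ db db0) [B [_ HB]] := Ub.
exists (`|A| + `|B| + 1); first by rewrite !addr_ge0.
move=> T hT; have hA := ler_norm (- A); have hB := ler_norm B; rewrite normrN in hA.
have hA0 := normr_ge0 A; have hB0 := normr_ge0 B.
split.
  by apply: (ha _ _).1; apply: HA; lra.
by apply: (hb _ _).2; apply: HB; lra.
Qed.

Lemma m0_reach c : reach F a b c -> m0 <= c.
Proof. by move=> hc; apply/ler_addgt0Pr => e e0; have [c' c'c /m0_min h] := hc e e0; exact: le_trans h c'c. Qed.

(** A cheaper path from [U x] to [U y], extended along [U] and by short segments to the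
    wells, would join the wells at a cost below [m0]. *)
Lemma local_minimality x y c : x <= y -> reach F (U x) (U y) c ->
  Int (fun z => 2 * W (U z)) x y <= s2 * c.
Proof.
move=> xy hc; apply/ler_addgt0Pr => e e0.
have e1 : 0 < e / (2 * s2) by rewrite divr_gt0// mulr_gt0.
have [T0 T00 hT] := reach_tail e1.
pose T := T0 + `|x| + `|y|.
have T0T : T0 <= T by rewrite /T -addrA lerDl addr_ge0.
have [ra rb] := hT T T0T.
have Tx : - T <= x by have := ler_norm (- x); rewrite normrN /T; have := normr_ge0 y; lra.
have yT : y <= T by have := ler_norm y; rewrite /T; have := normr_ge0 x; lra.
have := m0_reach (reach_trans ra (reach_trans (reach_U Tx) (reach_trans hc (reach_trans (reach_U yT) rb)))).
have WU_intg s t : intg (fun z => 2 * W (U z)) s t.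
  apply: intgT_continuous => z; apply: cvgM; first exact: cvg_cst.
  by apply: (@continuous_comp _ _ _ U W); [exact: Uc|exact: Wc].
have := Upot (le_trans Tx (le_trans xy yT)).
rewrite (Int_cat Tx (le_trans xy yT) (WU_intg _ _)) (Int_cat xy yT (WU_intg _ _)) -/s2.
move: (Int _ (- T) x) (Int _ x y) (Int _ y T) => i1 i2 i3 h1 h2.
have h3 : s2 * m0 <= s2 * (e / (2 * s2) + (s2^-1 * i1 + (c + (s2^-1 * i3 + e / (2 * s2))))).
  by rewrite ler_pM2l.
have h4 : s2 * (e / (2 * s2) + (s2^-1 * i1 + (c + (s2^-1 * i3 + e / (2 * s2))))) = e + i1 + s2 * c + i3.
  by field; rewrite gt_eqF.
lra.
Qed.

(** The competitor leaves [U] at time [x], reaches the translate [U + v] within time [h],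
    follows it up to time [y] and returns to [U] within another [h]. *)
Lemma competitor_inequality x y h v M1 M2 : 0 < h -> x + h <= y ->
  (forall th, 0 <= th <= 1 -> W (U x + th *: (U (x + h) + v - U x)) <= M1) ->
  (forall th, 0 <= th <= 1 -> W (U y + v + th *: (U (y + h) - (U y + v))) <= M2) ->
  Int (fun z => 2 * W (U z)) x (y + h) <=
    enorm (U (x + h) + v - U x) ^+ 2 / (2 * h) + h * M1
    + Int (fun z => W (U z + v) + W (U z)) (x + h) y
    + (enorm (U (y + h) - (U y + v)) ^+ 2 / (2 * h) + h * M2).
Proof.
move=> h0 xhy HM1 HM2.
have r1 := reach_fast_segment h0 HM1; have r3 := reach_fast_segment h0 HM2.
have r2 := reach_shift v xhy.
have xy : x <= y + h by lra.
have := local_minimality xy (reach_trans (reach_trans r1 r2) r3).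
move=> H; apply: le_trans H _; rewrite -!mulrDr mulrA divff ?gt_eqF// mul1r.
by rewrite le_eqVlt eqxx.
Qed.

End local_minimality.

(** * The discrete Euler-Lagrange equation *)

Lemma enorm_add_delta (R : realType) (N : nat) (D : 'rV[R]_N) (eps : R) (i : 'I_N) :
  enorm (D + eps *: delta_mx 0 i) ^+ 2 = enorm D ^+ 2 + 2 * (eps * D 0 i) + eps ^+ 2.
Proof.
rewrite !enorm_sqr !(dotDl, dotDr, dotZl, dotZr) (dotC D) !dot_delta mxE !eqxx /=; ring.
Qed.

(** The terms without [eps] cancel up to errors; those linear in [eps] are isolated on the
    left. *)
Lemma core_algebra (R : realType) (h L q e eps wx wy dx dy a1 a2 T T1 T2 T3 T23 J G G1 G2
    kp bnd B : R) :
  T <= a1 + h * (wx + L * (q + e)) + J + (a2 + h * (wy + L * (q + e))) ->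
  a1 <= h * (wx + L * q) + eps * dx / h + eps ^+ 2 / (2 * h) ->
  a2 <= h * (wy + L * q) + (- eps) * dy / h + eps ^+ 2 / (2 * h) ->
  (2 * (wx - L * q)) * h <= T1 -> (2 * (wy - L * q)) * h <= T3 ->
  J <= T2 + (eps * G2 + kp * e * bnd) ->
  T = T1 + T23 -> T23 = T2 + T3 -> G = G1 + G2 ->
  - (eps * G1) <= e * (B * h) -> forall n2, kp * e * bnd <= kp * e * n2 ->
  - (eps * (G + (dx / h - dy / h))) <=
    8 * (L * q) * h + 2 * (L * e) * h + eps ^+ 2 / h + e * (kp * n2 + B * h).
Proof.
rewrite !invfM.
move: (h^-1) => hi C K1 K2 I1 I3 Jm E1 E2 E3 epsG n2 lenn; rewrite E3.
have e2 : eps ^+ 2 * (2^-1 * hi) + eps ^+ 2 * (2^-1 * hi) = eps ^+ 2 * hi by field.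
lra.
Qed.

Lemma window_shift (R : realType) (n h z u : R) : `|z| <= n -> `|z + h| <= n ->
  z <= u <= z + h -> `|z + (u - z)| <= n /\ 0 <= u - z <= h.
Proof.
rewrite !ler_norml => /andP[? ?] /andP[? ?] /andP[? ?].
by split; apply/andP; split; lra.
Qed.

Lemma window_length (R : realType) (n x y h : R) : - n <= x + h -> y <= n ->
  y - (x + h) <= 2 * n.
Proof. by lra. Qed.

Lemma taylor_upper (R : realType) (w1 w0 gz b : R) : `|w1 - w0 - gz| <= b ->
  w1 + w0 <= 2 * w0 + (gz + b).
Proof. by rewrite ler_norml => /andP[_ ?]; lra. Qed.

Section euler_lagrange.
Context {R : realType} {N : nat}.
Notation mu := (@lebesgue_measure R).
Variables (W : 'rV[R]_N -> R) (U : R -> 'rV[R]_N).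
Hypotheses (Wc : continuous W) (W0 : forall q, 0 <= W q).
Let r q := Num.sqrt (2 * W q).
Hypotheses (Uc : continuous U)
  (Ulip : forall x y M, x <= y -> (forall z, x <= z <= y -> r (U z) <= M) ->
     enorm (U y - U x) <= M * (y - x))
  (comp : forall x y h v M1 M2, 0 < h -> x + h <= y ->
    (forall th, 0 <= th <= 1 -> W (U x + th *: (U (x + h) + v - U x)) <= M1) ->
    (forall th, 0 <= th <= 1 -> W (U y + v + th *: (U (y + h) - (U y + v))) <= M2) ->
    Int (fun z => 2 * W (U z)) x (y + h) <=
    enorm (U (x + h) + v - U x) ^+ 2 / (2 * h) + h * M1
    + Int (fun z => W (U z + v) + W (U z)) (x + h) y
    + (enorm (U (y + h) - (U y + v)) ^+ 2 / (2 * h) + h * M2)).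

Lemma WU_intg x y : intg (fun z => W (U z)) x y.
Proof.
apply: intgT_continuous => z.
by apply: (@continuous_comp _ _ _ U W); [exact: Uc|exact: Wc].
Qed.

Lemma WU_shift_intg v x y : intg (fun z => W (U z + v)) x y.
Proof.
apply: intgT_continuous => z.
apply: (@continuous_comp _ _ _ (fun z => U z + v) W); last exact: Wc.
by apply: cvgD; [exact: Uc|exact: cvg_cst].
Qed.

Lemma kinetic_bound (h w k L eps ei vv : R) : 0 < h ->
  k ^+ 2 <= h ^+ 2 * (2 * (w + L)) -> vv = k ^+ 2 + 2 * (eps * ei) + eps ^+ 2 ->
  vv / (2 * h) <= h * (w + L) + eps * ei / h + eps ^+ 2 / (2 * h).
Proof.
move=> h0 kL ->; rewrite ler_pdivrMr ?mulr_gt0//.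
have -> : (h * (w + L) + eps * ei / h + eps ^+ 2 / (2 * h)) * (2 * h) =
  h ^+ 2 * (2 * (w + L)) + 2 * (eps * ei) + eps ^+ 2 by field; rewrite gt_eqF.
lra.
Qed.

Section core.
Variables (n k L delta Bg kap epsk : R) (i : 'I_N).
Hypotheses (k0 : 0 <= k) (L0 : 0 <= L)
  (kU : forall x y, `|x| <= n -> `|y| <= n -> enorm (U x - U y) <= k * `|x - y|)
  (WL : forall z v, `|z| <= n -> enorm v <= delta -> `|W (U z + v) - W (U z)| <= L * enorm v)
  (gc : intg (fun z => grad W (U z) 0 i) (- n) n)
  (gB : forall z, `|z| <= n -> `|grad W (U z) 0 i| <= Bg)
  (Wk : forall z s, `|z| <= n -> `|s| <= epsk ->
     `|W (U z + s *: delta_mx 0 i) - W (U z) - s * grad W (U z) 0 i| <= kap * `|s|).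

(** First variation with a finite time step, for a translation by [eps] in direction [i].
    The two connecting segments contribute the difference quotients of [U] at [x] and
    [y], the translated piece contributes the integral of the partial derivative of
    [W], and everything else is an error. *)
Lemma EL_core x y h eps : 0 < h -> - n <= x -> x + h <= y -> y + h <= n ->
  k * h + `|eps| <= delta -> `|eps| <= epsk -> 0 <= kap -> 0 <= Bg ->
  - (eps * (Int (fun z => grad W (U z) 0 i) x y
     + ((U (x + h) - U x) 0 i / h - (U (y + h) - U y) 0 i / h)))
  <= 8 * (L * (k * h)) * h + 2 * (L * `|eps|) * h + eps ^+ 2 / h
     + `|eps| * (kap * (2 * n) + Bg * h).
Proof.
move=> h0 nx xhy yhn hd hk kap0 Bg0.
pose v : 'rV[R]_N := eps *: delta_mx 0 i.
have ev : enorm v = `|eps| by rewrite enormZ enorm_delta mulr1.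
have kh0 : 0 <= k * h by rewrite mulr_ge0// ltW.
have khd : k * h <= delta by have := normr_ge0 eps; lra.
have inn z : x <= z <= y + h -> `|z| <= n by move=> /andP[? ?]; rewrite ler_norml; apply/andP; split; lra.
have incr z t : `|z| <= n -> `|z + t| <= n -> 0 <= t <= h -> enorm (U (z + t) - U z) <= k * h.
  move=> zn ztn /andP[t0 th]; apply: le_trans (kU ztn zn) _.
  by rewrite addrAC subrr add0r (ger0_norm t0) ler_wpM2l.
have wlow z t : `|z| <= n -> `|z + t| <= n -> 0 <= t <= h ->
    `|W (U (z + t)) - W (U z)| <= L * (k * h).
  move=> zn ztn tI; have hi := incr z t zn ztn tI.
  have := @WL z (U (z + t) - U z) zn (le_trans hi khd).
  by rewrite (addrC (U z)) subrK => h1; apply: le_trans h1 _; rewrite ler_wpM2l.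
have step z : z <= z + h by rewrite lerDl ltW.
have window z u : `|z| <= n -> `|z + h| <= n -> z <= u <= z + h ->
    `|W (U u) - W (U z)| <= L * (k * h).
  move=> zn zhn uI; have [un tI] := window_shift zn zhn uI.
  by have := wlow z (u - z) zn un tI; rewrite (addrC z) subrK.
have nxh : - n <= x + h := le_trans nx (step x).
have ynn : y <= n := le_trans (step y) yhn.
have ylen : y - (x + h) <= 2 * n := window_length nxh ynn.
have xn : `|x| <= n by apply: inn; apply/andP; split; lra.
have xhn : `|x + h| <= n by apply: inn; apply/andP; split; lra.
have yn : `|y| <= n by apply: inn; apply/andP; split; lra.
have yhn' : `|y + h| <= n by apply: inn; apply/andP; split; lra.
have hI : 0 <= h <= h by rewrite lexx ltW.
have M1P th : 0 <= th <= 1 -> W (U x + th *: (U (x + h) + v - U x)) <= W (U x) + L * (k * h + `|eps|).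
  move=> /andP[t0 t1]; set w := th *: _.
  have we : enorm w <= k * h + `|eps|.
    rewrite enormZ ger0_norm//; apply: le_trans (_ : enorm (U (x + h) + v - U x) <= _).
      by rewrite ler_piMl// enorm_ge0.
    by rewrite addrAC; apply: le_trans (enormD _ _) _; rewrite ev lerD2r incr.
  have := @WL x w xn (le_trans we hd); rewrite ler_norml => /andP[_ h1].
  have : L * enorm w <= L * (k * h + `|eps|) by rewrite ler_wpM2l.
  lra.
have M2P th : 0 <= th <= 1 -> W (U y + v + th *: (U (y + h) - (U y + v))) <= W (U y) + L * (k * h + `|eps|).
  move=> /andP[t0 t1].
  have -> : U y + v + th *: (U (y + h) - (U y + v)) = U y + ((1 - th) *: v + th *: (U (y + h) - U y)).
    by apply/rowP => j; rewrite !mxE; ring.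
  set w := _ + th *: _.
  have we : enorm w <= k * h + `|eps|.
    apply: le_trans (enormD _ _) _; rewrite addrC !enormZ lerD//.
      rewrite ger0_norm//; apply: le_trans (incr y h yn yhn' hI).
      by rewrite ler_piMl// enorm_ge0.
    by rewrite ger0_norm ?subr_ge0// enorm_delta mulr1 ler_piMl//; lra.
  have := @WL y w yn (le_trans we hd); rewrite ler_norml => /andP[_ h1].
  have : L * enorm w <= L * (k * h + `|eps|) by rewrite ler_wpM2l.
  lra.
have C := comp h0 xhy M1P M2P.
have sq z : `|z| <= n -> `|z + h| <= n -> enorm (U (z + h) - U z) ^+ 2 <= h ^+ 2 * (2 * (W (U z) + L * (k * h))).
  move=> zn zhn.
  have w0 : 0 <= 2 * (W (U z) + L * (k * h)) by rewrite mulr_ge0// addr_ge0// mulr_ge0.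
  rewrite -[X in _ * X]sqr_sqrtr// -exprMn ler_pXn2r ?nnegrE ?enorm_ge0 ?mulr_ge0 ?sqrtr_ge0 ?(ltW h0)//.
  rewrite mulrC; have := @Ulip z (z + h) (Num.sqrt (2 * (W (U z) + L * (k * h)))) (step z).
  rewrite addrAC subrr add0r; apply => u uI; rewrite ler_wsqrtr// ler_wpM2l//.
  by have := window z u zn zhn uI; rewrite ler_norml => /andP[_]; rewrite lerBlDl.
have K1 : enorm (U (x + h) + v - U x) ^+ 2 / (2 * h) <=
    h * (W (U x) + L * (k * h)) + eps * (U (x + h) - U x) 0 i / h + eps ^+ 2 / (2 * h).
  apply: (kinetic_bound h0 (sq x xn xhn)).
  by rewrite addrAC /v enorm_add_delta.
have K2 : enorm (U (y + h) - (U y + v)) ^+ 2 / (2 * h) <=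
    h * (W (U y) + L * (k * h)) + (- eps) * (U (y + h) - U y) 0 i / h + (- eps) ^+ 2 / (2 * h).
  apply: (kinetic_bound h0 (sq y yn yhn')).
  have -> : U (y + h) - (U y + v) = (U (y + h) - U y) + (- eps) *: delta_mx 0 i by rewrite opprD addrA scaleNr.
  by rewrite enorm_add_delta.
have W2i s t : intg (fun z => 2 * W (U z)) s t by apply: intgZ; exact: WU_intg.
have lowint z : `|z| <= n -> `|z + h| <= n -> (2 * (W (U z) - L * (k * h))) * h <= Int (fun z => 2 * W (U z)) z (z + h).
  move=> zn zhn; have E : z + h - z = h by rewrite addrAC subrr add0r.
  rewrite -[X in _ * X <= _]E; apply: Int_ge_cst => // u uI.
  rewrite ler_wpM2l//; have := window z u zn zhn uI.
  by rewrite ler_norml => /andP[+ _]; rewrite lerBrDl.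
have I1 := lowint x xn xhn; have I3 := lowint y yn yhn'.
have gi s t : - n <= s -> t <= n -> intg (fun z => grad W (U z) 0 i) s t.
  by move=> s0 t0; apply: intgS gc.
have Jm : Int (fun z => W (U z + v) + W (U z)) (x + h) y <=
   Int (fun z => 2 * W (U z)) (x + h) y + (eps * Int (fun z => grad W (U z) 0 i) (x + h) y + kap * `|eps| * (y - (x + h))).
  have gi' := gi _ _ nxh ynn.
  rewrite -IntZ// -(Int_cst (kap * `|eps|) xhy) -IntD; [|by apply: intgZ|exact: intg_cst].
  rewrite -[leRHS]IntD//; last by apply: intgD; [apply: intgZ|exact: intg_cst].
  apply: Int_le.
  - by apply: intgD; [exact: WU_shift_intg|exact: WU_intg].
  - by apply: intgD => //; apply: intgD; [apply: intgZ|exact: intg_cst].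
  move=> z /andP[z1 z2].
  have zn : `|z| <= n by apply: inn; rewrite (le_trans (step x) z1) (le_trans z2 (step y)).
  exact: (taylor_upper (Wk zn hk)).
have G0 : `|Int (fun z => grad W (U z) 0 i) x (x + h)| <= Bg * h.
  have gi' := gi _ _ nx (le_trans xhy ynn).
  apply: le_trans (Int_norm gi') _.
  have E : x + h - x = h by rewrite addrAC subrr add0r.
  rewrite -[X in _ <= _ * X]E; apply: Int_le_cst; [exact: step|exact: intg_norm|].
  move=> z /andP[z1 z2]; apply: gB; apply: inn; rewrite z1.
  exact: le_trans (le_trans z2 xhy) (step y).
have Isplit := Int_cat (step x) (le_trans xhy (step y)) (W2i x (y + h)).
have Isplit2 := Int_cat xhy (step y) (W2i (x + h) (y + h)).
have Gsplit := Int_cat (step x) xhy (gi x y nx ynn).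
have epsG : - (eps * Int (fun z => grad W (U z) 0 i) x (x + h)) <= `|eps| * (Bg * h).
  by apply: le_trans (ler_norm _) _; rewrite normrN normrM ler_wpM2l.
have lenn : kap * `|eps| * (y - (x + h)) <= kap * `|eps| * (2 * n).
  by rewrite ler_wpM2l ?mulr_ge0.
rewrite sqrrN in K2.
exact: (core_algebra C K1 K2 I1 I3 Jm Isplit Isplit2 Gsplit epsG lenn).
Qed.
End core.
End euler_lagrange.

(** * From difference quotients to derivatives *)

(** For h = eta^2 and |eps| = eta^3 every error is small compared with [eps], and both
    signs of [eps] are allowed. *)
Lemma core_scaling (R : realType) (L k eta D kp n2 B kappa X : R) :
  0 < eta -> eta <= 1 -> 0 <= L -> 0 <= k -> 0 <= B ->
  eta * (8 * (L * k) + 2 * L + 1 + B) <= D -> kp * n2 + D <= kappa ->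
  (forall eps, `|eps| = eta ^+ 3 -> - (eps * X) <=
     8 * (L * (k * eta ^+ 2)) * eta ^+ 2 + 2 * (L * `|eps|) * eta ^+ 2 + eps ^+ 2 / eta ^+ 2
       + `|eps| * (kp * n2 + B * eta ^+ 2)) ->
  `|X| <= kappa.
Proof.
move=> e0 e1 L0 k0 B0 hD hk H.
have e30 : 0 < eta ^+ 3 by rewrite exprn_gt0.
have rhs eps : `|eps| = eta ^+ 3 -> - (eps * X) <= eta ^+ 3 * kappa.
  move=> ee; apply: le_trans (H eps ee) _; rewrite ee.
  have -> : eps ^+ 2 = eta ^+ 3 * eta ^+ 3 by rewrite -[LHS]real_normK ?num_real// ee expr2.
  have -> : 8 * (L * (k * eta ^+ 2)) * eta ^+ 2 + 2 * (L * eta ^+ 3) * eta ^+ 2 +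
     eta ^+ 3 * eta ^+ 3 / eta ^+ 2 + eta ^+ 3 * (kp * n2 + B * eta ^+ 2) =
     eta ^+ 3 * (eta * (8 * (L * k)) + eta * (eta * (2 * L)) + eta + eta * (eta * B) + kp * n2).
    by field; rewrite gt_eqF.
  rewrite ler_pM2l//.
  have h1 : eta * (eta * (2 * L)) <= eta * (2 * L).
    by rewrite ler_wpM2l ?(ltW e0)// ler_piMl// mulr_ge0.
  have h2 : eta * (eta * B) <= eta * B by rewrite ler_wpM2l ?(ltW e0)// ler_piMl.
  lra.
rewrite ler_norml; apply/andP; split.
  have := rhs (eta ^+ 3); rewrite gtr0_norm// => /(_ erefl).
  by rewrite -mulrN ler_pM2l// lerNl.
have := rhs (- eta ^+ 3); rewrite normrN gtr0_norm// => /(_ erefl).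
by rewrite mulNr opprK ler_pM2l.
Qed.

Section primitive.
Context {R : realType}.
Notation mu := (@lebesgue_measure R).
Variables (g : R -> R) (y0 : R).
Hypothesis gc : continuous g.

Let gi x y : intg g x y. Proof. exact: intgT_continuous. Qed.

Definition prim x := if y0 <= x then Int g y0 x else - Int g x y0.

Lemma primE c x : c <= x -> c <= y0 -> prim x = Int g c x - Int g c y0.
Proof.
move=> cx cy; rewrite /prim; have [yx|/ltW xy] := leP y0 x.
  by rewrite (Int_cat cy yx (gi _ _)) addrAC subrr add0r.
by rewrite (Int_cat cx xy (gi _ _)) opprD addNKr.
Qed.

Lemma prim_derive (x : R) : is_derive x 1 prim (g x).
Proof.
pose c := Num.min x y0 - 1.
have cx : c < x by rewrite /c ltrBlDr gt_min ltrDl ltr01.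
have cy : c <= y0 by rewrite /c lerBlDr ge_min lerDl ler01 orbT.
have xx : x < x + 1 by rewrite ltrDl.
have gx : {for x, continuous g} by exact: gc.
have [d dE] := continuous_FTC1_closed xx (gi c (x + 1)) cx gx.
have dI : is_derive x 1 (fun y => Int g c y) (g x) by split; [exact: d|rewrite -derive1E].
have dd : is_derive x 1 ((fun y => Int g c y) - cst (Int g c y0)) (g x).
  have := is_deriveB dI (is_derive_cst (Int g c y0) x 1); rewrite subr0; exact.
apply: near_eq_is_derive dd; near=> y.
have yc : c < y by near: y; exact: lt_nbhsr.
by rewrite (primE (ltW yc) cy).
Unshelve. all: by end_near. Qed.

End primitive.

Lemma margins (R : realType) (n h a b : R) : 0 < h -> h < 1 -> h < (b - a) / 2 ->
  - n + 1 <= a -> b <= n - 1 ->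
  [/\ - n <= a, - n <= a - h, a + h <= b, a + h <= b - h & b + h <= n].
Proof. by move=> *; split; lra. Qed.

Section quotients.
Context {R : realType}.
Variables (u g : R -> R) (y0 : R).
Hypotheses (gc : continuous g) (uy0 : derivable u y0 1).
Let q h x := (u (x + h) - u x) / h.
Hypothesis A : forall n kappa, 0 < kappa -> exists2 h0, 0 < h0 &
  forall h x y, 0 < h -> h < h0 -> - n <= x -> x + h <= y -> y + h <= n ->
    `|Int g x y + (q h x - q h y)| <= kappa.

Let gi x y : intg g x y. Proof. exact: intgT_continuous. Qed.

Lemma quotient_sides (f : R -> R) (x l : R) :
  (forall kappa, 0 < kappa -> exists2 h0, 0 < h0 & forall h, 0 < h -> h < h0 ->
     `|(f (x + h) - f x) / h - l| <= kappa /\ `|(f x - f (x - h)) / h - l| <= kappa) ->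
  derivable f x 1 /\ derive1 f x = l.
Proof.
move=> H; apply: cvg_derive1; apply/cvgrPdist_le => e e0.
have [h0 h00 hh] := H e e0; near=> h.
have hn : h != 0 by near: h; exact: nbhs_dnbhs_neq.
have hs : `|h| < h0 by near: h; exact: dnbhs0_lt.
rewrite distrC -[_ *: _]/(_ * _).
have [hp|hneg] := ltP 0 h.
  by rewrite gtr0_norm// in hs; have [h1 _] := hh h hp hs; rewrite mulrC (addrC h).
have hlt : h < 0 by rewrite lt_neqAle hn.
rewrite ltr0_norm// in hs; have hN : 0 < - h by rewrite oppr_gt0.
have [_ h1] := hh (- h) hN hs; move: h1; rewrite opprK (addrC h).
by rewrite invrN mulrN -mulNr opprB mulrC.
Unshelve. all: by end_near. Qed.

Lemma quotient_base kappa : 0 < kappa -> exists2 h0, 0 < h0 & forall h, 0 < h -> h < h0 ->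
  `|q h y0 - derive1 u y0| <= kappa /\ `|q h (y0 - h) - derive1 u y0| <= kappa.
Proof.
move=> k0; have := derive1_cvg uy0 => /cvgrPdist_le /(_ kappa k0).
rewrite /= => -[h0 /= h00 H]; exists h0 => // h hp hh; split.
  have := H h; rewrite /= sub0r normrN (gtr0_norm hp) => /(_ hh (lt0r_neq0 hp)).
  by rewrite distrC -[_ *: _]/(_ * _) mulrC (addrC h).
have := H (- h); rewrite /= sub0r opprK (gtr0_norm hp) oppr_eq0 => /(_ hh (lt0r_neq0 hp)).
rewrite distrC -[_ *: _]/(_ * _) (addrC (- h)) invrN mulNr -mulrN opprB mulrC.
by rewrite /q subrK.
Qed.

Lemma g_bound n : exists2 B, 0 <= B & forall x y, - n <= x -> x <= y -> y <= n -> `|Int g x y| <= B * (y - x).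
Proof.
have [M [_ hM]] := compact_bounded (continuous_compact (continuous_subspaceT gc) (@segment_compact _ (- n) n)).
exists (`|M| + 1); first by rewrite addr_ge0.
move=> x y nx xy yn; apply: le_trans (Int_norm (gi _ _)) _.
apply: Int_le_cst => //; first exact: intg_norm.
move=> t /andP[xt ty]; apply: (hM (`|M| + 1)); first by rewrite (le_lt_trans (ler_norm M))// ltrDl.
by exists t => //; rewrite /= in_itv /= (le_trans nx xt) (le_trans ty yn).
Qed.

(** The quotients at [x] are tied to those at [y0], which converge; the left quotient at
    [x] is the right quotient at [x - h]. *)
Lemma derivable_of_quotients x :
  derivable u x 1 /\ derive1 u x = derive1 u y0 + prim g y0 x.
Proof.
have [->|xy] := eqVneq x y0; first by split => //; rewrite /prim lexx Int_at addr0.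
apply: quotient_sides => kappa k0.
pose n := `|x| + `|y0| + 2.
have xn : - n + 1 <= x <= n - 1.
  have := ler_norm x; have := ler_norm (- x); rewrite normrN /n.
  by have := normr_ge0 y0; move=> ? ? ?; apply/andP; split; lra.
have yn : - n + 1 <= y0 <= n - 1.
  have := ler_norm y0; have := ler_norm (- y0); rewrite normrN /n.
  by have := normr_ge0 x; move=> ? ? ?; apply/andP; split; lra.
move: xn yn => /andP[xn1 xn2] /andP[yn1 yn2].
have k3 : 0 < kappa / 3 by rewrite divr_gt0.
have [hA hA0 HA] := A n k3; have [hB hB0 HB] := quotient_base k3.
have [B B0 gB] := g_bound n.
have hC0 : 0 < kappa / 3 / (B + 1) by rewrite divr_gt0// ltr_wpDl.
have hD0 : 0 < `|x - y0| / 2 by rewrite divr_gt0// normr_gt0 subr_eq0.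
exists (Num.min (Num.min hA hB) (Num.min (Num.min (kappa / 3 / (B + 1)) 1) (`|x - y0| / 2))).
  by rewrite !lt_min hA0 hB0 hC0 ltr01 hD0.
move=> h h0; rewrite !lt_min => /andP[/andP[hhA hhB] /andP[/andP[hhC h1] hhD]].
have [b1 b2] := HB h h0 hhB.
have small : B * h <= kappa / 3.
  rewrite ltr_pdivlMr ?ltr_wpDl// in hhC; nra.
have smallI x' : - n <= x' -> x' + h <= n -> `|Int g x' (x' + h)| <= kappa / 3.
  move=> n1 n2; apply: le_trans (gB x' (x' + h) n1 _ n2) _; first by rewrite lerDl ltW.
  by rewrite addrAC subrr add0r.
have qE : (u x - u (x - h)) / h = q h (x - h) by rewrite /q subrK.
rewrite qE -/(q h x).
have xhx : x - h <= x by rewrite gerBl ltW.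
have I2 : `|Int g (x - h) x| <= kappa / 3.
  have := smallI (x - h); rewrite subrK; apply.
    by rewrite lerBrDr; apply: le_trans xn1; rewrite lerD2l ltW.
  by apply: le_trans xn2 _; rewrite lerBlDr lerDl.
have [y0x|xy0] := ltP y0 x.
  have hD : h < (x - y0) / 2 by move: hhD; rewrite gtr0_norm ?subr_gt0.
  rewrite /prim (ltW y0x).
  have [m1 m2 m3 m4 m5] := margins h0 h1 hD yn1 xn2.
  have y0xh : y0 <= x - h by rewrite lerBrDr.
  have a1 : `|Int g y0 x + (q h y0 - q h x)| <= kappa / 3 by exact: HA.
  have a2 : `|Int g y0 (x - h) + (q h y0 - q h (x - h))| <= kappa / 3.
    by apply: HA => //; rewrite subrK (le_trans _ m5)// lerDl ltW.
  have E := Int_cat y0xh xhx (gi y0 x).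
  move: a1 a2 b1 b2 I2; rewrite E.
  move: (Int _ _ _) (Int _ _ _) (q h y0) (q h x) (q h (x - h)) (q h (y0 - h)) (derive1 u y0) => i1 i2 q1 q2 q3 q4 l.
  clear; rewrite !ler_norml => /andP[? ?] /andP[? ?] /andP[? ?] /andP[? ?] /andP[? ?].
  by split; apply/andP; split; lra.
have xlt : x < y0 by rewrite lt_neqAle xy.
have hD : h < (y0 - x) / 2 by move: hhD; rewrite distrC gtr0_norm ?subr_gt0.
rewrite /prim (leNgt y0 x) xlt /=.
have [m1 m2 m3 m4 m5] := margins h0 h1 hD xn1 yn2.
have a1 : `|Int g x y0 + (q h x - q h y0)| <= kappa / 3 by exact: HA.
have a2 : `|Int g (x - h) y0 + (q h (x - h) - q h y0)| <= kappa / 3.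
  by apply: HA => //; rewrite subrK ltW.
have E := Int_cat xhx (ltW xlt) (gi (x - h) y0).
move: a1 a2 b1 b2 I2; rewrite E.
move: (Int _ x y0) (Int _ (x - h) x) (q h y0) (q h x) (q h (x - h)) (q h (y0 - h)) (derive1 u y0) => i1 i2 q1 q2 q3 q4 l.
clear; rewrite !ler_norml => /andP[? ?] /andP[? ?] /andP[? ?] /andP[? ?] /andP[? ?].
by split; apply/andP; split; lra.
Qed.

End quotients.

(** The null set of exceptional points cannot contain an interval. *)
Lemma lip_derivable_point (R : realType) (f : R -> R) (c d k : R) : c < d -> continuous f ->
  (forall x y, c <= x <= d -> c <= y <= d -> `|f x - f y| <= k * `|x - y|) ->
  exists y, derivable f y 1.
Proof.
move=> cd fc fk; have [_ _ [Nl [mN N0 sub]]] := lip_seq_deriv cd fc fk.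
apply: contrapT => /forallNP nd.
have IN : `]c, d[%classic `<=` Nl.
  by move=> t tI; apply: sub => /= H; apply: (nd t); apply: H; move: tI; rewrite /= in_itv.
have : (lebesgue_measure (`]c, d[%classic : set R) <= 0)%E.
  by rewrite -N0; apply: le_measure => //; rewrite inE//; exact: measurable_itv.
by rewrite lebesgue_measure_itv /= lte_fin cd -EFinB lee_fin leNgt subr_gt0 cd.
Qed.

(** * Regularity of the reparametrized arc *)

Section regularity.
Context {R : realType} {N : nat}.
Notation mu := (@lebesgue_measure R).
Variables (W : 'rV[R]_N -> R) (U : R -> 'rV[R]_N) (A : set 'rV[R]_N) (alpha : R).
Hypotheses (Wc : continuous W) (W0 : forall q, 0 <= W q).
Hypotheses (al0 : 0 < alpha) (WA : C1_holder_loc alpha A W) (A0 : forall q, 0 < W q -> A q).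
Let r q := Num.sqrt (2 * W q).
Hypotheses (Uc : continuous U) (UW : forall z, 0 < W (U z))
  (Ulip : forall x y M, x <= y -> (forall z, x <= z <= y -> r (U z) <= M) ->
     enorm (U y - U x) <= M * (y - x))
  (comp : forall x y h v M1 M2, 0 < h -> x + h <= y ->
    (forall th, 0 <= th <= 1 -> W (U x + th *: (U (x + h) + v - U x)) <= M1) ->
    (forall th, 0 <= th <= 1 -> W (U y + v + th *: (U (y + h) - (U y + v))) <= M2) ->
    Int (fun z => 2 * W (U z)) x (y + h) <=
    enorm (U (x + h) + v - U x) ^+ 2 / (2 * h) + h * M1
    + Int (fun z => W (U z + v) + W (U z)) (x + h) y
    + (enorm (U (y + h) - (U y + v)) ^+ 2 / (2 * h) + h * M2)).

Let image_compact n : compact (U @` `[- n, n]).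
Proof. by apply: continuous_compact; [exact: continuous_subspaceT|exact: segment_compact]. Qed.

Let in_image (n z : R) : `|z| <= n -> (U @` `[- n, n]) (U z).
Proof. by rewrite ler_norml => zn; exists z => //; rewrite /= in_itv. Qed.

Let image_pos n p : (U @` `[- n, n]) p -> 0 < W p.
Proof. by move=> [z _ <-]. Qed.

Let estimates n := C1_estimates Wc al0 WA A0 (@image_compact n) (@image_pos n).

Lemma speed_bound n : exists2 k, 0 <= k & forall x y, `|x| <= n -> `|y| <= n ->
  enorm (U x - U y) <= k * `|x - y|.
Proof.
have rUc : continuous (fun z => r (U z)).
  by move=> z; apply: (@continuous_comp _ _ _ U r); [exact: Uc|exact: sqrt2W_continuous].
have [M [_ hM]] := compact_bounded (continuous_compact (continuous_subspaceT rUc) (@segment_compact _ (- n) n)).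
exists (`|M| + 1); first by rewrite addr_ge0.
move=> x y; wlog xy : x y / x <= y.
  move=> H xn yn; have [xy|/ltW yx] := leP x y; first exact: H.
  by rewrite enormC distrC; exact: H.
rewrite !ler_norml => /andP[xn _] /andP[_ yn].
rewrite enormC distrC (ger0_norm (_ : 0 <= y - x)) ?subr_ge0//; apply: Ulip => //.
move=> z /andP[xz zy]; apply: le_trans (ler_norm _) _; apply: (hM (`|M| + 1)).
  by rewrite (le_lt_trans (ler_norm M))// ltrDl.
by exists z => //; rewrite /= in_itv /= (le_trans xn xz) (le_trans zy yn).
Qed.

Lemma gradU_continuous : continuous (fun z => grad W (U z)).
Proof.
move=> x; apply/cvg_enormP => e e0; have e2 : 0 < e / 2 by rewrite divr_gt0.
have [dl [Lp [_ _ _ _ H]]] := estimates (`|x| + 1).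
have [d d0 Hd] := H _ e2.
have [d' d'0 hd'] := continuous_enorm x Uc d0.
have m0 : 0 < Num.min 1 d' by rewrite lt_min ltr01.
have hb : nbhs (x : R) (ball (x : R) (Num.min 1 d')) by exact: nbhsx_ballx.
apply: filterS hb => y; rewrite -ball_normE /= lt_min => /andP[xy1 xy2].
have yn : `|y| <= `|x| + 1.
  by have := ler_normD x (y - x); rewrite addrC subrK (distrC y); lra.
apply: (@le_lt_trans _ _ (e / 2)); last by lra.
apply: Hd; [exact: in_image|by apply: in_image; rewrite lerDl|exact/ltW/hd'].
Qed.

Let g i z := grad W (U z) 0 i.

Lemma g_continuous i : continuous (g i).
Proof. by move: i; apply/rV_continuousP; exact: gradU_continuous. Qed.

Lemma g_bounded i n : exists2 B, 0 <= B & forall z, `|z| <= n -> `|g i z| <= B.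
Proof.
have [M [_ hM]] := compact_bounded (continuous_compact (continuous_subspaceT (@g_continuous i)) (@segment_compact _ (- n) n)).
exists (`|M| + 1); first by rewrite addr_ge0.
move=> z; rewrite ler_norml => zn; apply: (hM (`|M| + 1)).
  by rewrite (le_lt_trans (ler_norm M))// ltrDl.
by exists z.
Qed.

Lemma EL_approx i n kappa : 0 < kappa -> exists2 h0, 0 < h0 &
  forall h x y, 0 < h -> h < h0 -> - n <= x -> x + h <= y -> y + h <= n ->
    `|Int (g i) x y + ((U (x + h) 0 i - U x 0 i) / h - (U (y + h) 0 i - U y 0 i) / h)| <= kappa.
Proof.
move=> k0; have [nneg|n0] := ltP n 0.
  by exists 1 => // h x y h0 _ nx xy yn; exfalso; lra.
have [delta [L [d0 L0 WL Wk _]]] := estimates n.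
have [k kk0 kU] := speed_bound n.
have [B B0 gB] := g_bounded i n.
pose kp := kappa / (4 * (n + 1)).
have n1 : 0 < 4 * (n + 1) by rewrite mulr_gt0// ltr_wpDl.
have kp0 : 0 < kp by rewrite divr_gt0.
have [ek ek0 Wkk] := Wk kp kp0.
pose D := kappa / 2.
have D0 : 0 < D by rewrite divr_gt0.
have kpD : kp * (2 * n) + D <= kappa.
  have : kp * (2 * n) <= kappa / 2; last by rewrite /D; lra.
  rewrite /kp mulrAC ler_pdivrMr//; nra.
pose Q := 8 * (L * k) + 2 * L + 1 + B.
have Q0 : 0 < Q.
  by rewrite /Q; have := mulr_ge0 L0 kk0; lra.
have k1 : 0 < k + 1 by rewrite ltr_wpDl.
(* below [e0], the competitor stays in the region of the estimates and the errors
   add up to at most [kappa] *)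
pose e0 := Num.min (Num.min 1 (delta / (k + 1))) (Num.min ek (D / Q)).
have e00 : 0 < e0 by rewrite !lt_min ltr01 !divr_gt0// ek0.
exists (e0 ^+ 2); first by rewrite exprn_gt0.
move=> h x y h0 hh nx xhy yhn.
(* the scaling h = eta^2, |eps| = eta^3 *)
pose eta := Num.sqrt h.
have hE : h = eta ^+ 2 by rewrite sqr_sqrtr// ltW.
have eta0 : 0 < eta by rewrite sqrtr_gt0.
have : eta < e0 by rewrite -(@ltr_pXn2r _ 2)// ?nnegrE ?(ltW eta0) ?(ltW e00)// -hE.
rewrite !lt_min => /andP[/andP[h1 h2] /andP[h3 h4]].
have e3le : eta ^+ 3 <= eta by rewrite exprS ler_piMr ?(ltW eta0)// exprn_ile1 ?(ltW eta0) ?(ltW h1).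
have e2le : eta ^+ 2 <= eta by rewrite exprS ler_piMr ?(ltW eta0)// expr1 ltW.
apply: (@core_scaling _ L k eta D kp (2 * n) B kappa) => //.
- exact: ltW.
- by rewrite ltr_pdivlMr// in h4; rewrite -/Q ltW.
move=> eps epsE.
have hd : k * h + `|eps| <= delta.
  rewrite ltr_pdivlMr// mulrDr mulr1 in h2; apply: le_trans (ltW h2); rewrite epsE hE lerD//.
  by rewrite mulrC ler_wpM2r.
have hk : `|eps| <= ek by rewrite epsE (le_trans e3le)// ltW.
have := @EL_core R N W U Wc W0 Uc Ulip comp n k L delta B kp ek i kk0 L0 kU _ _ gB _ x y h eps h0 nx xhy yhn hd hk (ltW kp0) B0.
rewrite -/(g i) hE !mxE; apply.
- by move=> z v zn vd; apply: WL => //; exact: in_image.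
- by apply: intgT_continuous; exact: g_continuous.
- by move=> z s zn; apply: Wkk; exact: in_image.
Qed.

Lemma U_derivable i : exists l y0, forall x,
  derivable (fun z => U z 0 i) x 1 /\ derive1 (fun z => U z 0 i) x = l + prim (g i) y0 x.
Proof.
have [k k0 kU] := speed_bound 1.
have uc : continuous (fun z => U z 0 i) by move: i; apply/rV_continuousP.
have [y0 dy0] : exists y, derivable (fun z => U z 0 i) y 1.
  apply: (@lip_derivable_point R _ 0 1 k) => // x y /andP[x0 x1] /andP[y0 y1].
  have := kU x y; rewrite (ger0_norm x0) (ger0_norm y0) => /(_ x1 y1); apply: le_trans.
  by have := coord_le_enorm (U x - U y) i; rewrite !mxE.
exists (derive1 (fun z => U z 0 i) y0), y0 => x.
apply: (@derivable_of_quotients R _ _ _ (@g_continuous i) dy0).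
by move=> n kappa; exact: EL_approx.
Qed.

(** One point of differentiability per coordinate determines [U'] everywhere, as a constant
    plus a primitive of the continuous function grad W (U). *)
Lemma regularity : classical_solution W U /\ forall x, enorm (derive1 U x) <= r (U x).
Proof.
have [l hl] := choice U_derivable; have [y0 H] := choice hl.
have dU x : derivable U x 1 by apply/derivable_mxP => i j; rewrite (ord1 i); have [] := H j x.
have U'E : derive1 U = fun x => \row_i (l i + prim (g i) (y0 i) x).
  apply/funext => x; apply/rowP => i; rewrite derive1E derive_mx// !mxE.
  by have [_ <-] := H i x; rewrite derive1E.
have dp i (x : R) : is_derive x 1 (fun x => l i + prim (g i) (y0 i) x) (g i x).
  have := is_deriveD (is_derive_cst (l i) x 1) (prim_derive (y0 i) (@g_continuous i) x).
  by rewrite add0r.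
have dU' x : derivable (derive1 U) x 1.
  rewrite U'E; apply/derivable_mxP => i j.
  rewrite (_ : (fun _ => _) = fun x => l j + prim (g j) (y0 j) x); first by have [] := dp j x.
  by apply/funext => z; rewrite mxE.
have U''E : derive1 (derive1 U) = fun x => grad W (U x).
  apply/funext => x; apply/rowP => i; rewrite derive1E derive_mx// [LHS]mxE.
  rewrite U'E (_ : (fun _ => _) = fun x => l i + prim (g i) (y0 i) x); last first.
    by apply/funext => z; rewrite mxE.
  by have [_ dE] := dp i x; exact: dE.
split.
  split; [exact: dU|exact: dU'|rewrite U''E; exact: gradU_continuous|].
  by move=> x; rewrite U''E subrr.
move=> x; apply/ler_addgt0Pr => e e0; have e2 : 0 < e / 2 by rewrite divr_gt0.
have rUc : continuous (fun z => r (U z)).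
  by move=> z; apply: (@continuous_comp _ _ _ U r); [exact: Uc|exact: sqrt2W_continuous].
have [d d0 hd] := heine_itv x x rUc e2.
have /cvg_enormP /(_ _ e2) [d' /= d'0 hd'] := derive1_cvg (dU x).
pose h := Num.min d d' / 2.
have m0 : 0 < Num.min d d' by rewrite lt_min d0.
have h0 : 0 < h by rewrite divr_gt0.
have hm : h < Num.min d d' by rewrite /h; lra.
move: hm; rewrite lt_min => /andP[hd1 hd2].
have := hd' h; rewrite /= sub0r normrN (gtr0_norm h0) => /(_ hd2 (lt0r_neq0 h0)) q1.
have xh : x <= h + x by rewrite lerDr ltW.
have q2 : enorm (U (h + x) - U x) <= (r (U x) + e / 2) * h.
  have := @Ulip x (h + x) (r (U x) + e / 2) xh; rewrite addrK; apply => z /andP[xz zx].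
  have hz : `|x - z| < d by rewrite distrC ger0_norm ?subr_ge0//; lra.
  have := hd x z; rewrite lexx => /(_ isT hz); rewrite ltr_norml => /andP[h1 h2].
  by rewrite -lerBlDl -opprB lerNl ltW.
have q3 : enorm (h^-1 *: (U (h + x) - U x)) <= r (U x) + e / 2.
  by rewrite enormZ gtr0_norm ?invr_gt0// mulrC ler_pdivrMr.
have q4 := enormD (derive1 U x - h^-1 *: (U (h + x) - U x)) (h^-1 *: (U (h + x) - U x)).
rewrite subrK in q4; rewrite enormC in q1; lra.
Qed.

End regularity.

(** * The arc of a geodesic between two wells *)

Section restriction.
Context {R : realType} {N : nat}.
Notation mu := (@lebesgue_measure R).
Implicit Types (Z : set 'rV[R]_N) (gamma : R -> 'rV[R]_N).

Definition clamp (al be t : R) := if t <= al then al else if be <= t then be else t.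

Lemma clamp_itv al be t : al <= be -> al <= clamp al be t <= be.
Proof.
move=> ab; rewrite /clamp; case: (leP t al) => h1; first by rewrite lexx ab.
by case: (leP be t) => h2; rewrite ?lexx ?ab// (ltW h1) (ltW h2).
Qed.

Lemma clamp_id al be t : al <= t <= be -> clamp al be t = t.
Proof.
move=> /andP[h1 h2]; rewrite /clamp; case: (leP t al) => h3.
  by apply/eqP; rewrite eq_le h1 h3.
by case: (leP be t) => h4//; apply/eqP; rewrite eq_le h2 h4.
Qed.

Lemma clamp_continuous al be : al <= be -> continuous (clamp al be).
Proof.
move=> ab; apply: (@lip_continuous _ _ 1) => x y; rewrite mul1r.
have h1 := ler_norm (x - y); have := ler_norm (y - x); rewrite distrC => h2.
rewrite ler_norml /clamp; apply/andP.
by case: (leP x al) => ?; case: (leP y al) => ?; case: (leP be x) => ?; case: (leP be y) => ?; split; lra.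
Qed.

(** A curve is constrained only on [0, 1]; freezing it outside [al, be] makes it continuous
    on the line without changing the arc. *)
Lemma clamp_comp_continuous gamma al be : {within `[(0 : R), 1], continuous gamma} ->
  0 <= al -> al <= be -> be <= 1 -> continuous (fun t => gamma (clamp al be t)).
Proof.
move=> gc al0 ab be1 x A /= nA; move/subspace_continuousP: gc => gc.
have clI t : `[(0 : R), 1]%classic (clamp al be t).
  have /andP[h1 h2] := clamp_itv t ab.
  by rewrite /= in_itv /= (le_trans al0 h1) (le_trans h2 be1).
have h := gc (clamp al be x) (clI x) A nA.
have := clamp_continuous ab h; rewrite /= !nbhs_filterE /= => h'.
near=> t.
have : `[(0 : R), 1]%classic (clamp al be t) -> A (gamma (clamp al be t)).
  by near: t; exact: h'.
by apply; exact: clI.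
Unshelve. all: by end_near. Qed.

(** Compactness turns the local Lipschitz constants into one constant. *)
Lemma LipZ_lip Z gamma (s t : R) : LipZ Z gamma -> 0 <= s -> s <= t -> t <= 1 ->
  (forall u, s <= u <= t -> ~ Z (gamma u)) ->
  exists k, forall x y, s <= x <= t -> s <= y <= t -> enorm (gamma x - gamma y) <= k * `|x - y|.
Proof.
move=> [_ gl] s0 st t1 nZ.
have D u : s <= u <= t -> ([set t : R | 0 <= t <= 1] `\` well_times Z gamma) u.
  move=> uI; have /andP[h1 h2] := uI; split; first by rewrite /= (le_trans s0) ?(le_trans h2).
  by move=> [_]; exact: nZ.
pose P d x := forall a b, s <= a <= t -> s <= b <= t -> `|a - x| < d -> `|b - x| < d ->
  enorm (gamma a - gamma b) <= d^-1 * `|a - b|.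
have /compact_near_coveringP cov := @segment_compact R s t.
have := cov R (0^'+) P _; case.
  move=> x; rewrite /= in_itv /= => xI.
  have [e [k [e0 H]]] := gl x (D _ xI).
  have e2 : 0 < e / 2 by rewrite divr_gt0.
  have k1 : 0 < (`|k| + 1)^-1 by rewrite invr_gt0 ltr_wpDl.
  near=> x' d => a b aI bI ax bx.
  have d0 : 0 < d by near: d; exact: nbhs_right_gt.
  have de : d < e / 2 by near: d; exact: nbhs_right_lt.
  have dk : d < (`|k| + 1)^-1 by near: d; exact: nbhs_right_lt.
  have : ball x (e / 2) x' by near: x'; exact: nbhsx_ballx.
  rewrite -ball_normE /= distrC => xx.
  have hx c : `|c - x'| < d -> `|c - x| < e.
    by move=> cx; have := ler_distD x' c x; lra.
  apply: le_trans (H a b (D _ aI) (D _ bI) (hx _ ax) (hx _ bx)) _.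
  rewrite ler_wpM2r//; apply: le_trans (ler_norm k) _.
  apply: (@le_trans _ _ (`|k| + 1)); first by rewrite lerDl.
  by rewrite -[leLHS]invrK lef_pV2 ?posrE// ltW.
move=> d /= d0 Hd.
pose d' := d / 2.
have d'0 : 0 < d' by rewrite divr_gt0.
have {}Hd x : s <= x <= t -> P d' x.
  move=> xI; apply: (Hd d'); rewrite //= ?in_itv//= sub0r normrN gtr0_norm// /d'; lra.
have dinv : 0 <= d'^-1 by rewrite invr_ge0 ltW.
have H a b : s <= a -> a <= b -> b <= t -> enorm (gamma a - gamma b) <= d'^-1 * (b - a).
  move=> sa ab bt.
  apply: (@chop _ (fun a b => enorm (gamma a - gamma b) <= d'^-1 * (b - a)) a b d') => //.
    move=> u v au uv vb uvd; have uI : s <= u <= t by rewrite (le_trans sa au) (le_trans uv) ?(le_trans vb).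
    have vI : s <= v <= t by rewrite (le_trans (le_trans sa au) uv) (le_trans vb).
    have := Hd u uI u v uI vI; rewrite subrr normr0 (distrC u v) (ger0_norm (_ : 0 <= v - u)) ?subr_ge0//.
    exact.
  move=> u v w _ _ _ _ h1 h2; apply: le_trans (enormB_le _ (gamma v) _) _.
  by rewrite (_ : w - u = (v - u) + (w - v)); [rewrite mulrDr lerD|ring].
exists d'^-1 => x y /andP[sx xt] /andP[sy yt].
have [xy|/ltW yx] := leP x y.
  by rewrite distrC ger0_norm ?subr_ge0//; exact: H.
by rewrite enormC ger0_norm ?subr_ge0//; exact: H.
Unshelve. all: by end_near. Qed.
End restriction.

Section arc.
Context {R : realType} {N : nat}.
Notation mu := (@lebesgue_measure R).

Section arc_speed.
Variables (gam : R -> 'rV[R]_N) (al be : R).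
Hypothesis gc : continuous gam.
Hypothesis glip : forall s t, al < s -> s <= t -> t < be ->
  exists k, forall x y, s <= x <= t -> s <= y <= t -> enorm (gam x - gam y) <= k * `|x - y|.

Lemma arc_speed s t : al < s -> s <= t -> t < be ->
  [/\ intg (speed gam) s t, enorm (gam t - gam s) <= Int (speed gam) s t &
    {ae mu, forall x, s < x < t -> enorm (derive1 gam x) = speed gam x}].
Proof.
move=> als st tbe; pose t' := (t + be) / 2.
have tt' : t < t' by rewrite /t'; lra.
have t'be : t' < be by rewrite /t'; lra.
have st' := le_lt_trans st tt'.
have [k hk] := glip als (ltW st') t'be.
have [h1 h2 h3] := lip_speed st' gc hk.
split; [exact: intgS (lexx s) (ltW tt') h1|exact: h2 (lexx s) st (ltW tt')|].
have FF : Filter (nbhs (almost_everywhere mu)) by exact: (ae_filter_ringOfSetsType mu).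
move: h3; apply: filterS => x H /andP[sx xt].
by have [] := H; first by rewrite sx (lt_trans xt).
Qed.

Lemma arc_speed_intg s t : al < s -> t < be -> intg (speed gam) s t.
Proof.
move=> als tbe; have [st|ts] := leP s t; first by have [] := arc_speed als st tbe.
by rewrite /intg set_itv_ge ?bnd_simp -?ltNge//; exact: integrable_set0.
Qed.

(** The measurable speed of the frozen curve agrees almost everywhere with the norm of
    the derivative of [gamma], and lower integrals are monotone in the domain. *)
Lemma arc_weight (F : 'rV[R]_N -> R) (gamma : R -> 'rV[R]_N) (m0 s t : R) : continuous F -> (forall q, 0 <= F q) ->
  (forall x, al < x < be -> gam x = gamma x) ->
  (\int[mu]_(x in `]al, be[) wspeed F gamma x <= m0%:E)%E ->
  al < s -> s <= t -> t < be -> Int (fun u => F (gam u) * speed gam u) s t <= m0.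
Proof.
move=> Fc F0 gE m0P als st tbe.
have [si _ sae] := arc_speed als st tbe.
have Fgc : continuous (fun u => F (gam u)).
  by move=> z; apply: (@continuous_comp _ _ _ gam F); [exact: gc|exact: Fc].
have fi : intg (fun u => F (gam u) * speed gam u) s t by exact: intgM_continuous.
have ws0 f x : (0 <= wspeed F f x)%E by rewrite lee_fin mulr_ge0 ?enorm_ge0.
have f0 x : (0 <= (F (gam x) * speed gam x)%:E)%E by rewrite lee_fin mulr_ge0 ?enorm_ge0.
rewrite -lee_fin; apply: le_trans m0P; rewrite Int_EFin// lower_integral_ccoo//.
rewrite -(@lower_integral_ae _ _ _ mu `]s, t[%classic (wspeed F gamma)) => //.
- apply: lower_integral_subset => // x; rewrite /= !in_itv /= => /andP[sx xt].
  by rewrite (lt_trans als sx) (lt_trans xt tbe).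
- apply: measurable_funTS; apply/measurable_EFinP; apply: measurable_funM.
    exact: continuous_measurable_fun.
  exact: measurable_speed.
have FF : Filter (nbhs (almost_everywhere mu)) by exact: (ae_filter_ringOfSetsType mu).
move: sae; apply: filterS => x H; rewrite /= in_itv /= => xI.
have /andP[sx xt] := xI.
have ax := lt_trans als sx; have xb := lt_trans xt tbe.
have xab : al < x < be by rewrite ax.
have dE : derive1 gamma x = derive1 gam x.
  apply: near_derive1; near=> z; rewrite gE//; apply/andP; split; near: z; [exact: lt_nbhsr|exact: lt_nbhsl].
by rewrite /wspeed dE (H xI) (gE _ xab).
Unshelve. all: by end_near. Qed.

End arc_speed.
End arc.

(** * Energy and weighted length *)

Lemma weighted_young (R : realType) (s p q : R) : s ^+ 2 = 2 ->
  s * (p * q) <= 2^-1 * q ^+ 2 + p ^+ 2.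
Proof.
move=> s2; have := sqr_ge0 (s * p - q).
have -> : (s * p - q) ^+ 2 = s ^+ 2 * p ^+ 2 - 2 * (s * (p * q)) + q ^+ 2 by ring.
rewrite s2; move: (s * _) (p ^+ 2) (q ^+ 2) => x y z; lra.
Qed.

Section energy_bounds.
Context {R : realType} {N : nat}.
Notation mu := (@lebesgue_measure R).
Variable W : 'rV[R]_N -> R.
Hypotheses (Wc : continuous W) (W0 : forall q, 0 <= W q).
Let F q := Num.sqrt (W q).

Lemma energy_density_ge0 (V G : R -> 'rV[R]_N) x :
  (0 <= (2^-1 * enorm (G x) ^+ 2 + W (V x))%:E)%E.
Proof. by rewrite lee_fin addr_ge0// mulr_ge0// sqr_ge0. Qed.

(** Since |U'|^2 <= 2 W(U), the energy density is at most 2 W(U). *)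
Lemma energy_upper_bound (U : R -> 'rV[R]_N) M : continuous U ->
  (forall x, enorm (derive1 U x) <= Num.sqrt (2 * W (U x))) ->
  (forall x y, x <= y -> Int (fun z => 2 * W (U z)) x y <= M) ->
  (energy W U (derive1 U) <= M%:E)%E.
Proof.
move=> Uc dU UM.
have fc : continuous (fun z => 2 * W (U z)).
  move=> z; apply: cvgM; first exact: cvg_cst.
  by apply: (@continuous_comp _ _ _ U W); [exact: Uc|exact: Wc].
apply: (@le_trans _ _ (\int[mu]_x (2 * W (U x))%:E)%E).
  apply: lower_integral_le => x _; first exact: energy_density_ge0.
  rewrite lee_fin; have W2 : 0 <= 2 * W (U x) by rewrite mulr_ge0.
  have : enorm (derive1 U x) ^+ 2 <= 2 * W (U x).
    rewrite -[leRHS](sqr_sqrtr W2) ler_pXn2r// nnegrE ?enorm_ge0//; exact: sqrtr_ge0.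
  lra.
pose I n := `[- (n%:R : R), n%:R]%classic : set R.
have IT : \bigcup_n I n = setT.
  apply/seteqP; split => // x _; exists (Num.bound `|x|) => //.
  by rewrite /I /= in_itv /= -ler_norml ltW// archi_boundP.
have cv : (\int[mu]_(x in I n) (2 * W (U x))%:E)%E @[n --> \oo] --> (\int[mu]_x (2 * W (U x))%:E)%E.
  rewrite -IT; apply: ge0_nondecreasing_set_cvg_integral.
  - move=> n k nk; apply/subsetPset => x; rewrite /I /= !in_itv /= => /andP[h1 h2].
    have nk' : (n%:R : R) <= k%:R by rewrite ler_nat.
    by rewrite (le_trans _ h1) ?lerN2// (le_trans h2).
  - by move=> n; exact: measurable_itv.
  - by move=> n; apply: measurable_funTS; apply/measurable_EFinP; exact: continuous_measurable_fun.
  - by move=> n x _; rewrite lee_fin mulr_ge0.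
rewrite -(cvg_lim _ cv)//; apply: lime_le; first by apply/cvg_ex; eexists; exact: cv.
apply: nearW => n; have nn : - (n%:R : R) <= n%:R by rewrite ge0_cp// ler0n.
have := UM _ _ nn; rewrite -lee_fin; apply: le_trans.
by rewrite Int_EFin//; exact: intgT_continuous.
Qed.

(** Young's inequality bounds the energy of a long piece of [V] by sqrt 2 times its
    weighted length, and two cheap segments complete the piece to a path between the
    wells. *)
Lemma energy_lower_bound (V G : R -> 'rV[R]_N) a b M : W a = 0 -> W b = 0 ->
  H1_loc V G -> connects a b V -> (forall c, reach F a b c -> M <= c) ->
  ((Num.sqrt 2 * M)%:E <= energy W V G)%E.
Proof.
move=> Wa Wb VG [Va Vb] hM.
have s2 : 0 < Num.sqrt (2 : R) by rewrite sqrtr_gt0.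
have [Gi Vug] := H1_upper_gradient VG; have [Vc _ _ _] := VG.
apply/lee_addgt0Pr => e e0.
have e1 : 0 < e / (2 * Num.sqrt 2) by rewrite divr_gt0// mulr_gt0.
have [T T0 /(_ T (lexx T)) [ra rb]] := reach_tail Wc Wa Wb Va Vb e1.
have TT : - T <= T by lra.
have rc := reach_curve TT (sqrtW_continuous Wc) (sqrtW_ge0 W) Vc (Gi _ _) (fun t => enorm_ge0 (G t))
  (fun s t _ st _ => Vug s t st).
have := hM _ (reach_trans ra (reach_trans rc rb)).
set f := (fun t => F (V t) * enorm (G t)).
have fi : intg f (- T) T.
  apply: intgM_continuous; last exact: Gi.
  by move=> z; apply: (@continuous_comp _ _ _ V F); [exact: Vc|exact: (sqrtW_continuous Wc)].
have h : ((Num.sqrt 2 * Int f (- T) T)%:E <= energy W V G)%E.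
  rewrite -IntZ// Int_EFin; last exact: intgZ.
  apply: (@le_trans _ _ (\int[mu]_(x in `[(- T)%R, T]) (2^-1 * enorm (G x) ^+ 2 + W (V x))%:E)%E).
    apply: lower_integral_le => x _; rewrite lee_fin.
      by rewrite mulr_ge0 ?mulr_ge0 ?sqrtr_ge0 ?enorm_ge0.
    rewrite /f -[in leRHS](sqr_sqrtr (W0 (V x))) -/(F _).
    have s22 : Num.sqrt (2 : R) ^+ 2 = 2 by rewrite sqr_sqrtr.
    exact: weighted_young.
  by apply: lower_integral_subset => // x _; exact: energy_density_ge0.
move=> Mle; apply: le_trans (leeD h (lexx e%:E)); rewrite -EFinD lee_fin.
move: Mle; rewrite -/f; move: (Int f _ _) (Num.sqrt 2) s2 => i s s0 Mle.
have : s * M <= s * (e / (2 * s) + (i + e / (2 * s))) by rewrite ler_pM2l.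
have -> : s * (e / (2 * s) + (i + e / (2 * s))) = s * i + e by field; rewrite gt_eqF.
by [].
Qed.

End energy_bounds.

(** * Existence of the connections *)

(** Here [m0] is the weighted length of the arc: no chain between its endpoints costs
    less, and the reparametrized arc has energy at most sqrt 2 m0. *)
Lemma geodesic_arc_heteroclinic (R : realType) (N m : nat) (W : 'rV[R]_N -> R)
  (p : 'I_m -> 'rV[R]_N) (P Q : 'rV[R]_N) (gamma : R -> 'rV[R]_N) (al be : R) :
  multiwell W p -> LipZ_between (range p) P Q gamma ->
  dist W (range p) P Q = weighted_length W (range p) gamma ->
  0 <= al -> al < be -> be <= 1 -> range p (gamma al) -> range p (gamma be) ->
  (forall t, al < t < be -> ~ range p (gamma t)) ->
  exists U, minimizing_heteroclinic W (range p) (gamma al) (gamma be) U.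
Proof.
move=> hW gL gmin al0 albe be1 Za Zb nZ.
have [Wc W0 _ WZ _ [alpha [alpha0 _ WA]] [C [delta [C0 delta0 WC]]]] := hW.
have [gLip _ _] := gL.
pose F q := Num.sqrt (W q).
have Fc : continuous F := sqrtW_continuous Wc.
have F0 : forall q, 0 <= F q := sqrtW_ge0 W.
have ZW q : range p q -> W q = 0 by move/WZ.
pose gam t := gamma (clamp al be t).
have gamE t : al <= t <= be -> gam t = gamma t by move=> tI; rewrite /gam clamp_id.
have ga : gam al = gamma al by apply: gamE; rewrite lexx ltW.
have gb : gam be = gamma be by apply: gamE; rewrite lexx ltW.
have gamc : continuous gam by apply: clamp_comp_continuous => //; [by case: gLip|exact: ltW].
have gamE' t : al < t < be -> gam t = gamma t.
  by move=> /andP[h1 h2]; apply: gamE; rewrite !ltW.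
have glip s t : al < s -> s <= t -> t < be ->
    exists k, forall x y, s <= x <= t -> s <= y <= t -> enorm (gam x - gam y) <= k * `|x - y|.
  move=> als st tbe; have [||||k hk] := @LipZ_lip _ _ _ gamma s t gLip => //.
  - by rewrite (le_trans al0)// ltW.
  - by rewrite (le_trans _ be1)// ltW.
  - by move=> u /andP[su ut]; apply: nZ; rewrite (lt_le_trans als su) (le_lt_trans ut tbe).
  have sub x : s <= x <= t -> al <= x <= be.
    by move=> /andP[sx xt]; rewrite ltW ?(lt_le_trans als sx)// ltW// (le_lt_trans xt tbe).
  by exists k => x y xI yI; rewrite (gamE x (sub x xI)) (gamE y (sub y yI)); exact: hk.
have sp0 t : 0 <= speed gam t by exact: enorm_ge0.
have spi : forall s t, al < s -> t < be -> intg (speed gam) s t := arc_speed_intg gamc glip.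
have gsp s t : al < s -> s <= t -> t < be -> enorm (gam t - gam s) <= Int (speed gam) s t.
  by move=> als st tbe; have [] := arc_speed gamc glip als st tbe.
have ws0 f x : (0 <= wspeed F f x)%E by exact: wspeed_ge0.
have minimal c : chain F (gamma al) (gamma be) c ->
    (\int[lebesgue_measure]_(t in `]al, be[) wspeed F gamma t <= c%:E)%E.
  move=> hc; have [eta [l ea eb hI]] := chain_curve F0 hc albe.
  exact: le_trans (glue_minimal Wc ZW gL al0 albe be1 Za Zb l ea eb gmin) hI.
have [m0 m0E] : exists m0 : R, m0%:E = (\int[lebesgue_measure]_(t in `]al, be[) wspeed F gamma t)%E.
  have [c /minimal hc] := chain_segment Wc (gamma al) (gamma be).
  eexists; apply: fineK; rewrite ge0_fin_numE; first exact: le_lt_trans hc (ltry _).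
  by apply: integral_ge0 => t _.
have m0_min c : chain F (gam al) (gam be) c -> m0 <= c.
  by rewrite ga gb => /minimal; rewrite -m0E lee_fin.
have m0P s t : al < s -> s <= t -> t < be -> Int (fun u => F (gam u) * speed gam u) s t <= m0.
  by apply: (@arc_weight _ _ gam al be gamc glip F gamma m0 s t Fc F0 gamE'); rewrite m0E.
have Za' : range p (gam al) by rewrite ga.
have Zb' : range p (gam be) by rewrite gb.
have nZ' t : al < t < be -> ~ range p (gam t) by move=> tI; rewrite gamE'//; exact: nZ.
have quad : exists C delta : R, [/\ 0 < C, 0 < delta & forall z q, range p z ->
    enorm (q - z) < delta -> W q <= C * enorm (q - z) ^+ 2].
  by exists C, delta; split => // z q [j _ <-]; exact: WC.
pose U := reparam Wc W0 WZ albe gamc Za' Zb' nZ' sp0 spi gsp quad.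
have Uc : continuous U by exact: reparam_continuous.
have Ulip := @reparam_lip _ _ _ _ Wc W0 WZ _ _ _ _ albe gamc Za' Zb' nZ' sp0 spi gsp quad.
have Upot := @reparam_potential _ _ _ _ Wc W0 WZ _ _ _ _ m0 albe gamc Za' Zb' nZ' sp0 spi gsp m0P quad.
have Ua : U z @[z --> -oo] --> gam al by exact: reparam_cvgNy.
have Ub : U z @[z --> +oo] --> gam be by exact: reparam_cvgy.
have UW z : 0 < W (U z).
  rewrite lt_neqAle W0 andbT eq_sym; apply/eqP => /WZ; exact: reparam_nZ.
have comp := competitor_inequality Wc W0 (ZW _ Za') (ZW _ Zb') Uc Ulip Upot Ua Ub m0_min.
have A0 q : 0 < W q -> (~` range p) q by move=> Wq /ZW W00; move: Wq; rewrite W00 ltxx.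
have [sol dU] := regularity Wc W0 alpha0 WA A0 Uc UW Ulip comp.
exists U; split => //; first by rewrite -ga -gb.
move=> V G VG; rewrite -ga -gb => Vab.
apply: (@le_trans _ _ (Num.sqrt 2 * m0)%:E).
  have h := energy_upper_bound Wc W0 Uc dU Upot; exact: h.
apply: (energy_lower_bound Wc W0 (ZW _ Za') (ZW _ Zb') VG Vab).
by move=> c; exact: m0_reach.
Qed.

Theorem theorem3p1 (R : realType) (N m : nat) (hN : (2 <= N)%N)
  (hm : (2 <= m)%N) (W : 'rV[R]_N -> R) (p : 'I_m -> 'rV[R]_N)
  (hW : multiwell W p) (j k : 'I_m) (hjk : j <> k)
  (gamma : R -> 'rV[R]_N)
  (hgamma : minimizing_geodesic W (range p) (p j) (p k) gamma)
  (J : nat) (hJ : (2 <= J)%N) (t : nat -> R) (ht1 : t 1%N = 0) (htJ : t J = 1)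
  (ht_incr : forall i : nat, (1 <= i < J)%N -> t i < t i.+1)
  (ht_times : forall s : R, well_times (range p) gamma s <->
     exists2 i : nat, (1 <= i <= J)%N & s = t i)
  (i : nat) (hi : (1 <= i < J)%N) :
  exists U : R -> 'rV[R]_N,
    minimizing_heteroclinic W (range p) (gamma (t i)) (gamma (t i.+1)) U.
Proof.
have [_ [gL _ _ gmin]] := hgamma.
have /andP[i1 iJ] := hi.
have incr a b : (1 <= a)%N -> (a <= b)%N -> (b <= J)%N -> t a <= t b.
  move=> a1; elim: b => [|b IH]; first by rewrite leqn0 => /eqP E; move: a1; rewrite E.
  rewrite leq_eqVlt => /orP[/eqP -> //|ab] bJ.
  apply: le_trans (IH ab (ltnW bJ)) (ltW (ht_incr b _)).
  by rewrite bJ (leq_trans a1 ab).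
have well b : (1 <= b <= J)%N -> range p (gamma (t b)).
  by move=> bI; have [] : well_times (range p) gamma (t b) by apply/ht_times; exists b.
apply: (geodesic_arc_heteroclinic hW gL gmin).
- by rewrite -ht1; apply: incr => //; exact: ltnW.
- exact: ht_incr.
- by rewrite -htJ; apply: incr.
- by apply: well; rewrite i1 ltnW.
- by apply: well; rewrite iJ.
move=> s /andP[s1 s2] Zs.
have s0 : 0 <= s by rewrite -ht1 (le_trans _ (ltW s1))//; apply: incr => //; exact: ltnW.
have s1' : s <= 1 by rewrite -htJ (le_trans (ltW s2))//; apply: incr.
have [|b /andP[b1 bJ] sE] := (ht_times s).1; first by split => //; rewrite s0 s1'.
have [bi|ib] := leqP b i.
  by have := lt_le_trans s1 (le_trans _ (incr b i b1 bi (ltnW iJ))); rewrite sE ltxx => /(_ (lexx _)).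
by have := lt_le_trans s2 (incr i.+1 b isT ib bJ); rewrite sE ltxx.
Qed.
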